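(* Let $K$ be a knot in $S^3$ with knot state $Z_K=(Z_k(E_K)\in\mathcal H_k)_{k\in\mathbb Z_{>0}}$. Assume: (i) $\pi(\operatorname{MS}(Z_k(E_K)))\subset r(\mathcal M(E_K))$; (ii) every regular point of $\mathbb R\lambda$ has an open neighborhood $V$ in $E$ such that $V\cap\mathbb R\lambda$ consists of regular points and $$Z_k(E_K)(x)=e^{im'\frac\pi4}\Bigl(\frac k{2\pi}\Bigr)^{1/4}t_\lambda^k(x)\otimes f(x,k)\Omega_\lambda+O(k^{-\infty}),\qquad x\in V,$$ where $m'$ is an integer, $t_\lambda$ is the holomorphic section of $L$ restricting to $1$ on $\mathbb R\lambda$, $\Omega_\lambda\in\delta$ satisfies $\varphi(\Omega_\lambda^{\otimes2})(\lambda)=1$, and $f(\cdot,k)\in\mathcal C^\infty(V)$ has an asymptotic expansion $f_0+k^{-1}f_1+\dots$ for the $\mathcal C^\infty$ topology with coefficients $f_i$ holomorphic on $V$ and $f_0(q\lambda)=\frac1{\sqrt2}\frac{\sigma-\sigma^{-1}}{\Delta_K(\sigma^2)}$ with $\sigma=e^{2i\pi q}$, for all $q\lambda\in V$. Let $\epsilon>0$ be such that $$\pi^{-1}\bigl(r(\mathcal M^{\mathrm{irr}}(E_K))\bigr)\cap\bigl((-\epsilon,\epsilon)\lambda+\mathbb R\mu\bigr)=\emptyset$$ and $\Delta_K(e^{2i\pi q})\ne0$ for all $q\in(-\epsilon,\epsilon)$. Then there is a fixed integer $m$ such that for any $\eta\in(0,\epsilon)$ there exists $C$ such that for all integers $k>0$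 and $\ell$ with $|\ell|\le k\eta$, $$\Bigl|\langle Z_k(E_K),\Psi_\ell\rangle-\frac{e^{im\frac\pi4}}{2k^{1/2}}\,\frac{\sigma-\sigma^{-1}}{\Delta_K(\sigma^2)}\Bigr|\le Ck^{-3/2},\qquad \sigma=\exp(i\pi\ell/k).$$
   Context: **Quantization.** For a knot $K\subset S^3$, let $N_K$ be a closed tubular neighborhood, $\Sigma=\partial N_K$, $E_K$ the closure of the complement of $N_K$; $E=H_1(\Sigma,\mathbb R)$, $\omega(x,y)=4\pi(x\cdot y)$, $R=H_1(\Sigma,\mathbb Z)$. $\mu,\lambda\in R$ are the classes of the meridian and the (zero-linking) longitude, oriented with $\mu\cdot\lambda=1$. $L$ is the trivial Hermitian line bundle over $E$ with connection $d+\frac1i\alpha$, $\alpha_x(y)=\frac12\omega(x,y)$; $j$ is a linear complex structure on $E$ compatible with $\omega$ ($\omega(x,jx)>0$); $K_j=\{\alpha\in E^*\otimes\mathbb C:\alpha(j\cdot)=i\alpha\}$ with $|\alpha|^2=i\alpha\wedge\bar\alpha/\omega$; $\delta$ is a half-form line, i.e. a complex line with an isomorphism $\varphi:\delta^{\otimes2}\to K_j$, made an isometry, also viewed as a trivial holomorphic line bundle over $E$. Sections $\Psi$ of $L^k$ or $L^k\otimes\delta$ are holomorphic if $Z.\Psi+\frac ki\alpha(Z)\Psi=0$ for anti-holomorphic $Z$. $(T_x^*\Psi)(y)=\exp(-i\frac k2\omega(x,y))\Psi(x+y)$. $\mathcal H_k$ is the space of holomorphic sections of $L^k\otimes\delta$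 with $T^*_x\Psi=\Psi$ for $x\in R$, with scalar product $\langle\Psi_1,\Psi_2\rangle=\int_D\langle\Psi_1,\Psi_2\rangle_\delta|\omega|$ over a fundamental domain $D$. Choose $\Omega_\mu\in\delta$ with $\varphi(\Omega_\mu^{\otimes 2})(\mu)=1$. $(\Psi_\ell)_{\ell\in\mathbb Z/2k\mathbb Z}$ is the unique orthonormal basis of $\mathcal H_k$ with $T^*_{\mu/2k}\Psi_\ell=e^{i\ell\pi/k}\Psi_\ell$, $T^*_{\lambda/2k}\Psi_\ell=\Psi_{\ell+1}$, $\Psi_0(0)=(\frac k{2\pi})^{1/4}\Omega_\mu\sum_{n\in\mathbb Z}e^{2i\pi kn^2\tau}$, where $\tau=\alpha'+i\beta'$ with $\lambda=\alpha'\mu+\beta'j\mu$. **Knot state.** The knot state (image of the TQFT vector of $E_K$ in $\mathcal H_k$) is $$Z_k(E_K)=\frac{\sin(\pi/k)}{\sqrt k}\sum_{\ell\in\mathbb Z/2k\mathbb Z}J_\ell^K(-e^{i\pi/2k})\Psi_\ell,$$ where $J^K_\ell\in\mathbb C[t^{\pm1}]$ is the colored Jones polynomial; $J^K_\ell=\langle T_\ell(K)\rangle$ with $\langle\cdot\rangle$ the Kauffman bracket ($A=t$, empty link $\mapsto1$), $K$ zero-framed, $T_0=0,T_1=1,T_{\ell+1}+xT_\ell+T_{\ell-1}=0$ and $x^i$ standing for $i$ parallel strands; $J_{-\ell}^K=-J_\ell^K$, and $J^K_{\ell+2k}(-e^{i\pi/2k})=J^K_\ell(-e^{i\pi/2k})$.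 **Microsupport.** A family $(\xi_k\in\mathcal H_k)$ is $O(k^{-\infty})$ on an open $U\subset E$ if every $x\in U$ has a neighborhood $V$ and positive numbers $(C_M)$ with $|\xi_k(y)|\le C_Mk^{-M}$ for all $y\in V$, $M$, $k$. $\operatorname{MS}(\xi_k)$ is the smallest closed subset $F$ of $E$ such that $(\xi_k)$ is $O(k^{-\infty})$ on $E\setminus F$. **Moduli spaces and regular points.** For a compact manifold $X$, $\mathcal M(X)$ is the set of conjugacy classes of representations $\pi_1(X)\to\mathrm{SU}_2$, $\mathcal M^{\mathrm{irr}}(E_K)\subset\mathcal M(E_K)$ the irreducible ones, $r:\mathcal M(E_K)\to\mathcal M(\Sigma)$ the restriction, $\pi:E\to\mathcal M(\Sigma)$, $\pi(x)(\gamma)=\exp((\gamma\cdot x)D)$ with $D=\operatorname{diag}(2i\pi,-2i\pi)$. $\Delta_K$ is the Alexander polynomial normalized by $\Delta_K(1)=1$, $\Delta_K(t^{-1})=\Delta_K(t)$. A point $q\lambda\in\mathbb R\lambda$ is regular if $\Delta_K(e^{4i\pi q})\neq0$ and some neighborhood of $\pi(q\lambda)$ in $\mathcal M(\Sigma)$ does not meet $r(\mathcal M^{\mathrm{irr}}(E_K))$. *)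

(* Defs.v *)
From HB Require Import structures.
From mathcomp Require Import all_boot all_order all_algebra.
From mathcomp Require Import spectral complex.
From mathcomp Require Import all_classical all_reals all_analysis.

Set Implicit Arguments.
Unset Strict Implicit.
Unset Printing Implicit Defensive.

Import Order.TTheory GRing.Theory Num.Theory.
Import numFieldNormedType.Exports.

Local Open Scope classical_set_scope.
Local Open Scope ring_scope.
Local Open Scope complex_scope.

(** * Link diagrams and the Kauffman bracket

  Each crossing [c] of a diagram has four ends [(c, d)], numbered
  counterclockwise by [d : 'Z_4]; the under strand joins the ends 0 and 2, the
  over strand joins the ends 1 and 3.  A (possibly multi-component, unoriented)
  diagram is given by the involution of the set of ends that joins the two
  ends of every edge. *)

Definition opp_end (X : Type) (x : X * 'Z_4) : X * 'Z_4 := (x.1, x.2 + 2).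

Definition rot_end (X : Type) (x : X * 'Z_4) : X * 'Z_4 := (x.1, x.2 + 1).

(* Turning the over strand counterclockwise sweeps the regions between the
   ends 1, 2 and 3, 0.  The A-smoothing merges these two regions, hence joins
   0 with 1 and 2 with 3; the B-smoothing joins 0 with 3 and 1 with 2. *)
Definition smooth_end (a : bool) (d : 'Z_4) : 'Z_4 :=
  (if a then 1 else 3) - d.

Definition loops (X : finType) (e : X * 'Z_4 -> X * 'Z_4)
    (s : {ffun X -> bool}) : nat :=
  n_comp [rel x y | (y == e x) || (y == (x.1, smooth_end (s x.1) x.2))] predT.

(* The value at [A] of the Kauffman bracket, as a state sum; the empty link
   has bracket 1. *)
Definition bracket (F : comUnitRingType) (X : finType)
    (e : X * 'Z_4 -> X * 'Z_4) (A : F) : F :=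
  \sum_(s : {ffun X -> bool})
    (\prod_(x : X) (if s x then A else A^-1)) *
    (- A ^+ 2 - A ^- 2) ^+ loops e s.

(** * Knots

  A knot in the oriented 3-sphere is given by an oriented planar diagram.
  The under strand at [c] runs from the end 0 to the end 2; the over strand
  runs from 3 to 1 when the crossing is positive, from 1 to 3 when it is
  negative.  Planarity is the Euler characteristic count: with
  [n = ncross.+1] crossings there are [2 * n] edges, hence [n + 2] faces, the
  faces being the cycles of "follow the edge, then turn to the next end".
  We take diagrams with at least one crossing and with writhe 0: every knot
  has such a diagram, and its blackboard framing is the zero framing. *)

Definition outgoing (X : Type) (pos : pred X) (x : X * 'Z_4) : bool :=
  (x.2 == 2) || (x.2 == (if pos x.1 then 1 else 3)).

Record knot := Knot {
  ncross : nat;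
  edge : 'I_ncross.+1 * 'Z_4 -> 'I_ncross.+1 * 'Z_4;
  positive : pred 'I_ncross.+1;
  edgeK : involutive edge;
  edge_oriented : forall x, outgoing positive (edge x) = ~~ outgoing positive x;
  one_component : forall x y, outgoing positive x -> outgoing positive y ->
    fconnect (fun z => opp_end (edge z)) x y;
  planar : fcard (fun x => rot_end (edge x)) predT = ncross.+3;
  writhe0 : (2 * #|[pred c | positive c]| = ncross.+1)%N
}.

Definition crossing (K : knot) : finType := 'I_(ncross K).+1.
Definition dart (K : knot) : finType := (crossing K * 'Z_4)%type.

(* The [m.+1]-parallel of a diagram: the crossing [c] becomes a square grid of
   crossings.  The position of a small crossing in the grid is recorded as
   seen from side 0: its distance to that side and its rank from left to right
   when facing outwards.  [turn] passes to the description from the next side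
   counterclockwise.  The strand leaving a side at rank [r] from the left
   arrives at the side across the edge at rank [rev_ord r]. *)
Definition turn (m : nat) (p : 'I_m.+1 * 'I_m.+1) : 'I_m.+1 * 'I_m.+1 :=
  (p.2, rev_ord p.1).

Definition parallel_crossing (K : knot) (m : nat) : finType :=
  (crossing K * ('I_m.+1 * 'I_m.+1))%type.

Definition parallel_edge (K : knot) (m : nat)
    (x : parallel_crossing K m * 'Z_4) : parallel_crossing K m * 'Z_4 :=
  let: ((c, p), d) := x in
  let v := iter d (@turn m) p in
  if v.1 == ord0 then
    let y := edge (c, d) in
    ((y.1, iter (4 - y.2) (@turn m) (ord0, rev_ord v.2)), y.2)
  else ((c, iter (4 - d) (@turn m) (inord (v.1).-1, v.2)), d + 2).

(* The bracket of [i] parallel strands along the zero-framed knot. *)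
Definition parallel_bracket (F : comUnitRingType) (K : knot) (i : nat) (A : F)
    : F :=
  if i is m.+1 then bracket (@parallel_edge K m) A else 1.

(* [T_l], with [x] the variable of the polynomial. *)
Fixpoint cabling_poly (l : nat) : {poly int} :=
  match l with
  | 0 => 0
  | 1 => 1
  | (l''.+1 as l').+1 => - ('X * cabling_poly l') - cabling_poly l''
  end.

(* The value at [A] of the Laurent polynomial [J_l]. *)
Definition colored_jones (F : comUnitRingType) (K : knot) (l : nat) (A : F)
    : F :=
  \sum_(i < size (cabling_poly l)) ((cabling_poly l)`_i)%:~R * parallel_bracket K i A.

(** * The Alexander polynomial

  [arc_eq] identifies the darts lying on the same arc, an arc running from an
  undercrossing to the next one; the arcs are indexed by the crossing from
  which they start.  The rows of [alexander_mx] are the abelianized Fox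
  derivatives of the Wirtinger relations of [knot_rep] below. *)

Definition arc_eq (K : knot) : rel (dart K) :=
  connect [rel x y : dart K |
    (y == edge x) || (odd x.2 && (y == opp_end x))].

Definition alexander_mx (K : knot) : 'M[{poly int}]_((ncross K).+1) :=
  \matrix_(c, c')
    let on_arc (d : 'Z_4) : {poly int} :=
      (arc_eq (K := K) (c, d) (c', 2))%:R in
    (1 - 'X) * on_arc 1 +
      (if positive c then 'X * on_arc 2 - on_arc 0
       else 'X * on_arc 0 - on_arc 2).

(* The Laurent polynomial [t^-d * P(t)] is the normalized Alexander polynomial
   of [K]: it equals a first minor of [alexander_mx] up to a unit of
   [Z[t, t^-1]], takes the value 1 at 1, and is invariant under [t -> t^-1]. *)
Definition is_alexander (K : knot) (P : {poly int}) (d : nat) : Prop :=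
  [/\ exists (b : bool) (s s' : nat),
        'X^s * P =
        (-1) ^+ b * 'X^s' * \det (row' ord0 (col' ord0 (alexander_mx K))),
      P.[1] = 1,
      (size P <= (2 * d).+1)%N &
      forall i : nat, (i <= 2 * d)%N -> P`_i = P`_(2 * d - i)].

Definition laurent_eval (F : fieldType) (P : {poly int}) (d : nat) (z : F) : F :=
  (map_poly intr P).[z] / z ^+ d.

(** * Representation spaces *)

Definition SU2 (R : realType) : set 'M[R[i]]_2 :=
  [set U | U \is unitarymx /\ \det U = 1].

Definition conj_class (R : realType) (I : Type) (rho : I -> 'M[R[i]]_2)
    : set (I -> 'M[R[i]]_2) :=
  [set rho' | exists2 g, @SU2 R g &
     rho' = (fun x => g *m rho x *m invmx g)].

(* Representations of the knot group, given on the generators of the Wirtinger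
   presentation.  The generator of [x] is the meridian of the edge through
   [x] with linking number 1 with the knot (base point above the diagram); in
   a product the left factor is the loop run first. *)
Definition knot_rep (R : realType) (K : knot) : set (dart K -> 'M[R[i]]_2) :=
  [set rho |
    [/\ forall x, SU2 (rho x),
        forall x, rho (edge x) = rho x,
        forall c, rho (c, 1) = rho (c, 3) &
        forall c, if positive c
          then rho (c, 1) *m rho (c, 2) = rho (c, 0) *m rho (c, 1)
          else rho (c, 2) *m rho (c, 1) = rho (c, 1) *m rho (c, 0)]].

Definition irreducible_rep (R : realType) (I : Type) (rho : I -> 'M[R[i]]_2)
    : Prop :=
  forall v : 'cV[R[i]]_2, v != 0 ->
    ~ (forall x, exists a : R[i], rho x *m v = a *: v).

Definition knot_moduli (R : realType) (K : knot)
    : set (set (dart K -> 'M[R[i]]_2)) :=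
  [set conj_class rho | rho in @knot_rep R K].

Definition knot_moduli_irr (R : realType) (K : knot)
    : set (set (dart K -> 'M[R[i]]_2)) :=
  [set conj_class rho | rho in
     [set rho | knot_rep rho /\ irreducible_rep rho]].

(* Generators of the fundamental group of the peripheral torus. *)
Variant peripheral := Mer | Lon.

Definition torus_rep (R : realType) : set (peripheral -> 'M[R[i]]_2) :=
  [set rho | (forall g, SU2 (rho g)) /\
             rho Mer *m rho Lon = rho Lon *m rho Mer].

(* The peripheral pair is based on the edge leaving the under strand of
   crossing 0.  The blackboard longitude goes under the over strands met by
   the under strand of the knot; it has linking number 0 since the writhe is 0. *)
Definition base_dart (K : knot) : dart K := (ord0, 2).

Definition longitude (R : realType) (K : knot) (rho : dart K -> 'M[R[i]]_2)
    : 'M[R[i]]_2 :=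
  \big[mulmx/1%:M]_(x <- traject (fun z : dart K => opp_end (edge z))
                           (base_dart K) (2 * (ncross K).+1))
    let: (c, d) := edge x in
    if d == 0 then
      if positive c then rho (c, 1) else invmx (rho (c, 1))
    else 1%:M.

(* The condition [mu . lambda = 1] refers to an orientation of the peripheral
   torus.  It makes the linking number of the meridian with the knot equal to
   1 if the torus is oriented as the boundary of the neighborhood of the knot
   ([ori = true]), and to -1 if it is oriented as the boundary of the knot
   exterior ([ori = false]). *)
Definition peripheral_rep (R : realType) (K : knot) (ori : bool)
    (rho : dart K -> 'M[R[i]]_2) : peripheral -> 'M[R[i]]_2 :=
  fun g => match g with
    | Mer => if ori then rho (base_dart K) else invmx (rho (base_dart K))
    | Lon => longitude rho
    end.

Definition restriction (R : realType) (K : knot) (ori : bool)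
    (c : set (dart K -> 'M[R[i]]_2)) : set (peripheral -> 'M[R[i]]_2) :=
  [set peripheral_rep ori rho | rho in c].

(* Open subsets of the moduli space of the torus for the quotient topology. *)
Definition open_torus_moduli (R : realType)
    (N : set (set (peripheral -> 'M[R[i]]_2))) : Prop :=
  N `<=` [set conj_class rho | rho in @torus_rep R] /\
  forall rho, torus_rep rho -> N (conj_class rho) ->
    exists2 eps : R, 0 < eps & forall rho', torus_rep rho' ->
      (forall g a b, `|rho' g a b - rho g a b| < eps%:C) ->
      N (conj_class rho').

(** * The symplectic plane

  [H_1(Sigma, R)] is identified with [R * R] by the basis (mu, lambda). *)

Definition mu (R : realType) : R * R := (1, 0).
Definition lam (R : realType) : R * R := (0, 1).

Definition inter (R : realType) (x y : R * R) : R := x.1 * y.2 - x.2 * y.1.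
Definition omega (R : realType) (x y : R * R) : R := 4 * pi * inter x y.

Definition cexp (R : realType) (z : R[i]) : R[i] :=
  (expR (complex.Re z))%:C * (cos (complex.Im z) +i* sin (complex.Im z)).

Definition torus_point (R : realType) (x : R * R)
    : set (peripheral -> 'M[R[i]]_2) :=
  conj_class (fun g =>
    let gamma := if g is Mer then mu R else lam R in
    let t : R[i] := 2 * pi%:C * 'i * (inter gamma x)%:C in
    \matrix_(a, b) if a == b then cexp (if a == 0 then t else - t) else 0).

Definition regular_point (R : realType) (K : knot) (ori : bool)
    (P : {poly int}) (d : nat) (q : R) : Prop :=
  laurent_eval P d (cexp (4 * 'i * pi%:C * q%:C)) != 0 /\
  exists N, [/\ open_torus_moduli N, N (torus_point (q *: lam R)) &
    N `&` (restriction ori @` @knot_moduli_irr R K) = set0].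

(** * Smooth and holomorphic functions *)

Definition cderive (R : realType) (v : R * R) (f : R * R -> R[i])
    : R * R -> R[i] :=
  fun x => 'D_v (fun y => complex.Re (f y)) x +i* 'D_v (fun y => complex.Im (f y)) x.

Definition iter_cderive (R : realType) (s : seq (R * R)) (f : R * R -> R[i])
    : R * R -> R[i] :=
  foldr (@cderive R) f s.

Definition smooth_on (R : realType) (U : set (R * R)) (f : R * R -> R[i])
    : Prop :=
  forall (s : seq (R * R)) x, U x ->
    differentiable (fun y => complex.Re (iter_cderive s f y)) x /\
    differentiable (fun y => complex.Im (iter_cderive s f y)) x.

Definition compatible_structure (R : realType)
    (j : {linear (R * R)%type -> (R * R)%type}) : Prop :=
  (forall x, j (j x) = - x) /\ (forall x, x != 0 -> 0 < omega x (j x)).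

Definition alphaL (R : realType) (x y : R * R) : R := omega x y / 2.

(* Holomorphic sections of [L^k] over [U]; the anti-holomorphic vectors are
   the [y + i j y].  For [k = 0] these are the holomorphic functions. *)
Definition holo_on (R : realType) (j : R * R -> R * R) (k : nat)
    (U : set (R * R)) (f : R * R -> R[i]) : Prop :=
  smooth_on U f /\
  forall x y, U x ->
    (cderive y f x + 'i * cderive (j y) f x) +
    (k%:R / 'i) * ((alphaL x y)%:C + 'i * (alphaL x (j y))%:C) * f x = 0.

(** * Half-forms *)

Definition is_Kj (R : realType) (j : R * R -> R * R) (a : R * R -> R[i])
    : Prop :=
  (forall (t : R) x y, a (t *: x + y) = t%:C * a x + a y) /\
  (forall x, a (j x) = 'i * a x).

Definition Kj_normsq (R : realType) (a : R * R -> R[i]) : R[i] :=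
  'i * (a (mu R) * conjc (a (lam R)) - a (lam R) * conjc (a (mu R))) /
  (omega (mu R) (lam R))%:C.

(* A complex line [delta] with a Hermitian product and an isometric
   isomorphism from [delta (x) delta] to [K_j], seen as a bilinear map. *)
Record half_form (R : realType) (j : R * R -> R * R) (delta : lmodType R[i]) :=
  HalfForm {
  phi : delta -> delta -> R * R -> R[i];
  herm : delta -> delta -> R[i];
  delta_line : exists2 u : delta, u != 0 & forall v, exists a, v = a *: u;
  phi_linl : forall a u v w x, phi (a *: u + v) w x = a * phi u w x + phi v w x;
  phi_linr : forall a u v w x, phi w (a *: u + v) x = a * phi w u x + phi w v x;
  phi_Kj : forall u v, is_Kj j (phi u v);
  phi_neq0 : forall u v, u != 0 -> v != 0 -> exists x, phi u v x != 0;
  herm_lin : forall a u v w, herm (a *: u + v) w = a * herm u w + herm v w;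
  herm_sym : forall u v, herm v u = conjc (herm u v);
  herm_ge0 : forall u, 0 <= herm u u;
  phi_isometry : forall u v, Kj_normsq (phi u v) = herm u u * herm v v
}.

Definition hnorm (R : realType) (j : R * R -> R * R) (delta : lmodType R[i])
    (h : half_form j delta) (u : delta) : R :=
  Num.sqrt (complex.Re (herm h u u)).

(** * The quantum spaces *)

Definition translate (R : realType) (delta : lmodType R[i]) (k : nat)
    (x : R * R) (Psi : R * R -> delta) : R * R -> delta :=
  fun y => cexp (- 'i * (k%:R / 2) * (omega x y)%:C) *: Psi (x + y).

Definition lattice (R : realType) : set (R * R) :=
  [set x | exists a b : int, x = (a%:~R, b%:~R)].

Definition Hk (R : realType) (j : R * R -> R * R) (delta : lmodType R[i])
    (k : nat) : set (R * R -> delta) :=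
  [set Psi |
    (exists (u : delta) (g : R * R -> R[i]),
       holo_on j k setT g /\ Psi = (fun x => g x *: u)) /\
    (forall x, lattice x -> translate k x Psi = Psi)].

Definition unit_square (R : realType) : set (R * R) := `[0, 1[ `*` `[0, 1[.

Definition plane_measure (R : realType) :=
  ((@lebesgue_measure R) \x (@lebesgue_measure R))%E.

(* [|omega|] is [|omega(mu, lambda)|] times the Lebesgue measure in the
   coordinates of the basis (mu, lambda). *)
Definition scalar_product (R : realType) (j : R * R -> R * R)
    (delta : lmodType R[i]) (h : half_form j delta)
    (Psi1 Psi2 : R * R -> delta) : R[i] :=
  `|omega (mu R) (lam R)|%:C *
  (Rintegral (@plane_measure R) (@unit_square R)
     (fun x => complex.Re (herm h (Psi1 x) (Psi2 x)))
   +i*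
   Rintegral (@plane_measure R) (@unit_square R)
     (fun x => complex.Im (herm h (Psi1 x) (Psi2 x)))).

Definition sumZ (R : realType) (u : int -> R[i]) : R[i] :=
  let S (N : nat) := \sum_(i < N.*2.+1) u (i%:Z - N%:Z) in
  limn (fun N => complex.Re (S N)) +i* limn (fun N => complex.Im (S N)).

Definition theta_basis (R : realType) (j : R * R -> R * R)
    (delta : lmodType R[i]) (h : half_form j delta) (tau : R[i])
    (Omega_mu : delta) (k : nat) (Psi : 'Z_(2 * k) -> R * R -> delta) : Prop :=
  [/\ forall l, Hk j k (Psi l),
      forall l l', scalar_product h (Psi l) (Psi l') = (l == l')%:R,
      forall xi, Hk j k xi -> exists c : 'Z_(2 * k) -> R[i],
        xi = (fun x => \sum_l c l *: Psi l x),
      (forall l, translate k ((2 * k%:R)^-1 *: mu R) (Psi l) =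
         (fun x => cexp ('i * l%:R * pi%:C / k%:R) *: Psi l x)) /\
      (forall l, translate k ((2 * k%:R)^-1 *: lam R) (Psi l) = Psi (l + 1)) &
      Psi 0 0 =
        (((k%:R / (2 * pi)) `^ 4^-1)%:C *
         sumZ (fun n => cexp (2 * 'i * pi%:C * k%:R * n%:~R ^+ 2 * tau)))
        *: Omega_mu].

(* The sum over [Z/2kZ] uses the representatives [0, ..., 2k - 1]. *)
Definition knot_state (R : realType) (delta : lmodType R[i]) (K : knot)
    (k : nat) (Psi : 'Z_(2 * k) -> R * R -> delta) : R * R -> delta :=
  fun x => (sin (pi / k%:R) / Num.sqrt k%:R)%:C *:
    \sum_(l : 'Z_(2 * k))
      colored_jones K l (- cexp ('i * pi%:C / (2 * k%:R))) *: Psi l x.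

(** * Semi-classical notions *)

Definition rapidly_small (R : realType) (j : R * R -> R * R)
    (delta : lmodType R[i]) (h : half_form j delta)
    (xi : nat -> R * R -> delta) (U : set (R * R)) : Prop :=
  forall x, U x -> exists (V : set (R * R)) (C : nat -> R),
    [/\ nbhs x V, forall M, 0 < C M &
        forall (k M : nat) y, (0 < k)%N -> V y ->
          hnorm h (xi k y) <= C M * k%:R ^- M].

Definition microsupport (R : realType) (j : R * R -> R * R)
    (delta : lmodType R[i]) (h : half_form j delta)
    (xi : nat -> R * R -> delta) : set (R * R) :=
  smallest (fun F => closed F /\ rapidly_small h xi (~` F)) set0.

Definition smooth_expansion (R : realType) (V : set (R * R))
    (f : nat -> R * R -> R[i]) (fcoef : nat -> R * R -> R[i]) : Prop :=
  forall (N : nat) (s : seq (R * R)) (B : set (R * R)),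
    compact B -> B `<=` V -> exists C : R, forall (k : nat) x,
      (0 < k)%N -> B x ->
      `|iter_cderive s
          (fun y => f k y - \sum_(i < N) k%:R ^- i * fcoef i y) x|
      <= (C * k%:R ^- N)%:C.

(* Main.v *)
Require Import Defs.
From HB Require Import structures.
From mathcomp Require Import all_boot all_order all_algebra.
From mathcomp Require Import spectral complex.
From mathcomp Require Import all_classical all_reals all_analysis.
From mathcomp Require Import measurable_realfun.
From mathcomp Require Import ring lra zify.

Set Implicit Arguments.
Unset Strict Implicit.
Unset Printing Implicit Defensive.

Import Order.TTheory GRing.Theory Num.Theory.
Import numFieldNormedType.Exports.

Local Open Scope classical_set_scope.
Local Open Scope ring_scope.
Local Open Scope complex_scope.

(** The coefficient of the knot state on [Psi l] is read off from its values on
    a single transverse segment. The basis diagonalizes the translations by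
    mu / 2k, so averaging the 2k translates of the state against a character
    isolates one coefficient; at the height q = - l / 2k all the phases are
    explicit and only the points (a / 2k, q) with - k <= a < k intervene
    ([extraction], [scalar_product_coefficient]).

    In the strip |x.2| < eps the microsupport lies over integral first
    coordinates. Indeed no irreducible character restricts to the strip, and a
    reducible representation is trivial on the longitude, because all meridians
    coincide and the writhe is 0 ([reducible_longitude], [knot_moduli_abelian]).
    Away from the line of lambda the segment thus contributes a negligible
    amount ([far_small]). Every point q lambda with |q| < eps / 2 is regular
    ([strip_regular]), so near the line the state is
    (k / 2 pi)^(1/4) t_lambda^k times a smooth amplitude. The Cauchy-Riemann
    equation in the coordinates s mu + q lambda shows that t_lambda has contact
    to all orders with exp(- 2 pi i s q - c s^2), where c = 2 pi i / tau
    ([flat_section_power]). The character of the average cancels the oscillating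
    factor, and there remains a Gaussian sum with summand exp(- c a^2 / 4k).
    Adding the terms a and - a removes the first-order variation of the
    amplitude ([segment_sum]), so that relative errors are O(1/k) and the
    coefficient is the value of the amplitude on the line times the Gaussian
    sum ([local_coefficient]).

    The Gaussian sum with complex parameter is equivalent to sqrt(4 pi k / c)
    ([complex_gauss_sum]). For a real parameter it is compared with the Gaussian
    integral; the parameter is then moved along a path on which the sum, suitably
    normalized, has a small derivative, again by the midpoint rule. Since
    Omega_lambda = kappa Omega_mu with kappa^2 tau = 1, the product of kappa and
    of this square root does not depend on tau up to sign: its square is a
    multiple of - i, which explains the eighth root of unity
    ([amplitude_square], [eighth_root]).

    The phase given by the local description at q is an eighth root of unity
    that may depend on q. Two descriptions that overlap have the same phase, as
    the amplitude sigma - sigma^(-1) has isolated zeros, and the interval is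
    connected ([constant_phase]). Finally, |l| <= k eta puts q in the compact
    interval [- eta / 2, eta / 2], on which the constants can be chosen
    uniformly. *)

(** * Complex modulus and complex exponential *)

Section ComplexModulus.
Context {R : realType}.
Implicit Types (z w : R[i]) (x y : R).

(** The norm of a complex number is itself a complex number here; estimates are
    made in the ordered field R instead. *)
Definition cmod z : R := complex.Re `|z|.

Lemma normE z : `|z| = (cmod z)%:C.
Proof. by rewrite /cmod normc_def. Qed.

Lemma cmodE z : cmod z = Num.sqrt (complex.Re z ^+ 2 + complex.Im z ^+ 2).
Proof. by rewrite /cmod normc_def. Qed.

Lemma cmod_ge0 z : 0 <= cmod z.
Proof. by rewrite cmodE sqrtr_ge0. Qed.

Lemma cmodM z w : cmod (z * w) = cmod z * cmod w.
Proof. by apply: complexI; rewrite rmorphM /= -!normE normrM. Qed.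

Lemma cmodD z w : cmod (z + w) <= cmod z + cmod w.
Proof. by rewrite -lecR rmorphD -!normE ler_normD. Qed.

Lemma cmodN z : cmod (- z) = cmod z.
Proof. by apply: complexI; rewrite -!normE normrN. Qed.

Lemma cmodB z w : cmod (z - w) <= cmod z + cmod w.
Proof. by rewrite -(cmodN w) cmodD. Qed.

Lemma cmodBC z w : cmod (z - w) = cmod (w - z).
Proof. by rewrite -cmodN opprB. Qed.

Lemma cmod_triangle z w u : cmod (z - u) <= cmod (z - w) + cmod (w - u).
Proof. by apply: le_trans (cmodD _ _); rewrite addrA subrK. Qed.

Lemma cmod0 : cmod 0 = 0.
Proof. by apply: complexI; rewrite -normE normr0. Qed.

Lemma cmodX z n : cmod (z ^+ n) = cmod z ^+ n.
Proof. by apply: complexI; rewrite rmorphXn /= -!normE normrX. Qed.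

Lemma cmodV z : cmod z^-1 = (cmod z)^-1.
Proof. by apply: complexI; rewrite fmorphV /= -!normE normfV. Qed.

Lemma cmod_eq0 z : (cmod z == 0) = (z == 0).
Proof. by rewrite -(inj_eq (@complexI R)) /= -normE normr_eq0. Qed.

Lemma cmod_gt0 z : (0 < cmod z) = (z != 0).
Proof. by rewrite lt_def cmod_ge0 cmod_eq0 andbT. Qed.

Lemma cmodR x : cmod x%:C = `|x|.
Proof. by rewrite cmodE /= expr0n /= addr0 sqrtr_sqr. Qed.

Lemma cmod_nat n : cmod n%:R = n%:R.
Proof. by rewrite -(rmorph_nat (real_complex R)) cmodR normr_nat. Qed.

Lemma cmodI : cmod 'i = 1.
Proof. by rewrite cmodE /= expr0n /= add0r expr1n sqrtr1. Qed.

Lemma Re_le_cmod z : `|complex.Re z| <= cmod z.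
Proof. by rewrite -lecR -normE normc_ge_Re. Qed.

Lemma Im_le_cmod z : `|complex.Im z| <= cmod z.
Proof.
by rewrite cmodE -(sqrtr_sqr (complex.Im z)) ler_sqrt ?addr_ge0 ?sqr_ge0//
  lerDr sqr_ge0.
Qed.

Lemma cmod_le_ReIm z : cmod z <= `|complex.Re z| + `|complex.Im z|.
Proof.
rewrite [z in cmod z]complexE (le_trans (cmodD _ _))// cmodM cmodI mul1r.
by rewrite !cmodR.
Qed.

Lemma cmod_sum (I : Type) (r : seq I) (P : pred I) (F : I -> R[i]) :
  cmod (\sum_(i <- r | P i) F i) <= \sum_(i <- r | P i) cmod (F i).
Proof.
elim/big_rec2: _ => [|i y z _ le_yz]; first by rewrite cmod0.
by rewrite (le_trans (cmodD _ _))// lerD2l.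
Qed.

Lemma ReM z w : complex.Re (z * w) =
  complex.Re z * complex.Re w - complex.Im z * complex.Im w.
Proof. by case: z w => [a b] [c d]. Qed.

Lemma ImM z w : complex.Im (z * w) =
  complex.Re z * complex.Im w + complex.Im z * complex.Re w.
Proof. by case: z w => [a b] [c d]. Qed.

Lemma ReD z w : complex.Re (z + w) = complex.Re z + complex.Re w.
Proof. by case: z w => [a b] [c d]. Qed.

Lemma ImD z w : complex.Im (z + w) = complex.Im z + complex.Im w.
Proof. by case: z w => [a b] [c d]. Qed.

Lemma ReN z : complex.Re (- z) = - complex.Re z.
Proof. by case: z. Qed.

Lemma ImN z : complex.Im (- z) = - complex.Im z.
Proof. by case: z. Qed.

Lemma Re_nat n : complex.Re (n%:R : R[i]) = n%:R.
Proof. by rewrite -(rmorph_nat (real_complex R)). Qed.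

Lemma Im_nat n : complex.Im (n%:R : R[i]) = 0.
Proof. by rewrite -(rmorph_nat (real_complex R)). Qed.

Lemma Re_int (n : int) : complex.Re (n%:~R : R[i]) = n%:~R.
Proof. by rewrite -(rmorph_int (real_complex R)). Qed.

Lemma Im_int (n : int) : complex.Im (n%:~R : R[i]) = 0.
Proof. by rewrite -(rmorph_int (real_complex R)). Qed.

Lemma Re_real x : complex.Re x%:C = x. Proof. by []. Qed.
Lemma Im_real x : complex.Im x%:C = 0. Proof. by []. Qed.
Lemma Re_i : complex.Re ('i : R[i]) = 0. Proof. by []. Qed.
Lemma Im_i : complex.Im ('i : R[i]) = 1. Proof. by []. Qed.
Lemma Re_conj z : complex.Re (conjc z) = complex.Re z. Proof. by case: z. Qed.
Lemma Im_conj z : complex.Im (conjc z) = - complex.Im z. Proof. by case: z. Qed.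
Lemma Re_1 : complex.Re (1 : R[i]) = 1. Proof. by []. Qed.
Lemma Im_1 : complex.Im (1 : R[i]) = 0. Proof. by []. Qed.
Lemma Re_cplx x y : complex.Re (x +i* y) = x. Proof. by []. Qed.
Lemma Im_cplx x y : complex.Im (x +i* y) = y. Proof. by []. Qed.

Definition ReImE :=  (ReM, ImM, ReD, ImD, ReN, ImN, Re_int, Im_int, Re_nat,
  Im_nat, Re_real, Im_real, Re_i, Im_i, Re_1, Im_1, Re_conj, Im_conj, Re_cplx, Im_cplx).

End ComplexModulus.

(* The literal 'i unfolds to a constructor applied to an unfolded zero, which
   the ring tactics do not recognize. *)
Ltac csimp := rewrite !ReImE -?[Algebra.hasZero.zero _]/(GRing.zero).

Section ComplexExponential.
Context {R : realType}.
Implicit Types (z w : R[i]) (x y : R).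

Lemma eqCP z w :
  complex.Re z = complex.Re w -> complex.Im z = complex.Im w -> z = w.
Proof. by case: z w => [a b] [c d] /= -> ->. Qed.

Lemma iiN1 : 'i * 'i = -1 :> R[i].
Proof. by rewrite -expr2 sqr_i. Qed.

Lemma i_neq0 : 'i != 0 :> R[i].
Proof. by rewrite -cmod_gt0 cmodI. Qed.

Lemma cexp0 : cexp (0 : R[i]) = 1.
Proof. by rewrite /cexp /= expR0 cos0 sin0 mul1r. Qed.

Lemma cexpD z w : cexp (z + w) = cexp z * cexp w.
Proof.
rewrite /cexp ReD ImD expRD cosD sinD; apply: eqCP; csimp; ring.
Qed.

Lemma cmod_cexp z : cmod (cexp z) = expR (complex.Re z).
Proof.
rewrite /cexp cmodM cmodR cmodE /= cos2Dsin2 sqrtr1 mulr1 ger0_norm// expR_ge0.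
Qed.

Lemma cexp_neq0 z : cexp z != 0.
Proof. by rewrite -cmod_gt0 cmod_cexp expR_gt0. Qed.

Lemma cexpN z : cexp (- z) = (cexp z)^-1.
Proof.
apply: (mulfI (cexp_neq0 z)); rewrite -cexpD subrr cexp0 mulfV//.
exact: cexp_neq0.
Qed.

Lemma cexpMn z n : cexp (n%:R * z) = cexp z ^+ n.
Proof.
elim: n => [|n IH]; first by rewrite mul0r cexp0 expr0.
by rewrite exprS -IH -cexpD -[in LHS]natr1 mulrDl mul1r addrC.
Qed.

Lemma cexpMz z (m : int) : cexp (m%:~R * z) = cexp z ^ m.
Proof.
case: m => n; first by rewrite -pmulrn cexpMn -exprnP.
by rewrite NegzE mulrNz mulNr cexpN -pmulrn cexpMn exprnN.
Qed.

Lemma cexp_2pi : cexp (2 * pi%:C * 'i : R[i]) = 1.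
Proof.
have -> : 2 * pi%:C * 'i = 0 +i* (pi *+ 2) :> R[i].
  by rewrite [in RHS]mulr2n; apply: eqCP; csimp; ring.
by rewrite /cexp Re_cplx Im_cplx expR0 cos2pi sin2pi mul1r.
Qed.

Lemma cexp_2piz (m : int) : cexp (m%:~R * (2 * pi%:C * 'i : R[i])) = 1.
Proof. by rewrite cexpMz cexp_2pi exp1rz. Qed.

Lemma cexp_real x : cexp x%:C = (expR x)%:C.
Proof. by rewrite /cexp /= cos0 sin0 mulr1. Qed.

End ComplexExponential.

(** * Complex-valued functions of a real variable *)

Section ComplexDerivative.
Context {R : realType}.
Implicit Types (f g : R -> R[i]) (x : R) (d : R[i]).

(** Encoded by real and imaginary parts, so that results on real functions
    apply to each. *)
Definition cder f x d : Prop :=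
  is_derive x 1 (fun t => complex.Re (f t)) (complex.Re d) /\
  is_derive x 1 (fun t => complex.Im (f t)) (complex.Im d).

Lemma is_derive_ext (f g : R -> R) x (a b : R) :
  is_derive x 1 f a -> f =1 g -> a = b -> is_derive x 1 g b.
Proof. by move=> df /funext <- <-. Qed.

Lemma cder_ext f g x d e : cder f x d -> f =1 g -> d = e -> cder g x e.
Proof. by move=> df /funext <- <-. Qed.

Lemma cderD f g x d e : cder f x d -> cder g x e ->
  cder (fun t => f t + g t) x (d + e).
Proof.
move=> [fr fi] [gr gi]; split.
  by apply: (is_derive_ext (is_deriveD fr gr)) => [t|]; rewrite ReD.
by apply: (is_derive_ext (is_deriveD fi gi)) => [t|]; rewrite ImD.
Qed.

Lemma cderM f g x d e : cder f x d -> cder g x e ->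
  cder (fun t => f t * g t) x (d * g x + f x * e).
Proof.
move=> [fr fi] [gr gi]; split.
  apply: (is_derive_ext (is_deriveB (is_deriveM fr gr) (is_deriveM fi gi))).
    by move=> t; rewrite ReM.
  by rewrite /GRing.scale /= !(ReD, ReM); ring.
apply: (is_derive_ext (is_deriveD (is_deriveM fr gi) (is_deriveM fi gr))).
  by move=> t; rewrite ImM.
by rewrite /GRing.scale /= !(ImD, ImM); ring.
Qed.

Lemma cder_cst x (c : R[i]) : cder (fun=> c) x 0.
Proof. by split; apply: is_derive_ext (is_derive_cst _ _ _) _ _. Qed.

Lemma cder_id x : cder (fun t => t%:C) x 1.
Proof.
split; first exact: is_derive_ext (is_derive_id _ _) _ _.
by apply: is_derive_ext (is_derive_cst 0 _ _) _ _.
Qed.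

Lemma cderZ f x d (c : R[i]) : cder f x d -> cder (fun t => c * f t) x (c * d).
Proof.
move=> df; apply: (cder_ext (cderM (cder_cst x c) df)) => //.
by rewrite mul0r add0r.
Qed.

Lemma cderN f x d : cder f x d -> cder (fun t => - f t) x (- d).
Proof.
by move=> df; apply: (cder_ext (cderZ (-1) df)) => [t|]; rewrite mulN1r.
Qed.

Lemma cderB f g x d e : cder f x d -> cder g x e ->
  cder (fun t => f t - g t) x (d - e).
Proof. by move=> df /cderN; exact: cderD. Qed.

Lemma cder_sum (I : Type) (r : seq I) (F : I -> R -> R[i]) (D : I -> R[i]) x :
  (forall i, cder (F i) x (D i)) ->
  cder (fun t => \sum_(i <- r) F i t) x (\sum_(i <- r) D i).
Proof.
move=> FD; elim: r => [|i r IH].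
  by apply: (cder_ext (cder_cst x 0)) => [t|]; rewrite big_nil.
by apply: (cder_ext (cderD (FD i) IH)) => [t|]; rewrite big_cons.
Qed.

Lemma cderX f x d n : cder f x d ->
  cder (fun t => f t ^+ n) x (n%:R * f x ^+ n.-1 * d).
Proof.
move=> df; elim: n => [|n IH].
  by apply: (cder_ext (cder_cst x 1)) => //; rewrite !mul0r.
apply: (cder_ext (cderM df IH)) => [t|]; first by rewrite exprS.
case: n {IH} => [|n] /=; first by rewrite !mul0r mulr0 expr0; ring.
by rewrite -[in RHS]natr1 exprS; ring.
Qed.

Lemma cder_comp f x d (u : R -> R) (v : R) :
  is_derive x 1 u v -> cder f (u x) d -> cder (fun t => f (u t)) x (v%:C * d).
Proof.
move=> du [fr fi]; split.
  apply: (is_derive_ext (is_derive1_comp fr du)) => //.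
  by rewrite ReM /=; ring.
apply: (is_derive_ext (is_derive1_comp fi du)) => //.
by rewrite ImM /=; ring.
Qed.

Lemma cder_cexp f x d : cder f x d ->
  cder (fun t => cexp (f t)) x (d * cexp (f x)).
Proof.
move=> [fr fi].
have er := is_derive1_comp (is_derive_expR (complex.Re (f x))) fr.
have ec := is_derive1_comp (is_derive_cos (complex.Im (f x))) fi.
have es := is_derive1_comp (is_derive_sin (complex.Im (f x))) fi.
split.
  apply: (is_derive_ext (is_deriveM er ec)).
    by move=> t; rewrite /cexp ReM /= mul0r subr0.
  by rewrite /cexp /GRing.scale /=; csimp; ring.
apply: (is_derive_ext (is_deriveM er es)).
  by move=> t; rewrite /cexp ImM /= mul0r addr0.
by rewrite /cexp /GRing.scale /=; csimp; ring.
Qed.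

(** The mean value theorem applies to real functions only; the factor 2 comes
    from treating real and imaginary parts separately. *)
Lemma cder_mean_value f f' (a b M : R) : a <= b ->
  (forall t, a <= t <= b -> cder f t (f' t)) ->
  (forall t, a <= t <= b -> cmod (f' t) <= M) ->
  cmod (f b - f a) <= 2 * M * (b - a).
Proof.
move=> ab df bf.
have mvt (p : R[i] -> R) : (forall z w, p (z - w) = p z - p w) ->
    (forall z, `|p z| <= cmod z) ->
    (forall t, a <= t <= b -> is_derive t 1 (p \o f) (p (f' t))) ->
    `|p (f b - f a)| <= M * (b - a).
  move=> pB ple dp.
  have [|||c + E] := @MVT_segment R (p \o f) (p \o f') a b.
  - exact: ab.
  - by move=> t /[!inE] /andP[/ltW ? /ltW ?]; apply: dp; apply/andP.
  - apply: derivable_within_continuous => t; rewrite inE /= => tab.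
    by have [] := dp t tab.
  rewrite inE /= => cab; rewrite pB [p _ - p _]E.
  rewrite normrM [`|b - a|]ger0_norm ?subr_ge0// ler_wpM2r ?subr_ge0//.
  exact: le_trans (ple _) (bf _ cab).
apply: (le_trans (cmod_le_ReIm _)).
rewrite -mulrA [leRHS]mulr_natl mulr2n lerD//.
  apply: mvt => [z w|z|t /df[]//]; last exact: Re_le_cmod.
  by rewrite ReD ReN.
apply: mvt => [z w|z|t /df[]//]; last exact: Im_le_cmod.
by rewrite ImD ImN.
Qed.

(** One step of Taylor's formula: a bound of order n on the derivative gives
    a bound of order n + 1 on a function that vanishes at 0. *)
Lemma cder_vanish f f' (K del : R) n : 0 <= K ->
  (forall t, `|t| <= del -> cder f t (f' t)) -> f 0 = 0 ->
  (forall t, `|t| <= del -> cmod (f' t) <= K * `|t| ^+ n) ->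
  forall t, `|t| <= del -> cmod (f t) <= 2 * K * `|t| ^+ n.+1.
Proof.
move=> K0 df f0 bf t tdel.
have bound s : `|s| <= `|t| -> cmod (f' s) <= K * `|t| ^+ n.
  move=> st; apply: le_trans (bf _ (le_trans st tdel)) _.
  by rewrite ler_wpM2l// lerXn2r// nnegrE.
have [t0|t0] := leP 0 t.
  have {}bound s : 0 <= s <= t -> cmod (f' s) <= K * `|t| ^+ n.
    by move=> /andP[s0 st]; apply: bound; rewrite !ger0_norm.
  have := cder_mean_value (f := f) t0 _ bound.
  rewrite f0 !subr0 exprSr (ger0_norm t0) !mulrA; apply.
  move=> s /andP[s0 st]; apply: df; rewrite ger0_norm// (le_trans st)//.
  by rewrite -(ger0_norm t0).
have {}bound s : t <= s <= 0 -> cmod (f' s) <= K * `|t| ^+ n.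
  by move=> /andP[s0 st]; apply: bound; rewrite (ler0_norm st) (ltr0_norm t0) lerN2.
have := cder_mean_value (f := f) (ltW t0) _ bound.
rewrite f0 !sub0r cmodN exprSr !mulrA -(ltr0_norm t0); apply.
move=> s /andP[ts s0]; apply: df; rewrite ler0_norm//.
by apply: le_trans tdel; rewrite (ltr0_norm t0) lerN2.
Qed.

End ComplexDerivative.

(** * Matrices of SU(2) *)

Section SpecialUnitary.
Local Open Scope sesquilinear_scope.
Context {R : realType}.
Implicit Types (a b c d : R[i]) (U V g : 'M[R[i]]_2).

Definition su2 a b : 'M[R[i]]_2 :=
  \matrix_(i, j) if i == 0 then (if j == 0 then a else b)
                 else (if j == 0 then - conjc b else conjc a).

Lemma ord2P (P : 'I_2 -> Prop) : P 0 -> P 1 -> forall i, P i.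
Proof.
move=> P0 P1 [[|[|//]] lti].
  by rewrite (_ : Ordinal _ = 0) //; apply: val_inj.
by rewrite (_ : Ordinal _ = 1) //; apply: val_inj.
Qed.

Lemma mulmx2E m n (A : 'M[R[i]]_(m, 2)) (B : 'M[R[i]]_(2, n)) i j :
  (A *m B) i j = A i 0 * B 0 j + A i 1 * B 1 j.
Proof.
rewrite mxE big_ord_recl big_ord1; congr (_ + A _ _ * B _ _); exact: val_inj.
Qed.

Lemma conjcD a b : conjc (a + b) = conjc a + conjc b.
Proof. exact: rmorphD. Qed.

Lemma conjcN a : conjc (- a) = - conjc a.
Proof. exact: rmorphN. Qed.

Lemma conjcM a b : conjc (a * b) = conjc a * conjc b.
Proof. exact: rmorphM. Qed.

Lemma mul_su2 a b c d :
  su2 a b *m su2 c d = su2 (a * c - b * conjc d) (a * d + b * conjc c).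
Proof.
apply/matrixP => i j; rewrite mulmx2E !mxE /=; move: i; apply: ord2P;
  move: j; apply: ord2P => /=; rewrite ?(conjcD, conjcN, conjcM, conjcK); ring.
Qed.

Lemma su2_1 : su2 1 0 = 1%:M.
Proof.
apply/matrixP => i j; rewrite !mxE; move: i; apply: ord2P;
  move: j; apply: ord2P => //=; by rewrite ?conjc0 ?oppr0 ?conjc1.
Qed.

Lemma su2_ad a b : (su2 a b) ^t* = su2 (conjc a) (- b).
Proof.
apply/matrixP => i j; rewrite !mxE /=; move: i; apply: ord2P;
  move: j; apply: ord2P => //=; rewrite -?[Num.conj _]/(conjc _);
  by rewrite ?conjcN ?conjcK ?opprK.
Qed.

Lemma adj_mx2 U : [/\ (\adj U) 0 0 = U 1 1, (\adj U) 0 1 = - U 0 1,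
  (\adj U) 1 0 = - U 1 0 & (\adj U) 1 1 = U 0 0].
Proof.
split; rewrite mxE /cofactor det_mx11 !mxE /= ?expr0 ?expr1 ?sqrrN ?mul1r ?mulN1r.
- congr (U _ _); exact: val_inj.
- congr (- U _ _); exact: val_inj.
- congr (- U _ _); exact: val_inj.
- rewrite expr1n mul1r; congr (U _ _); exact: val_inj.
Qed.

Lemma det_mx2 U : \det U = U 0 0 * U 1 1 - U 0 1 * U 1 0.
Proof.
have [e00 _ e10 _] := adj_mx2 U.
have := mul_mx_adj U => /matrixP/(_ 0 0).
by rewrite mulmx2E e00 e10 !mxE eqxx mulr1n mulrN.
Qed.

Lemma det_su2 a b : \det (su2 a b) = a * conjc a + b * conjc b.
Proof. by rewrite det_mx2 !mxE /=; ring. Qed.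

Lemma su2_SU2 a b : a * conjc a + b * conjc b = 1 -> SU2 (su2 a b).
Proof.
move=> ab1; split; last by rewrite det_su2.
apply/unitarymxP; rewrite su2_ad mul_su2 -su2_1; congr su2; last by rewrite conjcK; ring.
by rewrite conjcN -[RHS]ab1; ring.
Qed.

Lemma SU2_su2 U : SU2 U ->
  exists a b, U = su2 a b /\ a * conjc a + b * conjc b = 1.
Proof.
move=> [/unitarymxP UU detU].
have invU : U ^t* = \adj U.
  have : U *m \adj U = U *m U ^t* by rewrite mul_mx_adj detU UU.
  have /mulmx1_unit[_] := UU; rewrite -unitmx_tr => _.
  move/(congr1 (mulmx (\adj U))); rewrite !mulmxA mul_adj_mx detU.
  by rewrite !mul1mx.
have /matrixP invUE := invU.
have [adj00 adj01 _ _] := adj_mx2 U.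
have h1 : U 1 1 = conjc (U 0 0) by rewrite -adj00 -invUE !mxE.
have h2 : U 1 0 = - conjc (U 0 1).
  by rewrite -conjcN -adj01 -invUE !mxE -[Num.conj _]/(conjc _) conjcK.
exists (U 0 0), (U 0 1).
have EU : U = su2 (U 0 0) (U 0 1).
  by apply/matrixP => i j; rewrite mxE; move: i; apply: ord2P;
    move: j; apply: ord2P => //=.
by split => //; rewrite -det_su2 -EU.
Qed.

Lemma SU2_unit U : SU2 U -> U \in unitmx.
Proof. by move=> [/unitarymx_unit]. Qed.

Lemma SU2_mul U V : SU2 U -> SU2 V -> SU2 (U *m V).
Proof.
move=> [uU dU] [uV dV]; split; last by rewrite det_mulmx dU dV mulr1.
exact: mul_unitarymx.
Qed.

Lemma SU2_inv U : SU2 U -> SU2 (invmx U).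
Proof.
move=> hU; have [uU dU] := hU; split; last first.
  by rewrite -[RHS]invr1 -dU det_inv.
by rewrite (invmx_unitary uU) trmxC_unitary.
Qed.

(** The anti-linear map v |-> (- conj v_1, conj v_0) commutes with SU(2), so
    one eigenvector of a matrix in SU(2) gives an orthogonal second one, with
    the conjugate eigenvalue. *)
Lemma common_diagonalization (I : Type) (rho : I -> 'M[R[i]]_2) (v : 'cV_2) :
  (forall x, SU2 (rho x)) -> v != 0 ->
  (forall x, exists a, rho x *m v = a *: v) ->
  exists2 P, SU2 P & forall x, exists2 l, l * conjc l = 1 &
    rho x *m P = P *m su2 l 0.
Proof.
move=> rhoSU v0 eig.
pose N := cmod (v 0 0) ^+ 2 + cmod (v 1 0) ^+ 2.
have cmod2 z : (cmod z ^+ 2)%:C = z * conjc z :> R[i].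
  by rewrite rmorphXn /= -normE sqr_normc.
have NC : N%:C = v 0 0 * conjc (v 0 0) + v 1 0 * conjc (v 1 0) :> R[i].
  by rewrite /N (rmorphD (real_complex R)) /= !cmod2.
have N0 : 0 < N.
  rewrite lt_def addr_ge0 ?sqr_ge0// andbT; apply: contra v0.
  rewrite paddr_eq0 ?sqr_ge0// !sqrf_eq0 !cmod_eq0 => /andP[/eqP e0 /eqP e1].
  apply/eqP/matrixP => i j; rewrite (ord1 j) mxE; move: i; exact: ord2P.
pose r : R[i] := (Num.sqrt N)%:C^-1.
have rr : conjc r = r by rewrite conjc_inv /= oppr0.
have r2 : r * r * N%:C = 1.
  rewrite -[N]sqr_sqrtr ?ltW// rmorphXn expr2 /r mulrACA mulVf ?mul1r//.
  by rewrite -cmod_eq0 cmodR normr_eq0 gt_eqF// sqrtr_gt0.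
(* The columns are v and its image under the anti-linear map, divided by
   the norm of v. *)
exists (su2 (r * v 0 0) (- conjc (r * v 1 0))).
  apply: su2_SU2; rewrite !(conjcN, conjcM, conjcK) rr -[RHS]r2.
  by rewrite NC; ring.
move=> x; have [a] := eig x; have [b [c [-> bc1]]] := SU2_su2 (rhoSU x).
move=> /matrixP E; have E0 := E 0 0; have E1 := E 1 0.
move: E0 E1; rewrite !mulmx2E !mxE /= => E0 E1.
exists a.
  apply: (mulIf (lt0r_neq0 (_ : 0 < N%:C))); first by rewrite ltcR.
  have /(congr1 conjc) := E0; have /(congr1 conjc) := E1.
  rewrite !(conjcD, conjcM, conjcN, conjcK) => F1 F0.
  rewrite mul1r [in LHS]NC.
  rewrite [LHS](_ : _ = (a * v 0 0) * (conjc a * conjc (v 0 0)) +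
     (a * v 1 0) * (conjc a * conjc (v 1 0))); last by ring.
  rewrite -E0 -E1 -F0 -F1 NC.
  rewrite -[RHS]mul1r -bc1; ring.
rewrite !mul_su2; congr su2.
  rewrite !(conjcM, conjcN, conjcD, conjcK, conjc0) rr.
  rewrite [RHS](_ : _ = r * (a * v 0 0)); last by ring.
  by rewrite -E0; ring.
rewrite !(conjcM, conjcN, conjcD, conjcK, conjc0) rr.
have /(congr1 conjc) := E1; rewrite !(conjcD, conjcM, conjcN, conjcK) => F1.
rewrite [RHS](_ : _ = - r * (conjc a * conjc (v 1 0))); last by ring.
by rewrite -F1; ring.
Qed.

End SpecialUnitary.

(** * Reducible representations of the knot group *)

Section KnotGroup.
Context {K : knot}.

Local Notation n := (ncross K).
Local Notation out := (outgoing (positive (k := K))).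

Lemma opp_end_out (x : dart K) : ~~ out x -> out (opp_end x).
Proof.
by case: x => c [[|[|[|[|//]]]] ltd]; rewrite /outgoing /opp_end /=;
  rewrite -!val_eqE /=; case: (positive c).
Qed.

Let next (x : dart K) : dart K := opp_end (edge x).

Lemma next_out (x : dart K) : out x -> out (next x).
Proof. by move=> ox; apply: opp_end_out; rewrite edge_oriented ox. Qed.

Lemma fconnect_out (x y : dart K) : out x -> fconnect next x y = out y.
Proof.
move=> ox; apply/idP/idP; last by move=> oy; exact: one_component.
move=> /iter_findex <-; elim: (findex _ _ _) => //= m; exact: next_out.
Qed.

Lemma sum_dart (V : nmodType) (F : dart K -> V) :
  \sum_(x : dart K) F x = \sum_(c : crossing K) \sum_(d : 'Z_4) F (c, d).
Proof. by rewrite pair_big; apply: eq_bigr => -[]. Qed.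

Lemma Z4P (P : 'Z_4 -> Prop) : P 0 -> P 1 -> P 2 -> P 3 -> forall d, P d.
Proof.
move=> P0 P1 P2 P3 [[|[|[|[|//]]]] ltd].
- by rewrite (_ : Ordinal _ = 0) //; apply: val_inj.
- by rewrite (_ : Ordinal _ = 1) //; apply: val_inj.
- by rewrite (_ : Ordinal _ = 2) //; apply: val_inj.
- by rewrite (_ : Ordinal _ = 3) //; apply: val_inj.
Qed.

Lemma sum_Z4 (V : nmodType) (F : 'Z_4 -> V) :
  \sum_(d : 'Z_4) F d = F 0 + F 1 + F 2 + F 3.
Proof.
rewrite !big_ord_recr big_ord0 /= add0r.
by congr (F _ + F _ + F _ + F _); apply: val_inj.
Qed.

Lemma card_out : #|[pred x : dart K | out x]| = (2 * n.+1)%N.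
Proof.
rewrite -sum1_card big_mkcond sum_dart /=.
under eq_bigr => c _.
  rewrite sum_Z4 (_ : _ + _ = 2%N); last first.
    by rewrite ?inE /outgoing /=; case: (positive c).
  over.
by rewrite sum_nat_const card_ord mulnC.
Qed.

Lemma base_out : out (base_dart K).
Proof. by []. Qed.

(** The knot has one component, so its outgoing darts form a single orbit;
    this turns the product along the longitude into a product over crossings. *)
Lemma traject_out :
  perm_eq (traject next (base_dart K) (2 * n.+1))
          (enum [pred x : dart K | out x]).
Proof.
have -> : (2 * n.+1)%N = order next (base_dart K).
  rewrite -card_out /order; apply: eq_card => y.
  by rewrite !inE; apply/esym; exact: (fconnect_out y base_out).
apply: uniq_perm; [exact: orbit_uniq|exact: enum_uniq|].
move=> y; rewrite mem_enum inE -[traject _ _ _]/(orbit next _) -fconnect_orbit.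
exact: fconnect_out.
Qed.

(** The blackboard longitude passes under every crossing exactly once, and
    the signs of the crossings add up to the writhe. *)
Lemma sum_under_signs :
  \sum_(x <- traject next (base_dart K) (2 * n.+1))
     (if (edge x).2 == 0 then
        (if positive (edge x).1 then 1 else -1) else 0 : int) = 0.
Proof.
rewrite (perm_big _ traject_out) /= big_enum /=.
rewrite (reindex_inj (inv_inj (@edgeK K))) /=.
under eq_bigr do rewrite edgeK.
rewrite (eq_bigl (fun x => ~~ out x)); last by move=> x; rewrite !inE edge_oriented.
rewrite big_mkcond sum_dart /=.
under eq_bigr => c _.
  rewrite sum_Z4 (_ : _ + _ = if positive c then 1 else -1); last first.
    by rewrite ?inE /outgoing /=; case: (positive c).
  over.
rewrite (bigID (@positive K)) /=.
rewrite (eq_bigr (fun=> 1)); last by move=> c ->.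
rewrite [X in _ + X](eq_bigr (fun=> -1)); last by move=> c /negbTE ->.
rewrite !sumr_const mulNrn.
have h := writhe0 K.
have : (#|positive (k := K)| + #|[predC positive (k := K)]|)%N = n.+1.
  by rewrite cardC card_ord.
have -> : #|[predC positive (k := K)]| = #|[pred c | ~~ @positive K c]|.
  exact: eq_card.
have -> : #|positive (k := K)| = #|[pred c | @positive K c]| by exact: eq_card.
move: h; set p := #|_|; set q := #|_| => h1 h2.
have -> : q = p by lia.
by rewrite subrr.
Qed.

Context {R : realType}.
Implicit Types (rho : dart K -> 'M[R[i]]_2).

Lemma conj_rep rho g : knot_rep rho -> SU2 g ->
  knot_rep (fun x => g *m rho x *m invmx g).
Proof.
move=> [r1 r2 r3 r4] hg; have ug := SU2_unit hg.
have cancel A B : g *m A *m invmx g *m (g *m B *m invmx g) =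
    g *m (A *m B) *m invmx g.
  by rewrite !mulmxA mulmxKV.
split=> [x|x|c|c].
- by apply: SU2_mul; [exact: SU2_mul|exact: SU2_inv].
- by rewrite r2.
- by rewrite r3.
- by have := r4 c; case: (positive c); rewrite !cancel => ->.
Qed.

Lemma conj_eigen rho g : SU2 g ->
  ~ irreducible_rep rho -> ~ irreducible_rep (fun x => g *m rho x *m invmx g).
Proof.
move=> hg; apply: contra_not => irr v v0 eig.
have ug := SU2_unit hg.
apply: (irr (g *m v)).
  by apply: contra v0 => /eqP/(congr1 (mulmx (invmx g))); rewrite mulKmx// mulmx0 => ->.
move=> x; have [a Ea] := eig x; exists a.
by rewrite -!mulmxA mulKmx// Ea -scalemxAr.
Qed.

(** In a reducible representation all the meridians coincide, so the
    longitude, whose linking number with the knot is 0, is trivial. *)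
Lemma reducible_longitude rho : knot_rep rho -> ~ irreducible_rep rho ->
  longitude rho = 1%:M.
Proof.
move=> [r1 r2 r3 r4] red.
have [v v0 eig] : exists2 v : 'cV[R[i]]_2, v != 0 &
    forall x, exists a, rho x *m v = a *: v.
  apply: contrapT => h; apply: red => v v0 eig; apply: h; by exists v.
have [P hP dg] := common_diagonalization r1 v0 eig.
have uP := SU2_unit hP.
have comm x y : rho x *m rho y = rho y *m rho x.
  have [a _ Ea] := dg x; have [b _ Eb] := dg y.
  have : rho x *m rho y *m P = rho y *m rho x *m P.
    rewrite -!mulmxA Ea Eb !mulmxA Ea Eb -!mulmxA !mul_su2.
    by rewrite !(conjc0, mulr0, mul0r, subr0, addr0) [b * a]mulrC.
  by move=> /(congr1 (fun A => A *m invmx P)); rewrite !mulmxK.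
have r20 c : rho (c, 2) = rho (c, 0).
  have := r4 c; have u1 := SU2_unit (r1 (c, 1)).
  case: (positive c).
    by rewrite comm => /(congr1 (fun A => A *m invmx (rho (c, 1)))); rewrite !mulmxK.
  by rewrite [RHS]comm => /(congr1 (fun A => A *m invmx (rho (c, 1)))); rewrite !mulmxK.
have ropp x : rho (opp_end x) = rho x.
  case: x => c d; rewrite /opp_end /=; move: d; apply: Z4P.
  - by rewrite (_ : 0 + 2 = 2) //; apply: val_inj.
  - by rewrite (_ : 1 + 2 = 3) //; apply: val_inj.
  - by rewrite (_ : 2 + 2 = 0) //; apply: val_inj.
  - by rewrite (_ : 3 + 2 = 1) //; apply: val_inj.
pose M := rho (base_dart K).
have rout x : out x -> rho x = M.
  move=> ox; have : fconnect next (base_dart K) x by rewrite fconnect_out.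
  move=> /iter_findex <-; elim: (findex _ _ _) => //= m <-.
  by rewrite ropp r2.
have rM x : rho x = M.
  have [/rout//|nox] := boolP (out x).
  by rewrite -r2 rout// edge_oriented.
have uM : M \in unitmx by apply: SU2_unit; exact: r1.
rewrite /longitude.
pose e (x : dart K) : int := if (edge x).2 == 0 then
        (if positive (edge x).1 then 1 else -1) else 0.
suff gen s : \big[mulmx/1%:M]_(x <- s) (let: (c, d) := edge x in
    if d == 0 then if positive c then rho (c, 1) else invmx (rho (c, 1))
    else 1%:M) = exprz (M : 'M[R[i]]_1.+1) (\sum_(x <- s) e x).
  by rewrite gen /e sum_under_signs expr0z.
elim: s => [|x s IH]; first by rewrite !big_nil expr0z.
rewrite !big_cons IH exprzDr//; congr (_ * _).
rewrite /e; case: (edge x) => c d /=; case: ifP => _; last by rewrite expr0z.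
by rewrite rM; case: (positive c); [rewrite expr1z|rewrite exprN1].
Qed.

End KnotGroup.

(** * Characters of the peripheral torus *)

Section TorusModuli.
Context {R : realType}.

Definition circ (y : R) : R[i] := cexp (2 * pi%:C * 'i * y%:C).

Lemma circE y : circ y = cos (2 * pi * y) +i* sin (2 * pi * y).
Proof.
have -> : circ y = cexp (0 +i* (2 * pi * y)).
  by rewrite /circ; congr cexp; apply: eqCP; csimp; ring.
by rewrite /cexp Re_cplx Im_cplx expR0 mul1r.
Qed.

Lemma circ_eq1 y : circ y = 1 -> exists n : int, y = n%:~R.
Proof.
move=> y1; exists (Num.floor y).
pose r := y - (Num.floor y)%:~R.
have r01 : 0 <= r < 1.
  have := floor_le_tmp y; have := floorD1_gt y; rewrite intrD /r; lra.
have cr : circ r = 1.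
  rewrite /circ (_ : _ * _ = 2 * pi%:C * 'i * y%:C +
     (- Num.floor y)%:~R * (2 * pi%:C * 'i)); last first.
    by rewrite /r rmorphB /= rmorph_int mulrNz; ring.
  by rewrite cexpD cexp_2piz mulr1.
have [r0|r0] := eqVneq r 0; first by apply/eqP; rewrite -subr_eq0 -/r r0.
have : cos (2 * pi * r) = 1 by have := circE r; rewrite cr => -[].
have -> : 2 * pi * r = (pi * r) *+ 2 by rewrite mulr2n; ring.
rewrite cos_mulr2n mulr2n => c2.
have : sin (pi * r) ^+ 2 = 0 by have := cos2Dsin2 (pi * r); lra.
move/eqP; rewrite sqrf_eq0 gt_eqF//; apply: sin_gt0_pi.
have pi0 := pi_gt0 R.
have r1 : 0 < r < 1 by rewrite lt_def r0 /=.
by apply/andP; split; nra.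
Qed.

Lemma unit_circ (l : R[i]) : l * conjc l = 1 ->
  exists2 y, `|y| <= 2^-1 & l = circ y.
Proof.
case: l => a b; move=> [ab _].
have {}ab : a ^+ 2 + b ^+ 2 = 1 by rewrite -ab; ring.
have pi0 := pi_gt0 R.
have a1 : -1 <= a <= 1 by apply/andP; split; nra.
pose t := acos a.
have t0 : 0 <= t := acos_ge0 a1.
have tpi : t <= pi := acos_lepi a1.
have cost : cos t = a by rewrite /t acosK// inE.
have sint : sin t = `|b|.
  rewrite /t sin_acos// (_ : 1 - _ = b ^+ 2) ?sqrtr_sqr//.
  by rewrite -ab; ring.
have pi2 : 0 < 2 * pi :> R by rewrite mulr_gt0.
have tE : 2 * pi * (t / (2 * pi)) = t by rewrite mulrC divfK// gt_eqF.
have bound : `|t / (2 * pi)| <= 2^-1.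
  rewrite (ger0_norm (divr_ge0 t0 (ltW pi2))) (ler_pdivrMr _ _ pi2).
  by rewrite mulrA mulVf// mul1r.
have [b0|b0] := leP 0 b.
  exists (t / (2 * pi)) => //.
  rewrite circE tE.
  by rewrite cost sint ger0_norm.
exists (- (t / (2 * pi))); first by rewrite normrN.
rewrite circE mulrN tE.
by rewrite cosN sinN cost sint ltr0_norm// opprK.
Qed.

Lemma inter_mu (x : R * R) : inter (mu R) x = x.2.
Proof. by rewrite /inter /mu /= mul1r mul0r subr0. Qed.

Lemma inter_lam (x : R * R) : inter (lam R) x = - x.1.
Proof. by rewrite /inter /lam /= mul1r mul0r sub0r. Qed.

Lemma tr_su2 (a b : R[i]) : \tr (su2 a b) = a + conjc a.
Proof. by rewrite /mxtrace big_ord_recl big_ord1 !mxE. Qed.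

Definition torus_diag (x : R * R) (g : peripheral) : 'M[R[i]]_2 :=
  su2 (circ (inter (if g is Mer then mu R else lam R) x)) 0.

Lemma circ_conj y : conjc (circ y) = circ (- y).
Proof. by rewrite !circE mulrN cosN sinN. Qed.

Lemma circN y : circ (- y) = (circ y)^-1.
Proof. by rewrite /circ rmorphN mulrN cexpN. Qed.

Lemma circ_neq0 y : circ y != 0.
Proof. exact: cexp_neq0. Qed.

Lemma circ_circ_conj y : circ y * conjc (circ y) = 1.
Proof. by rewrite circ_conj circN mulfV// circ_neq0. Qed.

Lemma torus_pointE x : torus_point x = conj_class (torus_diag x).
Proof.
rewrite /torus_point; congr conj_class; apply/funext => g.
apply/matrixP => a b; rewrite !mxE.
set z := _ * (inter _ x)%:C.
have zN : cexp (- z) = conjc (circ (inter (match g with Mer => mu R | Lon => lam R end) x)).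
  by rewrite circ_conj circN cexpN /circ /z.
move: a; apply: ord2P; move: b; apply: ord2P => //=.
by rewrite -[_ *i]/(conjc 0) conjc0 oppr0.
Qed.

Lemma SU2_torus_diag x g : SU2 (torus_diag x g).
Proof. by apply: su2_SU2; rewrite circ_circ_conj conjc0 mulr0 addr0. Qed.

Lemma torus_diag_rep x : torus_rep (torus_diag x).
Proof.
split=> [g|]; first exact: SU2_torus_diag.
by rewrite !mul_su2 !(conjc0, mulr0, mul0r, subr0, addr0) mulrC.
Qed.

Lemma SU2_1 : SU2 (1%:M : 'M[R[i]]_2).
Proof. by rewrite -su2_1; apply: su2_SU2; rewrite conjc1 conjc0 mulr1 mulr0 addr0. Qed.

Lemma invmx1 : invmx (1%:M : 'M[R[i]]_2) = 1%:M.
Proof.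
have u1 := SU2_unit SU2_1.
by rewrite -[LHS]mul1mx mulmxV.
Qed.

Lemma conj_class_refl (I : Type) (rho : I -> 'M[R[i]]_2) : conj_class rho rho.
Proof.
exists 1%:M; first exact: SU2_1.
by apply/funext => x; rewrite invmx1 mul1mx mulmx1.
Qed.

Lemma conj_class_eq (I : Type) (rho : I -> 'M[R[i]]_2) g : SU2 g ->
  conj_class (fun x => g *m rho x *m invmx g) = conj_class rho.
Proof.
move=> hg; have ug := SU2_unit hg.
have invM (A B : 'M[R[i]]_2) : A \in unitmx -> B \in unitmx ->
    invmx (A *m B) = invmx B *m invmx A.
  move=> uA uB; have uAB : A *m B \in unitmx by rewrite unitmx_mul uA.
  apply: (can_inj (mulKmx uAB)); rewrite mulmxV// mulmxA mulmxK// mulmxV//.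
apply/seteqP; split => rho' [k hk ->].
  exists (k *m g); first exact: SU2_mul.
  apply/funext => x; rewrite invM ?SU2_unit//; by rewrite !mulmxA.
exists (k *m invmx g); first by apply: SU2_mul => //; exact: SU2_inv.
apply/funext => x; rewrite invM ?SU2_unit//; last exact: SU2_inv.
by rewrite invmxK !mulmxA !mulmxKV.
Qed.

(** Two commuting matrices have a common eigenvector, hence are diagonalized
    by one element of SU(2). *)
Lemma torus_rep_point (rho : peripheral -> 'M[R[i]]_2) : torus_rep rho ->
  exists2 x, `|x.2| <= 2^-1 & conj_class rho = torus_point x.
Proof.
move=> [rhoSU comm].
have commT : (rho Mer)^T *m (rho Lon)^T = (rho Lon)^T *m (rho Mer)^T.
  by rewrite -!trmx_mul comm.
have [v v0 /andP[/sub_rVP[a Ea] /sub_rVP[b Eb]]] :=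
  common_eigenvector2 (isT : (0 < 2)%N) commT.
have v0' : v^T != 0.
  by apply: contra v0 => /eqP vT; rewrite -[v]trmxK vT trmx0.
have eig g : exists c, rho g *m v^T = c *: v^T.
  case: g; [exists a|exists b]; apply: trmx_inj;
    by rewrite trmx_mul trmxK linearZ /= trmxK.
have [P hP dg] := common_diagonalization rhoSU v0' eig.
have uP := SU2_unit hP.
have [lm /unit_circ[ym ym2 lmE] Em] := dg Mer.
have [ll /unit_circ[yl _ llE] El] := dg Lon.
exists (- yl, ym) => //.
rewrite torus_pointE -(conj_class_eq _ (SU2_inv hP)); congr conj_class.
apply/funext => g; rewrite invmxK -mulmxA.
have -> : rho g *m P = P *m torus_diag (- yl, ym) g.
  case: g; rewrite /torus_diag; first by rewrite inter_mu -lmE.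
  by rewrite inter_lam opprK -llE.
by rewrite mulKmx.
Qed.

Lemma torus_point_trace (rho : peripheral -> 'M[R[i]]_2) x :
  torus_rep rho -> conj_class rho = torus_point x ->
  complex.Re (\tr (rho Mer)) = 2 * cos (2 * pi * x.2).
Proof.
move=> hrho E; have : conj_class rho rho := conj_class_refl rho.
rewrite E torus_pointE => -[g hg ->].
rewrite mxtrace_mulC mulKmx ?SU2_unit// tr_su2 ReD Re_conj.
by rewrite inter_mu circE Re_cplx; ring.
Qed.

Lemma torus_point_Lon x (rho : peripheral -> 'M[R[i]]_2) :
  torus_point x rho -> rho Lon = 1%:M -> exists n : int, x.1 = n%:~R.
Proof.
rewrite torus_pointE => -[g hg ->] /(congr1 (fun A => invmx g *m A *m g)).
rewrite mulmx1 mulVmx ?SU2_unit// -!mulmxA mulKmx ?SU2_unit//.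
rewrite mulmxA mulmxKV ?SU2_unit// => /matrixP/(_ 0 0).
rewrite mxE [RHS]mxE inter_lam => /circ_eq1[n En].
by exists (- n); rewrite mulrNz -En opprK.
Qed.

Variables (K : knot) (ori : bool).

(** A reducible representation is trivial on the longitude, and the character
    of the torus attached to x takes the longitude to exp(- x.1 D). *)
Lemma knot_moduli_abelian x :
  (restriction ori @` @knot_moduli R K) (torus_point x) ->
  (restriction ori @` @knot_moduli_irr R K) (torus_point x) \/
  exists n : int, x.1 = n%:~R.
Proof.
move=> [_ [rho hrho <-] E].
have [irr|red] := pselect (irreducible_rep rho).
  by left; exists (conj_class rho) => //; exists rho.
right; have : torus_point x (torus_diag x).
  by rewrite torus_pointE; exact: conj_class_refl.
rewrite -E => -[_ [g hg ->] Ex].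
have hx : torus_point x (torus_diag x).
  by rewrite torus_pointE; exact: conj_class_refl.
apply: (torus_point_Lon hx); rewrite -Ex /=.
by apply: reducible_longitude; [exact: conj_rep|exact: conj_eigen].
Qed.

Variable eps : R.
Hypothesis hirr : forall x : R * R, - eps < x.2 < eps ->
  ~ (restriction ori @` @knot_moduli_irr R K) (torus_point x).

(** The trace of the meridian is 2 cos(2 pi x.2) at the class of x. Modulo the
    lattice and the Weyl group x.2 can be taken in [-1/2, 1/2], where this
    cosine determines its absolute value; so the strip is an open condition
    on the trace. *)
Lemma open_torus_strip :
  open_torus_moduli [set c | exists2 x : R * R, - eps < x.2 < eps &
                                                c = torus_point x].
Proof.
split=> [_ [x _ ->]|rho hrho [x /= xeps Ex]].
  by rewrite torus_pointE; exists (torus_diag x) => //; exact: torus_diag_rep.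
have pi0 := pi_gt0 R.
have [epsbig|epssmall] := ltP 2^-1 eps.
  exists 1 => // rho' hrho' _.
  have [y y2 ->] := torus_rep_point hrho'.
  by exists y => //; rewrite -ltr_norml (le_lt_trans y2).
have eps0 : 0 < eps by move: xeps; lra.
have in0pi (y : R) : 0 <= y <= 2^-1 -> 2 * pi * y \in `[0, pi].
  by move=> /andP[y0 y1]; rewrite in_itv /=; apply/andP; split; nra.
have cosx : cos (2 * pi * eps) < cos (2 * pi * x.2).
  have -> : cos (2 * pi * x.2) = cos (2 * pi * `|x.2|).
    by case: (ger0P x.2) => // _; rewrite mulrN cosN.
  have nx : `|x.2| < eps by rewrite ltr_norml.
  have nx0 := normr_ge0 x.2.
  rewrite ltr_cos ?in0pi//; last 2 first.
  - by lra.
  - by lra.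
  by rewrite ltr_pM2l// mulr_gt0.
exists (cos (2 * pi * x.2) - cos (2 * pi * eps)); first by rewrite subr_gt0.
move=> rho' hrho' close.
have [y y2 Ey] := torus_rep_point hrho'; exists y => //.
rewrite -ltr_norml.
have cosy : cos (2 * pi * eps) < cos (2 * pi * y.2).
  have := torus_point_trace hrho Ex; have := torus_point_trace hrho' Ey.
  rewrite /mxtrace !big_ord_recl !big_ord0 !addr0 !ReD => t' t.
  have c a : `|complex.Re (rho' Mer a a) - complex.Re (rho Mer a a)| <
      cos (2 * pi * x.2) - cos (2 * pi * eps).
    by have := close Mer a a; rewrite normE ltcR; apply: le_lt_trans;
      rewrite -ReN -ReD Re_le_cmod.
  have := c 0; have := c (lift 0 0); rewrite !ltr_norml; lra.
move: cosy; have -> : cos (2 * pi * y.2) = cos (2 * pi * `|y.2|).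
  by case: (ger0P y.2) => // _; rewrite mulrN cosN.
have ny0 := normr_ge0 y.2.
rewrite ltr_cos ?in0pi//; last 2 first.
- by lra.
- by lra.
by rewrite ltr_pM2l// mulr_gt0.
Qed.

Variables (P : {poly int}) (d : nat).
Hypothesis hroot : forall q : R, - eps < q < eps ->
  laurent_eval P d (cexp (2 * 'i * pi%:C * q%:C)) != 0.

(** The factor 1/2 comes from the two normalizations: regularity at q involves
    exp(4 i pi q), while the strip is described by exp(2 i pi q). *)
Lemma strip_regular q : - eps / 2 < q < eps / 2 -> regular_point K ori P d q.
Proof.
move=> qeps; split.
  have := hroot (q := 2 * q).
  rewrite (_ : 2 * 'i * pi%:C * _ = 4 * 'i * pi%:C * q%:C); last first.
    by rewrite rmorphM /= (rmorph_nat (real_complex R)); ring.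
  by apply; lra.
exists [set c | exists2 x : R * R, - eps < x.2 < eps & c = torus_point x].
split; first exact: open_torus_strip.
  by exists (q *: lam R) => //=; rewrite /GRing.scale /= mulr1; lra.
by apply/seteqP; split=> // _ [[x xeps ->]]; exact: hirr.
Qed.

End TorusModuli.

(** * The Gaussian integral *)

Section GaussIntegral.
Context {R : realType}.
Implicit Types (X Y : R).

Definition gint : R -> R := @gauss_integral_proof.integral0_gauss R.

Lemma gauss_integrable (X : R) :
  (@lebesgue_measure R).-integrable `[0, X] (EFin \o gauss_fun).
Proof.
apply: continuous_compact_integrable => //; first exact: segment_compact.
by apply: continuous_subspaceT; exact: continuous_gauss_fun.
Qed.

Lemma gint_derive X : 0 < X -> is_derive X 1 gint (expR (- X ^+ 2)).
Proof.
move=> X0.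
have X1 : X < X + 1 by rewrite ltrDl.
have [||dI EI] := @continuous_FTC1_closed R gauss_fun 0 X _ X1 (gauss_integrable _).
- exact: X0.
- exact: continuous_gauss_fun.
by apply: DeriveDef; [exact: dI|rewrite -derive1E].
Qed.

Lemma gint0 : gint 0 = 0.
Proof. by rewrite /gint /gauss_integral_proof.integral0_gauss set_itv1 Rintegral_set1. Qed.

Lemma gint_continuous X : 0 <= X -> {within `[0, X], continuous gint}.
Proof.
move=> X0; apply: parameterized_integral_continuous => //.
exact: gauss_integrable.
Qed.

Lemma gint_cvg : gint x @[x --> +oo] --> Num.sqrt pi / 2.
Proof.
have : Num.sqrt (gint x ^+ 2) @[x --> +oo] --> Num.sqrt (pi / 4).
  apply: continuous_cvg => //; first exact: sqrt_continuous.
  exact: gauss_integral_proof.cvg_integral0_gauss_sqr.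
rewrite sqrtrM ?pi_ge0// sqrtrV// (_ : 4 = 2 ^+ 2); last first.
  by rewrite expr2 -natrM.
rewrite sqrtr_sqr ger0_norm// (_ : (fun _ => Num.sqrt _) = gint)//.
apply/funext => r; rewrite sqrtr_sqr ger0_norm//.
exact: gauss_integral_proof.integral0_gauss_ge0.
Qed.

Lemma gint_mvt X Y : 0 < X -> X < Y ->
  exists2 c, X < c < Y & gint Y - gint X = expR (- c ^+ 2) * (Y - X).
Proof.
move=> X0 XY.
have [||c] := @MVT R gint (fun x => expR (- x ^+ 2)) X Y XY.
- move=> x; rewrite in_itv /= => /andP[Xx _].
  exact: gint_derive (lt_trans X0 Xx).
- apply: derivable_within_continuous => x; rewrite in_itv /= => /andP[Xx _].
  by have [] := gint_derive (lt_le_trans X0 Xx).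
by rewrite in_itv /= => cXY E; exists c.
Qed.

(** The exponent 1 - X bounds - X^2 from above, and has an explicit
    primitive. *)
Lemma gint_tail X : 0 < X -> `|gint X - Num.sqrt pi / 2| <= expR (1 - X).
Proof.
move=> X0; rewrite distrC ger0_norm; last first.
  rewrite subr_ge0; apply: (cvgr_to_ge gint_cvg).
  near=> Y; have XY : X < Y by near: Y; apply: nbhs_pinfty_gt; exact: num_real.
  have [c _ E] := gint_mvt X0 XY.
  by rewrite -subr_ge0 E mulr_ge0 ?expR_ge0// subr_ge0 ltW.
rewrite lerBlDr; apply: (cvgr_to_le gint_cvg).
near=> Y; have XY : X < Y by near: Y; apply: nbhs_pinfty_gt; exact: num_real.
have dH (x : R) : 0 < x -> is_derive x 1 (fun x => gint x + expR (1 - x))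
    (expR (- x ^+ 2) - expR (1 - x)).
  move=> x0.
  have d1 : is_derive x 1 (fun x : R => 1 - x) (-1).
    apply: (is_derive_ext (is_deriveB (is_derive_cst (1 : R) x 1)
      (is_derive_id x 1))) => //.
    by rewrite sub0r.
  apply: (is_derive_ext (is_deriveD (gint_derive x0)
      (@is_derive1_comp R expR (fun x => 1 - x) x _ _ (is_derive_expR _) d1))) => //.
  by rewrite mulrN1.
have [||c] := @MVT R (fun x => gint x + expR (1 - x))
   (fun x => expR (- x ^+ 2) - expR (1 - x)) X Y XY.
- move=> x; rewrite in_itv /= => /andP[Xx _].
  exact: dH (lt_trans X0 Xx).
- apply: derivable_within_continuous => x; rewrite in_itv /= => /andP[Xx _].
  by have [] := dH _ (lt_le_trans X0 Xx).
rewrite in_itv /= => /andP[Xc _] E.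
have : (gint Y + expR (1 - Y)) - (gint X + expR (1 - X)) <= 0.
  rewrite E mulr_le0_ge0 ?subr_ge0 ?(ltW XY)// subr_le0 ler_expR.
  have c0 : 0 < c := lt_trans X0 Xc.
  by have := sqr_ge0 (c - 2^-1); nra.
have := expR_ge0 (1 - Y); lra.
Unshelve. all: by end_near. Qed.

Lemma gint_small X : 0 < X -> `|gint X - X| <= X ^+ 3.
Proof.
move=> X0.
have [||c] := @MVT R gint (fun x => expR (- x ^+ 2)) 0 X X0.
- by move=> x; rewrite in_itv /= => /andP[x0 _]; exact: gint_derive.
- exact: gint_continuous (ltW X0).
rewrite in_itv /= => /andP[c0 cX]; rewrite gint0 !subr0 => ->.
have -> : expR (- c ^+ 2) * X - X = - ((1 - expR (- c ^+ 2)) * X) by ring.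
have e1 : expR (- c ^+ 2) <= 1 by rewrite -expR0 ler_expR oppr_le0 sqr_ge0.
rewrite normrN ger0_norm; last by rewrite mulr_ge0 ?subr_ge0// ltW.
rewrite [X ^+ 3]exprSr ler_wpM2r ?(ltW X0)//.
have := expR_ge1Dx (- c ^+ 2).
have : c ^+ 2 <= X ^+ 2 by rewrite lerXn2r// ?nnegrE ltW.
lra.
Qed.

End GaussIntegral.

(** * Gaussian sums *)

Section GaussianSum.
Context {R : realType}.
Implicit Types (e : R[i]) (x : R).

Lemma half_gt0 : 0 < 2^-1 :> R. Proof. by rewrite invr_gt0. Qed.

Lemma cder_shift (f : R -> R[i]) (a h : R) d :
  cder f (a + h) d -> cder (fun h => f (a + h)) h d.
Proof.
move=> df; have da : is_derive h 1 (fun h => a + h) 1.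
  apply: (is_derive_ext (is_deriveD (is_derive_cst (a : R) h 1)
    (is_derive_id h 1))) => //.
  by rewrite add0r.
by apply: (cder_ext (cder_comp da df)) => //; rewrite mul1r.
Qed.

Lemma cder_reflect (f : R -> R[i]) (a h : R) d :
  cder f (a - h) d -> cder (fun h => f (a - h)) h (- d).
Proof.
move=> df; have da : is_derive h 1 (fun h => a - h) (-1).
  apply: (is_derive_ext (is_deriveB (is_derive_cst (a : R) h 1)
    (is_derive_id h 1))) => //.
  by rewrite sub0r.
by apply: (cder_ext (cder_comp da df)) => //; rewrite rmorphN1 mulN1r.
Qed.

(** The odd function h |-> f (a + h) - f (a - h) - 2 h f'(a) vanishes to second
    order at 0, and its third derivative is bounded by twice that of f. *)
Lemma central_difference (f f1 f2 f3 : R -> R[i]) (a M : R) :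
  (forall x, `|x - a| <= 2^-1 -> [/\ cder f x (f1 x), cder f1 x (f2 x),
     cder f2 x (f3 x) & cmod (f3 x) <= M]) ->
  cmod (f (a + 2^-1) - f (a - 2^-1) - f1 a) <= 2 * M.
Proof.
move=> H.
have near1 h : `|h| <= 2^-1 -> `|a + h - a| <= 2^-1 by rewrite addrC addKr.
have near2 h : `|h| <= 2^-1 -> `|a - h - a| <= 2^-1.
  by rewrite addrAC subrr sub0r normrN.
have M0 : 0 <= M.
  have aa : `|a - a| <= 2^-1 by rewrite subrr normr0 ltW// half_gt0.
  by have [_ _ _] := H a aa; apply: le_trans; exact: cmod_ge0.
pose G h := f (a + h) - f (a - h) - (2 * f1 a) * h%:C.
pose G1 h := f1 (a + h) + f1 (a - h) - 2 * f1 a.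
pose G2 h := f2 (a + h) - f2 (a - h).
pose G3 h := f3 (a + h) + f3 (a - h).
have d0 h : `|h| <= 2^-1 -> cder G h (G1 h).
  move=> hh; have [p _ _ _] := H _ (near1 _ hh); have [m _ _ _] := H _ (near2 _ hh).
  apply: (cder_ext (cderB (cderB (cder_shift p) (cder_reflect m))
    (cderZ (2 * f1 a) (cder_id h)))) => //.
  by rewrite /G1; ring.
have d1 h : `|h| <= 2^-1 -> cder G1 h (G2 h).
  move=> hh; have [_ p _ _] := H _ (near1 _ hh); have [_ m _ _] := H _ (near2 _ hh).
  apply: (cder_ext (cderB (cderD (cder_shift p) (cder_reflect m))
    (cder_cst h (2 * f1 a)))) => //.
  by rewrite /G2; ring.
have d2 h : `|h| <= 2^-1 -> cder G2 h (G3 h).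
  move=> hh; have [_ _ p _] := H _ (near1 _ hh); have [_ _ m _] := H _ (near2 _ hh).
  apply: (cder_ext (cderB (cder_shift p) (cder_reflect m))) => //.
  by rewrite /G3; ring.
have b3 h : `|h| <= 2^-1 -> cmod (G3 h) <= 2 * M * `|h| ^+ 0.
  move=> hh; have [_ _ _ p] := H _ (near1 _ hh); have [_ _ _ m] := H _ (near2 _ hh).
  by rewrite expr0 mulr1 (le_trans (cmodD _ _))// mulr_natl mulr2n lerD.
have G20 : G2 0 = 0 by rewrite /G2 addr0 subr0 subrr.
have G10 : G1 0 = 0 by rewrite /G1 addr0 subr0 mulr_natl mulr2n subrr.
have G00 : G 0 = 0 by rewrite /G addr0 subr0 subrr mulr0 subr0.
have hh : `|2^-1 : R| <= 2^-1 by rewrite ger0_norm// ltW// half_gt0.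
have M4 : 0 <= 2 * (2 * M) by rewrite !mulr_ge0.
have M8 : 0 <= 2 * (2 * (2 * M)) by rewrite !mulr_ge0.
have b2 := cder_vanish (mulr_ge0 (ler0n _ 2) M0) d2 G20 b3.
have b1 := cder_vanish M4 d1 G10 b2.
have := cder_vanish M8 d0 G00 b1 hh.
rewrite ger0_norm ?(ltW half_gt0)//.
rewrite (_ : _ * 2^-1 ^+ 3 = 2 * M); last by rewrite !exprS expr0; field.
rewrite (_ : G 2^-1 = f (a + 2^-1) - f (a - 2^-1) - f1 a)//.
rewrite /G; congr (_ - _).
by rewrite fmorphV (rmorph_nat (real_complex R)) mulrAC mulfV ?mul1r// pnatr_eq0.
Qed.

(** From x^2 >= 2 x - 1 the terms are dominated by a geometric progression. *)
Lemma sum_gauss_le (s : R) N : 0 < s ->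
  \sum_(1 <= a < N) expR (- (s * a%:R) ^+ 2) <= expR 1 / (2 * s).
Proof.
move=> s0; pose q := expR (- (2 * s)).
have q0 : 0 < q := expR_gt0 _.
have q1 : q < 1 by rewrite -expR0 ltr_expR oppr_lt0 mulr_gt0.
have le_geo a : expR (- (s * a%:R) ^+ 2) <= expR 1 * q ^+ a.
  rewrite -expRM_natl -expRD ler_expR.
  by have := sqr_ge0 (s * a%:R - 1); nra.
apply: (@le_trans _ _ (\sum_(1 <= a < N) expR 1 * q ^+ a)).
  by apply: ler_sum => a _.
rewrite -mulr_sumr ler_pM2l ?expR_gt0//.
have geo : (1 - q) * \sum_(1 <= a < N) q ^+ a <= q.
  case: N => [|N]; first by rewrite big_geq// mulr0 ltW.
  suff -> : (1 - q) * \sum_(1 <= a < N.+1) q ^+ a = q - q ^+ N.+1.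
    by rewrite lerBlDr lerDl exprn_ge0// ltW.
  elim: N => [|N IH]; first by rewrite big_geq// mulr0 expr1 subrr.
  by rewrite big_nat_recr//= mulrDr IH [q ^+ N.+2]exprS; ring.
have qq : q * expR (2 * s) = 1 by rewrite /q -expRD addNr expR0.
have es := expR_ge1Dx (2 * s).
rewrite -[leRHS]mul1r ler_pdivlMr ?mulr_gt0// -(ler_pM2l q0).
have S0 : 0 <= \sum_(1 <= a < N) q ^+ a by apply: sumr_ge0 => a _; rewrite exprn_ge0// ltW.
set S := \sum_(_ <= _ < _) _ in geo S0 *.
have : 2 * s * q <= 1 - q by nra.
nra.
Qed.

End GaussianSum.

Section GaussianSumAsymptotics.
Context {R : realType}.
Implicit Types (e : R[i]) (x : R).

(** [gE] and [gF] are the even and odd Gaussians exp(- e x^2) and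
    x exp(- e x^2); the digits mark their successive derivatives. *)
Definition gE e x : R[i] := cexp (- (e * x%:C ^+ 2)).
Definition gF e x : R[i] := x%:C * gE e x.
Definition gF1 e x : R[i] := (1 - 2 * e * x%:C ^+ 2) * gE e x.
Definition gF2 e x : R[i] := (- (6 * e * x%:C) + 4 * e ^+ 2 * x%:C ^+ 3) * gE e x.
Definition gF3 e x : R[i] :=
  (- (6 * e) + 24 * e ^+ 2 * x%:C ^+ 2 - 8 * e ^+ 3 * x%:C ^+ 4) * gE e x.
Definition gE1 e x : R[i] := - (2 * e * x%:C) * gE e x.
Definition gE2 e x : R[i] := (- (2 * e) + 4 * e ^+ 2 * x%:C ^+ 2) * gE e x.

Lemma cder_pow x n : cder (fun t : R => t%:C ^+ n) x (n%:R * x%:C ^+ n.-1).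
Proof. by apply: (cder_ext (cderX n (cder_id x))) => //; rewrite mulr1. Qed.

Lemma cder_gE e x : cder (gE e) x (gE1 e x).
Proof.
apply: (cder_ext (cder_cexp (cderN (cderZ e (cder_pow x 2))))) => //.
by rewrite /gE1 /gE expr1; ring.
Qed.

Lemma cder_gE1 e x : cder (gE1 e) x (gE2 e x).
Proof.
apply: (cder_ext (cderM (cderN (cderZ (2 * e) (cder_id x))) (cder_gE e x))) => //.
by rewrite /gE2 /gE1; ring.
Qed.

Lemma cder_gF e x : cder (gF e) x (gF1 e x).
Proof.
apply: (cder_ext (cderM (cder_id x) (cder_gE e x))) => //.
by rewrite /gF1 /gE1; ring.
Qed.

Lemma cder_gF1 e x : cder (gF1 e) x (gF2 e x).
Proof.
apply: (cder_ext (cderM (cderB (cder_cst x 1) (cderZ (2 * e) (cder_pow x 2)))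
  (cder_gE e x))) => //.
by rewrite /gF2 /gE1 expr1; ring.
Qed.

Lemma cder_gF2 e x : cder (gF2 e) x (gF3 e x).
Proof.
apply: (cder_ext (cderM (cderD (cderN (cderZ (6 * e) (cder_id x)))
  (cderZ (4 * e ^+ 2) (cder_pow x 3))) (cder_gE e x))) => //.
by rewrite /gF3 /gE1; ring.
Qed.

Lemma cmod_gE e x : cmod (gE e x) = expR (- (complex.Re e * x ^+ 2)).
Proof.
rewrite /gE cmod_cexp ReN ReM; congr (expR (- _)).
by rewrite -(rmorphXn (real_complex R)) Re_real Im_real mulr0 subr0.
Qed.

Lemma expN_le1 (y : R) : 0 <= y -> expR (- y) <= 1.
Proof. by move=> y0; rewrite -expR0 ler_expR oppr_le0. Qed.

Lemma expN_le_V2 (y : R) : 0 < y -> expR (- y) <= 4 / y ^+ 2.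
Proof.
move=> y0; rewrite expRN -[leRHS]invrK lef_pV2 ?posrE ?expR_gt0 ?invr_gt0
  ?divr_gt0 ?exprn_gt0//.
rewrite invf_div; have := expR_ge1Dx (y / 2) => h.
have -> : expR y = expR (y / 2) ^+ 2.
  by rewrite -expRM_natl; congr expR; field.
rewrite (_ : _ / 4 = (y / 2) ^+ 2); last by field.
by rewrite lerXn2r ?nnegrE ?expR_ge0 ?divr_ge0 ?(ltW y0)//; lra.
Qed.

Lemma y_exp_le (y : R) : 0 <= y -> y * expR (- (y / 2)) <= 2.
Proof.
move=> y0; have := expR_ge1Dx (y / 2).
have := expR_gt0 (- (y / 2)).
have : expR (- (y / 2)) * expR (y / 2) = 1 by rewrite -expRD addNr expR0.
nra.
Qed.

Lemma y2_exp_le (y : R) : 0 <= y -> y ^+ 2 * expR (- (y / 2)) <= 16.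
Proof.
move=> y0; have h := y_exp_le (_ : 0 <= y / 2).
have {}h : y / 2 * expR (- (y / 2 / 2)) <= 2 by apply: h; lra.
have -> : expR (- (y / 2)) = expR (- (y / 2 / 2)) ^+ 2.
  by rewrite -expRM_natl; congr expR; field.
have := expR_ge0 (- (y / 2 / 2)); set q := expR _ in h * => q0.
have : 0 <= y * q by rewrite mulr_ge0.
nra.
Qed.

(** Half of the exponent is kept aside to absorb the powers of x that the
    derivatives produce. *)
Lemma gauss_split (k x : R) e : 0 < k -> k <= complex.Re e ->
  cmod (gE e x) <= expR (- (k * x ^+ 2 / 2)) ^+ 2.
Proof.
move=> k0 ke; rewrite cmod_gE -expRM_natl ler_expR.
by have := sqr_ge0 x; nra.
Qed.

Lemma cmod_nat_mul n e : cmod (n%:R * e) = n%:R * cmod e.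
Proof. by rewrite cmodM cmod_nat. Qed.

Lemma gF3_bound (L k x : R) e : 0 < k -> k <= complex.Re e ->
  cmod e <= L * k ->
  cmod (gF3 e x) <= k * (6 * L + 48 * L ^+ 2 + 128 * L ^+ 3) *
                    expR (- (k * x ^+ 2 / 2)).
Proof.
move=> k0 ke eL.
have x2 := sqr_ge0 x.
have y0 : 0 <= k * x ^+ 2 by rewrite mulr_ge0// ltW.
have L0 : 0 <= L.
  rewrite -(pmulr_rge0 _ k0) mulrC; apply: le_trans eL; exact: cmod_ge0.
have g := gauss_split x k0 ke.
have yq := y_exp_le y0; have y2q := y2_exp_le y0.
have q1 : expR (- (k * x ^+ 2 / 2)) <= 1 by apply: expN_le1; rewrite divr_ge0.
have q0 := expR_gt0 (- (k * x ^+ 2 / 2)).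
rewrite /gF3 cmodM; move: g yq y2q q1 q0; set q := expR _ => g yq y2q q1 q0.
set y := k * x ^+ 2 in yq y2q y0 *.
have poly : cmod (- (6 * e) + 24 * e ^+ 2 * x%:C ^+ 2 - 8 * e ^+ 3 * x%:C ^+ 4)
    <= k * (6 * L + 24 * L ^+ 2 * y + 8 * L ^+ 3 * y ^+ 2).
  have e0 := cmod_ge0 e.
  have e2 : cmod e ^+ 2 <= (L * k) ^+ 2 by rewrite lerXn2r ?nnegrE// (le_trans e0).
  have e3 : cmod e ^+ 3 <= (L * k) ^+ 3 by rewrite lerXn2r ?nnegrE// (le_trans e0).
  have x4 : 0 <= x ^+ 4 by rewrite exprn_even_ge0.
  apply: (le_trans (cmodB _ _)); apply: (le_trans (lerD (cmodD _ _) (lexx _))).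
  rewrite cmodN !(cmodX, cmod_nat, cmodR, cmodM).
  have -> : `|x| ^+ 2 = x ^+ 2 by rewrite real_normK ?num_real.
  have -> : `|x| ^+ 4 = x ^+ 4.
    by rewrite (exprM `|x| 2 2) real_normK ?num_real// -exprM.
  apply: (@le_trans _ _ (6 * (L * k) + 24 * (L * k) ^+ 2 * x ^+ 2 +
      8 * (L * k) ^+ 3 * x ^+ 4)).
    by apply: lerD; [apply: lerD|]; rewrite ?ler_wpM2r// ?ler_wpM2l.
  by rewrite le_eqVlt; apply/orP; left; apply/eqP; rewrite /y; ring.
apply: (le_trans (ler_pM (cmod_ge0 _) (cmod_ge0 _) poly g)).
rewrite (_ : _ * q ^+ 2 =
  k * ((6 * L + 24 * L ^+ 2 * y + 8 * L ^+ 3 * y ^+ 2) * q) * q); last by ring.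
rewrite ler_pM2r// ler_pM2l//.
have h1 : 6 * L * q <= 6 * L by rewrite ler_piMr// mulr_ge0.
have h2 : 24 * L ^+ 2 * (y * q) <= 24 * L ^+ 2 * 2.
  by rewrite ler_wpM2l// mulr_ge0// sqr_ge0.
have h3 : 8 * L ^+ 3 * (y ^+ 2 * q) <= 8 * L ^+ 3 * 16.
  by rewrite ler_wpM2l// mulr_ge0// exprn_ge0.
rewrite (_ : _ * q = 6 * L * q + 24 * L ^+ 2 * (y * q) +
  8 * L ^+ 3 * (y ^+ 2 * q)); last by ring.
lra.
Qed.

Lemma gE2_bound (k x : R) : 0 < k ->
  cmod (gE2 k%:C x) <= k * 10 * expR (- (k * x ^+ 2 / 2)).
Proof.
move=> k0.
have x2 := sqr_ge0 x.
have y0 : 0 <= k * x ^+ 2 by rewrite mulr_ge0// ltW.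
have g := @gauss_split k x k%:C k0 (lexx _).
have yq := y_exp_le y0.
have q1 : expR (- (k * x ^+ 2 / 2)) <= 1 by apply: expN_le1; rewrite divr_ge0.
have q0 := expR_gt0 (- (k * x ^+ 2 / 2)).
rewrite /gE2 cmodM; move: g yq q1 q0; set q := expR _ => g yq q1 q0.
have poly : cmod (- (2 * k%:C) + 4 * k%:C ^+ 2 * x%:C ^+ 2)
    <= k * (2 + 4 * (k * x ^+ 2)).
  apply: (le_trans (cmodD _ _)).
  rewrite cmodN !(cmodX, cmod_nat, cmodR, cmodM).
  rewrite !real_normK ?num_real// (gtr0_norm k0).
  by rewrite le_eqVlt; apply/orP; left; apply/eqP; ring.
apply: (le_trans (ler_pM (cmod_ge0 _) (cmod_ge0 _) poly g)).
rewrite (_ : _ * q ^+ 2 = k * ((2 + 4 * (k * x ^+ 2)) * q) * q); last by ring.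
rewrite ler_pM2r// ler_pM2l//.
nra.
Qed.

(** A Gaussian at a point of the unit interval around a is comparable to a
    wider Gaussian at a, which makes local bounds summable over a. *)
Lemma gauss_shift (k x a : R) : 0 < k -> k <= 1 -> `|x - a| <= 2^-1 ->
  expR (- (k * x ^+ 2 / 2)) <= expR 1 * expR (- (Num.sqrt k / 2 * a) ^+ 2).
Proof.
move=> k0 k1 xa; rewrite -expRD ler_expR exprMn expr_div_n sqr_sqrtr ?(ltW k0)//.
have : (x - a) ^+ 2 <= 2^-1 ^+ 2.
  by rewrite -[X in X <= _](real_normK (num_real _)) lerXn2r ?nnegrE// invr_ge0.
have := sqr_ge0 (2 * x - a) => h1 h2.
suff : k * (a ^+ 2 / 4 - x ^+ 2 / 2) <= 1 by lra.
have : a ^+ 2 / 4 - x ^+ 2 / 2 <= 1 by nra.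
move=> h3; have [h4|h4] := leP 0 (a ^+ 2 / 4 - x ^+ 2 / 2); nra.
Qed.

(** The sum of the derivatives at the integers is the midpoint rule for the
    telescoping sum of the increments of f. *)
Lemma midpoint_sum (f f1 : R -> R[i]) (k B : R) N : (0 < N)%N ->
  0 < k -> 0 <= B ->
  (forall a, (1 <= a < N)%N ->
     cmod (f (a%:R + 2^-1) - f (a%:R - 2^-1) - f1 a%:R) <=
     2 * (k * B * (expR 1 * expR (- (Num.sqrt k / 2 * a%:R) ^+ 2)))) ->
  cmod (\sum_(1 <= a < N) f1 a%:R - (f (N%:R - 2^-1) - f 2^-1)) <=
  2 * expR 1 ^+ 2 * B * Num.sqrt k.
Proof.
move=> N0 k0 B0 H.
have sk0 : 0 < Num.sqrt k by rewrite sqrtr_gt0.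
have -> : f (N%:R - 2^-1) - f 2^-1 =
    \sum_(1 <= a < N) (f (a%:R + 2^-1) - f (a%:R - 2^-1)).
  have := @telescope_sumr _ 1%N N (fun a => f (a%:R - 2^-1)) N0.
  rewrite (_ : 1%:R - 2^-1 = 2^-1 :> R); last by field.
  move=> <-; apply: eq_bigr => a _; congr (f _ - _).
  by rewrite -natr1 -addrA; congr (_ + _); field.
rewrite -sumrB; apply: (le_trans (cmod_sum _ _ _)).
apply: (@le_trans _ _ (\sum_(1 <= a < N) 2 * k * B * expR 1 *
      expR (- (Num.sqrt k / 2 * a%:R) ^+ 2))).
  rewrite big_nat_cond [leRHS]big_nat_cond; apply: ler_sum => a.
  rewrite andbT => aN; rewrite cmodBC; apply: (le_trans (H _ aN)).
  by rewrite !mulrA.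
rewrite -mulr_sumr.
have s0 : 0 < Num.sqrt k / 2 by rewrite divr_gt0.
have := sum_gauss_le N s0.
have -> : 2 * (Num.sqrt k / 2) = Num.sqrt k by field.
move=> h; have C0 : 0 <= 2 * k * B * expR 1.
  by rewrite mulr_ge0 ?expR_ge0// !mulr_ge0// ltW.
apply: (le_trans (ler_wpM2l C0 h)).
rewrite le_eqVlt; apply/orP; left; apply/eqP.
rewrite -{1}[k](sqr_sqrtr (ltW k0)); field.
exact: lt0r_neq0.
Qed.

End GaussianSumAsymptotics.

(** * Asymptotics of Gaussian sums *)

Section GaussSumLimit.
Context {R : realType}.

(** The sum of exp(- e a^2) over the integers a with |a| < N, folded by
    parity. *)
Definition gauss_sum (N : nat) (e : R[i]) : R[i] :=
  1 + 2 * \sum_(1 <= a < N) gE e a%:R.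

Lemma sqrt_div4 (r s : R) : 0 < r -> 0 < s ->
  Num.sqrt (r / (4 * s)) = Num.sqrt r / (2 * Num.sqrt s).
Proof.
move=> r0 s0; rewrite sqrtrM ?(ltW r0)// sqrtrV ?mulr_ge0 ?(ltW s0)//.
rewrite sqrtrM// (_ : 4 = 2 ^+ 2); last by rewrite expr2 -natrM.
by rewrite sqrtr_sqr ger0_norm.
Qed.

(** The midpoint rule compares the sum with the Gaussian integral; the two
    endpoints contribute a cubic error near 0 and an exponentially small one
    at infinity. *)
Lemma real_gauss_sum (r : R) : 0 < r -> exists C : R, forall k : nat,
  (0 < k)%N -> r <= 4 * k%:R ->
  cmod (gauss_sum k (r / (4 * k%:R))%:C -
        (Num.sqrt (4 * pi / r) * Num.sqrt k%:R)%:C) <= C / Num.sqrt k%:R.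
Proof.
move=> r0.
exists ((1 + 40 * expR 1 ^+ 2) * Num.sqrt r + 256 * expR 1 / (r * Num.sqrt r)).
move=> k k0 rk.
have kR0 : 0 < k%:R :> R by rewrite ltr0n.
have kR1 : 1 <= k%:R :> R by rewrite ler1n.
set e := r / (4 * k%:R).
have e0 : 0 < e by rewrite divr_gt0// mulr_gt0.
have e1 : e <= 1 by rewrite ler_pdivrMr ?mulr_gt0// mul1r.
have sk0 : 0 < Num.sqrt k%:R :> R by rewrite sqrtr_gt0.
have sr0 : 0 < Num.sqrt r by rewrite sqrtr_gt0.
have seE : Num.sqrt e = Num.sqrt r / (2 * Num.sqrt k%:R) by exact: sqrt_div4.
have se0 : 0 < Num.sqrt e by rewrite sqrtr_gt0.
have se1 : Num.sqrt e <= 1 by rewrite -sqrtr1 ler_sqrt.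
have see : Num.sqrt e ^+ 2 = e by rewrite sqr_sqrtr// ltW.
pose f (x : R) := gint (x * Num.sqrt e) / Num.sqrt e.
have df (x : R) : 0 < x -> is_derive x 1 f (expR (- (e * x ^+ 2))).
  move=> x0.
  have d1 : is_derive x 1 (fun t : R => t * Num.sqrt e) (Num.sqrt e).
    apply: (is_derive_ext (is_deriveM (is_derive_id x 1)
      (is_derive_cst (Num.sqrt e) x 1))) => //.
    by rewrite /GRing.scale /= mulr0 add0r mulr1.
  have d2 := @is_derive1_comp R gint (fun t => t * Num.sqrt e) x _ _
    (gint_derive (mulr_gt0 x0 se0)) d1.
  apply: (is_derive_ext (is_deriveM d2 (is_derive_cst (Num.sqrt e)^-1 x 1))) => //.
  rewrite /GRing.scale /= exprMn see [x ^+ 2 * e]mulrC.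
  by field; rewrite gt_eqF.
pose fC (x : R) : R[i] := (f x)%:C.
have dfC (x : R) : 0 < x -> cder fC x (gE e%:C x).
  move=> x0; have -> : gE e%:C x = (expR (- (e * x ^+ 2)))%:C.
    by rewrite /gE -(rmorphXn (real_complex R)) -rmorphM -rmorphN cexp_real.
  split; first exact: df.
  exact: is_derive_ext (is_derive_cst 0 x 1) _ _.
have mid : cmod (\sum_(1 <= a < k) gE e%:C a%:R - (fC (k%:R - 2^-1) - fC 2^-1))
    <= 2 * expR 1 ^+ 2 * 10 * Num.sqrt e.
  apply: midpoint_sum => // a /andP[a1 _].
  apply: (@central_difference R fC (gE e%:C) (gE1 e%:C) (gE2 e%:C) a%:R
     (e * 10 * (expR 1 * expR (- (Num.sqrt e / 2 * a%:R) ^+ 2)))) => x xa.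
  split; [|exact: cder_gE|exact: cder_gE1|].
    apply: dfC; move: xa; rewrite ler_norml => /andP[xa _].
    have : 1 <= a%:R :> R by rewrite ler1n.
    by lra.
  apply: (le_trans (gE2_bound _ e0)).
  have e10 : 0 < e * 10 by rewrite pmulr_lgt0.
  by rewrite (ler_pM2l e10); exact: (gauss_shift e0 e1 xa).
have half : `|2 * f 2^-1 - 1| <= Num.sqrt e.
  have X0 : 0 < 2^-1 * Num.sqrt e by rewrite mulr_gt0// half_gt0.
  have := gint_small X0; set X := 2^-1 * Num.sqrt e in X0 * => h.
  have -> : 2 * f 2^-1 - 1 = (gint X - X) * (2 / Num.sqrt e).
    by rewrite /f -/X /X; field; rewrite gt_eqF.
  rewrite normrM (ger0_norm (_ : 0 <= 2 / _)) ?divr_ge0 ?(ltW se0)//.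
  apply: (@le_trans _ _ (X ^+ 3 * (2 / Num.sqrt e))).
    by rewrite ler_wpM2r// divr_ge0// ltW.
  have -> : X ^+ 3 * (2 / Num.sqrt e) = Num.sqrt e * Num.sqrt e / 4.
    by rewrite /X; field; rewrite gt_eqF.
  nra.
have tail : `|2 * f (k%:R - 2^-1) - Num.sqrt pi / Num.sqrt e| <=
    256 * expR 1 / (r * Num.sqrt r) / Num.sqrt k%:R.
  have X0 : 0 < (k%:R - 2^-1) * Num.sqrt e by rewrite mulr_gt0//; lra.
  have := gint_tail X0; rewrite /f; set X := _ * Num.sqrt e in X0 * => h.
  have -> : 2 * (gint X / Num.sqrt e) - Num.sqrt pi / Num.sqrt e =
      (gint X - Num.sqrt pi / 2) * (2 / Num.sqrt e).
    by field; rewrite gt_eqF.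
  rewrite normrM (ger0_norm (_ : 0 <= 2 / _)) ?divr_ge0 ?(ltW se0)//.
  have h2 : expR (1 - X) <= expR 1 * (4 / X ^+ 2).
    by rewrite expRD ler_wpM2l ?expR_ge0// expN_le_V2.
  have Xk : k%:R / 2 * Num.sqrt e <= X by rewrite ler_wpM2r ?(ltW se0)//; lra.
  have Xk0 : 0 < k%:R / 2 * Num.sqrt e by rewrite mulr_gt0// divr_gt0.
  have h3 : 4 / X ^+ 2 <= 4 / (k%:R / 2 * Num.sqrt e) ^+ 2.
    rewrite ler_pM2l// lef_pV2 ?posrE ?exprn_gt0//.
    by rewrite lerXn2r ?nnegrE// ltW.
  apply: (@le_trans _ _ (expR 1 * (4 / (k%:R / 2 * Num.sqrt e) ^+ 2) *
      (2 / Num.sqrt e))).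
    rewrite ler_wpM2r ?divr_ge0 ?(ltW se0)//.
    apply: (le_trans h); apply: (le_trans h2).
    by rewrite ler_wpM2l ?expR_ge0.
  rewrite seE.
  have kE : k%:R = Num.sqrt k%:R ^+ 2 :> R by rewrite sqr_sqrtr// ltW.
  rewrite {1}kE.
  rewrite -[X in _ / (X * Num.sqrt r)](sqr_sqrtr (ltW r0)).
  rewrite le_eqVlt; apply/orP; left; apply/eqP; field.
  by rewrite !gt_eqF.
have lim : Num.sqrt (4 * pi / r) * Num.sqrt k%:R = Num.sqrt pi / Num.sqrt e.
  have pi0 := pi_gt0 R.
  rewrite seE sqrtrM ?mulr_ge0 ?(ltW pi0)// sqrtrV ?(ltW r0)//.
  rewrite sqrtrM// (_ : 4 = 2 ^+ 2); last by rewrite expr2 -natrM.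
  rewrite sqrtr_sqr ger0_norm//; field.
  by rewrite !gt_eqF.
rewrite lim.
have -> : gauss_sum k e%:C - (Num.sqrt pi / Num.sqrt e)%:C =
   2 * (\sum_(1 <= a < k) gE e%:C a%:R - (fC (k%:R - 2^-1) - fC 2^-1)) +
   ((2 * f (k%:R - 2^-1) - Num.sqrt pi / Num.sqrt e)%:C
    - (2 * f 2^-1 - 1)%:C).
  rewrite /gauss_sum /fC !rmorphB !rmorphM /= (rmorph_nat (real_complex R)).
  by ring.
apply: (le_trans (cmodD _ _)); rewrite cmod_nat_mul.
apply: (le_trans (lerD (lexx _) (cmodB _ _))).
rewrite !cmodR [leRHS]mulrDl.
have -> : (1 + 40 * expR 1 ^+ 2) * Num.sqrt r / Num.sqrt k%:R =
   2 * (2 * expR 1 ^+ 2 * 10 * Num.sqrt e) + Num.sqrt e +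
   Num.sqrt e * (1 + 40 * expR 1 ^+ 2).
  by rewrite seE; field; rewrite gt_eqF.
have : 0 <= Num.sqrt e * (1 + 40 * expR 1 ^+ 2).
  by rewrite mulr_ge0 ?(ltW se0)// addr_ge0// mulr_ge0// exprn_ge0// expR_ge0.
by lra.
Qed.

End GaussSumLimit.

Section ComplexGaussSum.
Context {R : realType}.
Implicit Types (c e w : R[i]).

Lemma Re_mulr (z : R[i]) (x : R) : complex.Re (z * x%:C) = complex.Re z * x.
Proof. by rewrite ReM Re_real Im_real mulr0 subr0. Qed.

Lemma gE_0 e : gE e 0 = 1.
Proof. by rewrite /gE expr0n /= mulr0 oppr0 cexp0. Qed.

(** The sum over all integers of the derivative of x exp(- e x^2) would be 0
    if the midpoint rule were exact, since this function vanishes at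
    infinity. *)
Lemma gF1_sum_bound (K L : R) : 0 < K -> 0 <= L -> exists D : R,
  forall (k : nat) e, (0 < k)%N -> K <= 4 * k%:R ->
    K / (4 * k%:R) <= complex.Re e -> cmod e <= L * (K / (4 * k%:R)) ->
    cmod (1 + 2 * \sum_(1 <= a < k) gF1 e a%:R) <= D / Num.sqrt k%:R.
Proof.
move=> K0 L0; pose B := 6 * L + 48 * L ^+ 2 + 128 * L ^+ 3.
have B0 : 0 <= B by rewrite /B !addr_ge0// ?mulr_ge0// ?exprn_ge0.
exists (2048 / K ^+ 2 + (B + 2 * expR 1 ^+ 2 * B) * Num.sqrt K).
move=> k e k0 Kk; set q := K / _ => qe eL.
have kR0 : 0 < k%:R :> R by rewrite ltr0n.
have kR1 : 1 <= k%:R :> R by rewrite ler1n.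
have q0 : 0 < q by rewrite divr_gt0// mulr_gt0.
have q1 : q <= 1 by rewrite ler_pdivrMr ?mulr_gt0// mul1r.
have sk0 : 0 < Num.sqrt k%:R :> R by rewrite sqrtr_gt0.
have sk1 : 1 <= Num.sqrt k%:R :> R by rewrite -[leLHS]sqrtr1 ler_sqrt.
have skk : Num.sqrt k%:R ^+ 2 = k%:R :> R by rewrite sqr_sqrtr// ltW.
have sqE : Num.sqrt q = Num.sqrt K / (2 * Num.sqrt k%:R) by exact: sqrt_div4.
have sq0 : 0 < Num.sqrt q by rewrite sqrtr_gt0.
have sq1 : Num.sqrt q <= 1 by rewrite -sqrtr1 ler_sqrt.
have sqq : Num.sqrt q ^+ 2 = q by rewrite sqr_sqrtr// ltW.
have qsq : q <= Num.sqrt q by rewrite -[leLHS]sqq expr2 ler_piMr ?(ltW sq0).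
have qB0 : 0 <= q * B by rewrite mulr_ge0// ltW.
have mid : cmod (\sum_(1 <= a < k) gF1 e a%:R - (gF e (k%:R - 2^-1) - gF e 2^-1))
    <= 2 * expR 1 ^+ 2 * B * Num.sqrt q.
  apply: midpoint_sum => // a /andP[a1 _].
  apply: (@central_difference R (gF e) (gF1 e) (gF2 e) (gF3 e) a%:R
     (q * B * (expR 1 * expR (- (Num.sqrt q / 2 * a%:R) ^+ 2)))) => x xa.
  split; [exact: cder_gF|exact: cder_gF1|exact: cder_gF2|].
  apply: (le_trans (gF3_bound _ q0 qe eL)).
  exact: ler_wpM2l (gauss_shift q0 q1 xa).
have zero : cmod (gF e (0 + 2^-1) - gF e (0 - 2^-1) - gF1 e 0) <= 2 * (q * B).
  apply: (@central_difference R (gF e) (gF1 e) (gF2 e) (gF3 e) 0 (q * B)) => x xa.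
  split; [exact: cder_gF|exact: cder_gF1|exact: cder_gF2|].
  apply: (le_trans (gF3_bound _ q0 qe eL)).
  rewrite -[leRHS]mulr1 ler_wpM2l// expN_le1// divr_ge0// mulr_ge0 ?sqr_ge0//.
  exact: ltW.
have gFN x : gF e (- x) = - gF e x.
  by rewrite /gF /gE rmorphN sqrrN mulNr.
have F10 : gF1 e 0 = 1 by rewrite /gF1 gE_0 expr0n /= mulr0 subr0 mulr1.
have last : cmod (gF e (k%:R - 2^-1)) <= 1024 / K ^+ 2 / Num.sqrt k%:R.
  rewrite /gF cmodM cmodR cmod_gE.
  have kh : 0 <= k%:R - 2^-1 :> R by lra.
  rewrite (ger0_norm kh).
  have Y0 : 0 < q * (k%:R / 2) ^+ 2 by rewrite mulr_gt0// exprn_gt0// divr_gt0.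
  have h1 : expR (- (complex.Re e * (k%:R - 2^-1) ^+ 2)) <=
      expR (- (q * (k%:R / 2) ^+ 2)).
    rewrite ler_expR lerN2 ler_pM ?(ltW q0) ?sqr_ge0//.
    by rewrite lerXn2r ?nnegrE ?divr_ge0//; lra.
  have h2 := le_trans h1 (expN_le_V2 Y0).
  apply: (@le_trans _ _ (k%:R * (4 / (q * (k%:R / 2) ^+ 2) ^+ 2))).
    by rewrite ler_pM ?expR_ge0//; lra.
  have -> : k%:R * (4 / (q * (k%:R / 2) ^+ 2) ^+ 2) = 1024 / K ^+ 2 / k%:R.
    by rewrite /q; field; rewrite !gt_eqF.
  apply: ler_wpM2l; first by apply: divr_ge0; [exact: ler0n|exact: sqr_ge0].
  rewrite lef_pV2 ?posrE// -[leRHS]skk expr2.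
  by apply: ler_peMl => //; exact: ltW.
rewrite add0r sub0r gFN opprK F10 in zero.
have -> : 1 + 2 * \sum_(1 <= a < k) gF1 e a%:R =
   2 * (\sum_(1 <= a < k) gF1 e a%:R - (gF e (k%:R - 2^-1) - gF e 2^-1))
   - (gF e 2^-1 + gF e 2^-1 - 1) + 2 * gF e (k%:R - 2^-1) by ring.
apply: (le_trans (cmodD _ _)); apply: (le_trans (lerD (cmodB _ _) (lexx _))).
rewrite !cmod_nat_mul.
have -> : (2048 / K ^+ 2 + (B + 2 * expR 1 ^+ 2 * B) * Num.sqrt K) / Num.sqrt k%:R =
  2 * (1024 / K ^+ 2 / Num.sqrt k%:R) + 2 * (Num.sqrt q * B) +
  2 * (2 * expR 1 ^+ 2 * B * Num.sqrt q).
  by rewrite sqE; field; rewrite !gt_eqF.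
have : q * B <= Num.sqrt q * B by rewrite ler_wpM2r.
by lra.
Qed.

(** The product W exp(- W^2 s a^2) is, up to the factor a, the function
    x exp(- s x^2) at x = a W; its derivative in W therefore involves the
    derivative in x. *)
Lemma cder_gauss_sum (W : R -> R[i]) (W' : R[i]) (u : R) (k : nat) (s : R[i]) :
  cder W u W' ->
  cder (fun t => W t * gauss_sum k (W t ^+ 2 * s)) u
    (W' * (1 + 2 * \sum_(1 <= a < k) gF1 (W u ^+ 2 * s) a%:R)).
Proof.
move=> dW.
have dE (a : nat) : cder (fun t => gE (W t ^+ 2 * s) a%:R) u
    (- (2 * W u * W' * s * a%:R%:C ^+ 2) * gE (W u ^+ 2 * s) a%:R).
  have := cder_cexp (cderN (cderM (cderM (cderX 2 dW) (cder_cst u s))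
     (cder_cst u (a%:R%:C ^+ 2)))).
  by move/cder_ext; apply => //; rewrite /gE /= expr1; ring.
have dS := cder_sum (index_iota 1 k) dE.
have dG := cderM dW (cderD (cder_cst u 1) (cderZ 2 dS)).
apply: (cder_ext dG) => //.
set D := (X in W u * (0 + 2 * X)).
have -> : W u * (0 + 2 * D) = 2 * (W u * D) by ring.
have -> : W u * D = W' * (\sum_(1 <= a < k) gF1 (W u ^+ 2 * s) a%:R -
    \sum_(1 <= a < k) gE (W u ^+ 2 * s) a%:R).
  rewrite /D -sumrB !mulr_sumr; apply: eq_bigr => a _.
  by rewrite /gF1; ring.
by ring.
Qed.

(** Along the path W(u) = Re w + i u Im w between Re w and a square root w of
    c, the product of W and of the Gaussian sum of parameter W^2 has a small
    derivative, because the sum of the derivatives of an odd Gaussian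
    telescopes up to a third-order error. This transports the value of the
    real Gaussian sum to complex parameters, with no complex integral, and
    selects the square root of 4 pi / c. *)
Lemma complex_gauss_sum c : 0 < complex.Re c -> exists2 v : R[i],
  v ^+ 2 = 4 * pi%:C / c &
  exists C : R, forall k : nat, (0 < k)%N -> cmod c <= 4 * k%:R ->
    cmod (gauss_sum k (c / (4 * k%:R)) - v * (Num.sqrt k%:R)%:C) <=
    C / Num.sqrt k%:R.
Proof.
move=> Rc0.
have [w wc wr0] : exists2 w : R[i], w ^+ 2 = c & 0 <= complex.Re w.
  have [h|h] := leP 0 (complex.Re (sqrtc c)).
    by exists (sqrtc c); rewrite ?sqr_sqrtc.
  by exists (- sqrtc c); rewrite ?sqrrN ?sqr_sqrtc// ReN oppr_ge0 ltW.
pose wr := complex.Re w; pose wi := complex.Im w.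
have wE : w = wr%:C + 'i * wi%:C by exact: complexE.
have RcE : complex.Re c = wr ^+ 2 - wi ^+ 2 by rewrite -wc expr2 ReM !expr2.
have {}wr0 : 0 < wr.
  rewrite lt_neqAle wr0 andbT eq_sym; apply: contraTneq Rc0 => wr00.
  by rewrite RcE [wr]wr00 expr0n /= sub0r -leNgt oppr_le0 sqr_ge0.
have cE : cmod c = wr ^+ 2 + wi ^+ 2.
  by rewrite -wc cmodX cmodE sqr_sqrtr// addr_ge0 ?sqr_ge0.
have w0 : w != 0 by apply: contraTneq wr0 => w0; rewrite /wr w0 /= ltxx.
have r0 : 0 < wr ^+ 2 by rewrite exprn_gt0.
have pi0 := pi_gt0 R.
have [C1 HC1] := real_gauss_sum r0.
have L0 : 0 <= cmod c / complex.Re c by rewrite divr_ge0 ?cmod_ge0// ltW.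
have [D HD] := gF1_sum_bound Rc0 L0.
pose v : R[i] := (Num.sqrt (4 * pi / wr ^+ 2) * wr)%:C / w.
exists v.
  rewrite /v expr_div_n wc -(rmorphXn (real_complex R)) /= exprMn.
  rewrite sqr_sqrtr; last by rewrite divr_ge0 ?mulr_ge0// ltW.
  rewrite divfK ?gt_eqF// rmorphM /=.
  by rewrite (rmorph_nat (real_complex R)).
exists ((2 * `|wi| * D + wr * C1) / cmod w).
move=> k k0 ck.
have kR0 : 0 < k%:R :> R by rewrite ltr0n.
have sk0 : 0 < Num.sqrt k%:R :> R by rewrite sqrtr_gt0.
have k4 : 0 < 4 * k%:R :> R by rewrite mulr_gt0.
pose s : R[i] := (4 * k%:R)^-1.
have sE : s = (4 * k%:R)^-1%:C.
  by rewrite /s fmorphV rmorphM /= !(rmorph_nat (real_complex R)).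
pose W (u : R) : R[i] := wr%:C + 'i * wi%:C * u%:C.
have dW u : cder W u ('i * wi%:C).
  apply: (cder_ext (cderD (cder_cst u wr%:C) (cderZ ('i * wi%:C) (cder_id u)))) => //.
  by rewrite add0r mulr1.
pose psi u := W u * gauss_sum k (W u ^+ 2 * s).
have ReW u : complex.Re (W u) = wr by rewrite /W; csimp; ring.
have ImW u : complex.Im (W u) = wi * u by rewrite /W; csimp; ring.
have ReW2 u : complex.Re (W u ^+ 2) = wr ^+ 2 - wi ^+ 2 * u ^+ 2.
  by rewrite (expr2 (W u)) ReM ReW ImW; ring.
have bound (u : R) : 0 <= u <= 1 ->
    cmod ('i * wi%:C * (1 + 2 * \sum_(1 <= a < k) gF1 (W u ^+ 2 * s) a%:R)) <=
    `|wi| * (D / Num.sqrt k%:R).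
  move=> /andP[u0 u1]; rewrite !cmodM cmodI mul1r cmodR ler_wpM2l//.
  have u2 : wi ^+ 2 * u ^+ 2 <= wi ^+ 2.
    by rewrite ler_piMr ?sqr_ge0// expr_le1.
  apply: HD => //.
  - apply: le_trans ck; apply: le_trans (Re_le_cmod _); exact: ler_norm.
  - rewrite sE Re_mulr ler_wpM2r ?invr_ge0 ?(ltW k4)//.
    by rewrite ReW2 RcE; lra.
  - rewrite cmodM sE cmodR ger0_norm ?invr_ge0 ?(ltW k4)//.
    rewrite mulrA divfK ?gt_eqF// ler_wpM2r ?invr_ge0 ?(ltW k4)//.
    rewrite cmodX cmodE sqr_sqrtr ?addr_ge0 ?sqr_ge0// ReW ImW exprMn cE.
    by lra.
have mv := cder_mean_value (f := psi) ler01 (fun u _ => cder_gauss_sum k s (dW u)) bound.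
have psi1 : psi 1 = w * gauss_sum k (c / (4 * k%:R)).
  by rewrite /psi /W mulr1 -wE wc.
have psi0 : psi 0 = wr%:C * gauss_sum k (wr ^+ 2 / (4 * k%:R))%:C.
  rewrite /psi /W mulr0 addr0 sE -(rmorphXn (real_complex R)) -rmorphM //.
rewrite psi1 psi0 subr0 mulr1 in mv.
have rk : wr ^+ 2 <= 4 * k%:R by apply: le_trans ck; rewrite cE lerDl sqr_ge0.
have h := HC1 k k0 rk.
have cw0 : 0 < cmod w by rewrite cmod_gt0.
rewrite -(ler_pM2l cw0) -cmodM.
set g := gauss_sum k (c / _) in mv *.
set g0 := gauss_sum k _ in mv h.
have -> : w * (g - v * (Num.sqrt k%:R)%:C) =
   (w * g - wr%:C * g0) +
   wr%:C * (g0 - (Num.sqrt (4 * pi / wr ^+ 2) * Num.sqrt k%:R)%:C).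
  have -> : w * (g - v * (Num.sqrt k%:R)%:C) = w * g - (w * v) * (Num.sqrt k%:R)%:C.
    by ring.
  have -> : w * v = (Num.sqrt (4 * pi / wr ^+ 2) * wr)%:C.
    by rewrite /v mulrC divfK.
  rewrite !(rmorphM (real_complex R)) /=.
  by ring.
apply: (le_trans (cmodD _ _)).
have -> : cmod w * ((2 * `|wi| * D + wr * C1) / cmod w / Num.sqrt k%:R) =
   2 * (`|wi| * (D / Num.sqrt k%:R)) + wr * (C1 / Num.sqrt k%:R).
  by field; rewrite !gt_eqF.
apply: lerD => //.
by rewrite cmodM cmodR ger0_norm ?(ltW wr0)// ler_pM2l.
Qed.

End ComplexGaussSum.

(** * Calculus in the plane *)

Section PlaneCalculus.
Context {R : realType}.
Implicit Types (f : R * R -> R[i]).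

(** Asking for all the larger constants near each point lets the local bounds
    be merged over a finite subcover. *)
Lemma compact_uniform (X : topologicalType) (K : set X) (P : X -> R -> Prop) :
  compact K ->
  (forall x, K x -> exists C : R, \forall y \near x, forall C', C <= C' -> P y C') ->
  exists C : R, forall x, K x -> P x C.
Proof.
move=> /compact_near_coveringP cK H.
have : \forall C \near +oo%R, K `<=` [set x | P x C].
  apply: (cK _ (nbhs +oo%R) (fun C x => P x C)) => x Kx.
  have [C HC] := H x Kx.
  near=> y C' => /=.
  have Cy : forall C', C <= C' -> P y C' by near: y.
  by apply: Cy; near: C'; exact: nbhs_pinfty_ge (num_real _).
move=> /filter_ex[C HC]; exists C => x Kx; exact: HC.
Unshelve. all: by end_near. Qed.

Lemma derive_ext (g : R -> R) (f : R * R -> R) (v : R * R) (x : R * R) (t : R) :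
  differentiable f x -> (forall h : R, g (h + t) = f (h *: v + x)) ->
  is_derive t 1 g ('D_v f x).
Proof.
move=> df E.
have dfv : derivable f x v by exact: diff_derivable.
have EE : (fun h : R => h^-1 *: (g (h *: 1 + t) - g t)) =
          (fun h => h^-1 *: (f (h *: v + x) - f x)).
  apply/funext => h; rewrite -(E h) /GRing.scale /= mulr1.
  by have := E 0; rewrite add0r scale0r add0r => ->.
apply: DeriveDef; first by rewrite /derivable EE.
by rewrite /derive EE.
Qed.

Lemma cder_slice1 f (s q : R) : differentiable (fun y => complex.Re (f y)) (s, q) ->
  differentiable (fun y => complex.Im (f y)) (s, q) ->
  cder (fun t => f (t, q)) s (cderive (mu R) f (s, q)).
Proof.
have e h : (h + s, q) = h *: mu R + (s, q).
  have -> : h *: mu R + (s, q) = (h * 1 + s, h * 0 + q) by [].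
  by rewrite mulr1 mulr0 add0r.
by move=> dr di; split; apply: derive_ext => // h; rewrite e.
Qed.

Lemma cder_slice2 f (s q : R) : differentiable (fun y => complex.Re (f y)) (s, q) ->
  differentiable (fun y => complex.Im (f y)) (s, q) ->
  cder (fun t => f (s, t)) q (cderive (lam R) f (s, q)).
Proof.
have e h : (s, h + q) = h *: lam R + (s, q).
  have -> : h *: lam R + (s, q) = (h * 0 + s, h * 1 + q) by [].
  by rewrite mulr1 mulr0 add0r.
by move=> dr di; split; apply: derive_ext => // h; rewrite e.
Qed.

Lemma cder_unique (f : R -> R[i]) x d e : cder f x d -> cder f x e -> d = e.
Proof.
move=> [dr di] [er ei]; apply: eqCP.
  by rewrite -(@derive_val _ _ _ _ _ _ _ dr) (@derive_val _ _ _ _ _ _ _ er).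
by rewrite -(@derive_val _ _ _ _ _ _ _ di) (@derive_val _ _ _ _ _ _ _ ei).
Qed.

Lemma near_cmod f (x : R * R) (e : R) : 0 < e ->
  differentiable (fun y => complex.Re (f y)) x ->
  differentiable (fun y => complex.Im (f y)) x ->
  \forall y \near x, cmod (f y - f x) <= e.
Proof.
move=> e0 dr di.
have e2 : 0 < e / 2 by rewrite divr_gt0.
have cr := differentiable_continuous dr; have ci := differentiable_continuous di.
move/cvgrPdist_le: cr => /(_ _ e2) nr; move/cvgrPdist_le: ci => /(_ _ e2) ni.
near=> y.
apply: (le_trans (cmod_le_ReIm _)); rewrite ReD ImD ReN ImN [leRHS]splitr.
apply: lerD; rewrite distrC; near: y; [exact: nr|exact: ni].
Unshelve. all: by end_near. Qed.

Lemma near_box (x : R * R) (P : R * R -> Prop) : (\forall y \near x, P y) ->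
  exists2 d : R, 0 < d & forall s q, `|s - x.1| <= d -> `|q - x.2| <= d -> P (s, q).
Proof.
move=> /nbhs_ballP[d /= d0 H]; exists (d / 2); first by rewrite divr_gt0.
have dd : d / 2 < d by rewrite ltr_pdivrMr// ltr_pMr// ltr1n.
move=> s q hs hq; apply: H; split => /=; rewrite /ball /= distrC.
  exact: le_lt_trans hs dd.
exact: le_lt_trans hq dd.
Qed.

(** Both mixed derivatives are limits of the same second difference; the mean
    value inequality bounds the error. *)
Lemma mixed_derivatives (g gs gq a b : R -> R -> R[i]) (s0 q0 : R) :
  (forall s q, cder (g^~ q) s (gs s q)) ->
  (forall s q, cder (g s) q (gq s q)) ->
  (forall s q, cder (gs s) q (a s q)) ->
  (forall s q, cder (gq^~ q) s (b s q)) ->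
  (forall e, 0 < e -> exists2 d : R, 0 < d & forall s q, `|s - s0| <= d ->
     `|q - q0| <= d -> cmod (a s q - a s0 q0) <= e) ->
  (forall e, 0 < e -> exists2 d : R, 0 < d & forall s q, `|s - s0| <= d ->
     `|q - q0| <= d -> cmod (b s q - b s0 q0) <= e) ->
  a s0 q0 = b s0 q0.
Proof.
move=> dgs dgq da db ca cb.
have half (u us c : R -> R -> R[i]) (x y h e : R) : 0 <= h ->
    (forall s q, cder (u^~ q) s (us s q)) -> (forall s q, cder (us s) q (c s q)) ->
    (forall s q, x <= s <= x + h -> y <= q <= y + h -> cmod (c s q - c x y) <= e) ->
    cmod (u (x + h) (y + h) - u (x + h) y - u x (y + h) + u x y -
          c x y * h%:C * h%:C) <= 2 * (2 * e * h) * h.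
  move=> h0 du dus bc.
  have inner s : x <= s <= x + h ->
      cmod (us s (y + h) - us s y - c x y * h%:C) <= 2 * e * h.
    move=> sx; pose p q := us s q - c x y * (q - y)%:C.
    have dp q : y <= q <= y + h -> cder p q (c s q - c x y).
      move=> _; have dl : cder (fun q => (q - y)%:C) q 1.
        apply: (cder_ext (cderB (cder_id q) (cder_cst q y%:C))) => [r|].
          by rewrite rmorphB.
        by rewrite subr0.
      apply: (cder_ext (cderB (dus s q) (cderZ (c x y) dl))) => //.
      by rewrite mulr1.
    have yh : y <= y + h by rewrite lerDl.
    have := cder_mean_value yh dp (fun q => bc s q sx).
    by rewrite /p subrr mulr0 subr0 (addrC y h) addrK addrAC.
  pose p s := u s (y + h) - u s y - c x y * h%:C * (s - x)%:C.
  have dp s : x <= s <= x + h -> cder p s (us s (y + h) - us s y - c x y * h%:C).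
    move=> _; have dl : cder (fun q => (q - x)%:C) s 1.
      apply: (cder_ext (cderB (cder_id s) (cder_cst s x%:C))) => [r|].
        by rewrite rmorphB.
      by rewrite subr0.
    apply: (cder_ext (cderB (cderB (du s (y + h)) (du s y))
      (cderZ (c x y * h%:C) dl))) => //.
    by rewrite mulr1.
  have xh : x <= x + h by rewrite lerDl.
  have := cder_mean_value xh dp inner.
  rewrite /p subrr mulr0 subr0 (addrC x h) addrK.
  by congr (cmod _ <= _); rewrite (addrC h x); ring.
apply/eqP; rewrite -subr_eq0 -cmod_eq0 eq_le cmod_ge0 andbT.
apply/ler_addgt0Pr => e e0; rewrite add0r.
have e8 : 0 < e / 8 by rewrite divr_gt0.
have [d d0 Ha] := ca _ e8; have [d' d'0 Hb] := cb _ e8.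
pose h := Num.min d d'.
have h0 : 0 < h by rewrite lt_min d0.
have hd : h <= d by rewrite ge_min lexx.
have hd' : h <= d' by rewrite ge_min lexx orbT.
have close (z x : R) : x <= z <= x + h -> `|z - x| <= h.
  by move=> /andP[z1 z2]; rewrite ger0_norm ?subr_ge0// lerBlDl.
have B1 := half g gs a s0 q0 h (e / 8) (ltW h0) dgs da
  (fun s q hs hq => Ha _ _ (le_trans (close _ _ hs) hd) (le_trans (close _ _ hq) hd)).
have B2 := half (fun q s => g s q) (fun q s => gq s q) (fun q s => b s q) q0 s0 h
  (e / 8) (ltW h0) (fun q s => dgq s q) (fun q s => db s q)
  (fun q s hq hs => Hb _ _ (le_trans (close _ _ hs) hd') (le_trans (close _ _ hq) hd')).
have hh : 0 < h * h by rewrite mulr_gt0.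
rewrite -(ler_pM2r hh).
have -> : cmod (a s0 q0 - b s0 q0) * (h * h) =
    cmod (a s0 q0 * h%:C * h%:C - b s0 q0 * h%:C * h%:C).
  by rewrite -!mulrBl !cmodM cmodR (gtr0_norm h0) mulrA.
apply: (le_trans (cmod_triangle _
  (g (s0 + h) (q0 + h) - g (s0 + h) q0 - g s0 (q0 + h) + g s0 q0) _)).
have -> : e * (h * h) = 2 * (2 * (e / 8) * h) * h + 2 * (2 * (e / 8) * h) * h.
  by field.
rewrite cmodBC; apply: lerD => //.
apply: le_trans B2; rewrite le_eqVlt; apply/orP; left; apply/eqP.
by congr cmod; ring.
Qed.

End PlaneCalculus.

Section SmoothPlane.
Context {R : realType}.
Implicit Types (f : R * R -> R[i]).

Lemma smooth_iter U f s : smooth_on U f -> smooth_on U (iter_cderive s f).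
Proof.
move=> sf r x Ux.
have -> : iter_cderive r (iter_cderive s f) = iter_cderive (r ++ s) f.
  by rewrite /iter_cderive foldr_cat.
exact: sf.
Qed.

Lemma smooth_cderive U f v : smooth_on U f -> smooth_on U (cderive v f).
Proof. exact: (@smooth_iter U f [:: v]). Qed.

Lemma smooth_diff U f x : smooth_on U f -> U x ->
  differentiable (fun y => complex.Re (f y)) x /\
  differentiable (fun y => complex.Im (f y)) x.
Proof. by move=> sf; exact: (sf [::]). Qed.

Lemma smooth_cder1 U f s q : smooth_on U f -> U (s, q) ->
  cder (fun t => f (t, q)) s (cderive (mu R) f (s, q)).
Proof. by move=> sf /(smooth_diff sf)[dr di]; exact: cder_slice1. Qed.

Lemma smooth_cder2 U f s q : smooth_on U f -> U (s, q) ->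
  cder (fun t => f (s, t)) q (cderive (lam R) f (s, q)).
Proof. by move=> sf /(smooth_diff sf)[dr di]; exact: cder_slice2. Qed.

Lemma smooth_near U f x e : smooth_on U f -> U x -> 0 < e ->
  \forall y \near x, cmod (f y - f x) <= e.
Proof. by move=> sf /(smooth_diff sf)[dr di] e0; exact: near_cmod. Qed.

Lemma smooth_bounded U f (B : set (R * R)) : smooth_on U f -> compact B ->
  B `<=` U -> exists C : R, forall x, B x -> cmod (f x) <= C.
Proof.
move=> sf cB BU; apply: (compact_uniform (P := fun x C => cmod (f x) <= C)) => // x Bx.
exists (cmod (f x) + 1).
have := smooth_near sf (BU _ Bx) ltr01; apply: filterS => y h C hC.
apply: le_trans hC; rewrite addrC -lerBlDr; apply: le_trans h.
by rewrite lerBlDr -[X in cmod X <= _](subrK (f x)) cmodD.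
Qed.

Lemma smooth_mixed f x : smooth_on setT f ->
  cderive (lam R) (cderive (mu R) f) x = cderive (mu R) (cderive (lam R) f) x.
Proof.
move=> sf; case: x => s0 q0.
have cont (h : R * R -> R[i]) : smooth_on setT h -> forall e : R, 0 < e ->
    exists2 d : R, 0 < d & forall s q, `|s - s0| <= d ->
     `|q - q0| <= d -> cmod (h (s, q) - h (s0, q0)) <= e.
  move=> sh e e0.
  exact: near_box (smooth_near (x := (s0, q0)) sh I e0).
apply: (@mixed_derivatives R (fun s q => f (s, q))
  (fun s q => cderive (mu R) f (s, q)) (fun s q => cderive (lam R) f (s, q))
  (fun s q => cderive (lam R) (cderive (mu R) f) (s, q))
  (fun s q => cderive (mu R) (cderive (lam R) f) (s, q)) s0 q0).
- by move=> s q; apply: (smooth_cder1 (U := setT)).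
- by move=> s q; apply: (smooth_cder2 (U := setT)).
- by move=> s q; apply: (smooth_cder2 (U := setT)) => //; exact: smooth_cderive.
- by move=> s q; apply: (smooth_cder1 (U := setT)) => //; exact: smooth_cderive.
- by apply: cont; do 2 apply: smooth_cderive.
- by apply: cont; do 2 apply: smooth_cderive.
Qed.

End SmoothPlane.

(** * The Cauchy-Riemann equation *)

Section FlatSection.
Context {R : realType}.
Variable j : {linear (R * R)%type -> (R * R)%type}.
Hypothesis hj : compatible_structure j.
Variable tau : R[i].
Hypothesis htau : lam R = complex.Re tau *: mu R + complex.Im tau *: j (mu R).

Lemma Im_tau_gt0 : 0 < complex.Im tau.
Proof.
have pi0 := pi_gt0 R.
have mu0 : mu R != 0.
  by apply/eqP => /(congr1 fst) /eqP; rewrite /= oner_eq0.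
have := hj.2 _ mu0; rewrite /omega /inter.
have -> : (mu R).1 = 1 by [].
have -> : (mu R).2 = 0 by [].
rewrite mul1r mul0r subr0 => h.
have : (lam R).2 = complex.Im tau * (j (mu R)).2.
  by rewrite htau /= /GRing.scale /= mulr0 add0r.
have -> : (lam R).2 = 1 by [].
have {}h : 0 < (j (mu R)).2 by rewrite pmulr_rgt0 ?mulr_gt0// in h.
move=> e; have : 0 < complex.Im tau * (j (mu R)).2 by rewrite -e.
by rewrite pmulr_lgt0.
Qed.

Lemma tau_neq0 : tau != 0.
Proof.
apply/negP => /eqP t0; have := Im_tau_gt0.
by rewrite t0 /= ltxx.
Qed.

Lemma jmuE : j (mu R) = (complex.Im tau)^-1 *: (lam R - complex.Re tau *: mu R).
Proof.
rewrite htau addrAC subrr add0r scalerA mulVf ?scale1r// gt_eqF//.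
exact: Im_tau_gt0.
Qed.

Lemma derive_scale (F : R * R -> R) x (a : R) u : differentiable F x ->
  'D_(a *: u) F x = a * 'D_u F x.
Proof. by move=> dF; rewrite (deriveE _ dF) (deriveE _ dF) linearZ. Qed.

Lemma derive_sub (F : R * R -> R) x u v : differentiable F x ->
  'D_(u - v) F x = 'D_u F x - 'D_v F x.
Proof.
by move=> dF; rewrite (deriveE _ dF) (deriveE _ dF) (deriveE _ dF) linearB.
Qed.

Lemma cderiveZ (f : R * R -> R[i]) x (a : R) u :
  differentiable (fun y => complex.Re (f y)) x ->
  differentiable (fun y => complex.Im (f y)) x ->
  cderive (a *: u) f x = a%:C * cderive u f x.
Proof.
move=> dr di; rewrite /cderive (derive_scale _ _ dr) (derive_scale _ _ di).
apply: eqCP; first by rewrite ReM Re_real Im_real mul0r subr0.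
by rewrite ImM Re_real Im_real mul0r addr0.
Qed.

Lemma cderiveB (f : R * R -> R[i]) x u v :
  differentiable (fun y => complex.Re (f y)) x ->
  differentiable (fun y => complex.Im (f y)) x ->
  cderive (u - v) f x = cderive u f x - cderive v f x.
Proof.
by move=> dr di; rewrite /cderive (derive_sub _ _ dr) (derive_sub _ _ di).
Qed.

(** The imaginary unit is a variable here, because its literal is not treated
    as an atom by the ring tactics. *)
Lemma cauchy_riemann_algebra (I a b al be k y s q p : R[i]) :
  I * I = -1 -> be != 0 ->
  a + I * (be^-1 * (b - al * a)) +
    k / I * (- (p * q) + I * (be^-1 * (p * (s + al * q)))) * y = 0 ->
  b - (al + I * be) * a = k * (I * p * (s + (al + I * be) * q)) * y.
Proof.
move=> I2 bC E.
have I0 : I != 0.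
  by apply: contraTneq (oner_neq0 R[i]) => I0; rewrite -oppr_eq0 -I2 I0 mul0r eqxx.
have iV : I^-1 = - I by apply: (mulfI I0); rewrite mulfV// mulrN I2 opprK.
apply/eqP; rewrite -subr_eq0; apply/eqP.
rewrite -[RHS](mulr0 (- I * be)) -{}E iV.
have II : I ^+ 2 = -1 by rewrite expr2.
have I3 : I ^+ 3 = - I by rewrite exprS II mulrN1.
transitivity (- I * be * a - I ^+ 2 * (b - al * a) +
     k * I ^+ 2 * be * (- (p * q)) * y +
     k * I ^+ 3 * (p * (s + al * q)) * y).
  rewrite [RHS](_ : _ = b - (al + I * be) * a -
    k * (I * p * (s + (al + I * be) * q)) * y +
    (I ^+ 2 + 1) * (k * p * be * q * y)).
    by rewrite II addNr mul0r addr0.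
  by rewrite I3 [X in - (X * (b - _))]II [X in k * X * be]II; ring.
by field.
Qed.

(** The anti-holomorphic vector mu + i j mu is proportional to lam - tau mu;
    with x = s mu + q lam, holomorphy thus becomes the single equation
    (d_q - tau d_s) f = 2 pi i k (s + tau q) f. *)
Lemma holo_pde k U f x : holo_on j k U f -> U x ->
  cderive (lam R) f x - tau * cderive (mu R) f x =
  k%:R * ('i * (2 * pi%:C) * (x.1%:C + tau * x.2%:C)) * f x.
Proof.
move=> [sf pde] Ux; have [dr di] := smooth_diff sf Ux.
have b0 := Im_tau_gt0.
have bC : (complex.Im tau)%:C != 0 :> R[i].
  by rewrite -cmod_eq0 cmodR normr_eq0 gt_eqF.
have := pde x (mu R) Ux.
rewrite jmuE (cderiveZ _ _ dr di) (cderiveB _ _ dr di) (cderiveZ _ _ dr di).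
have -> : alphaL x (mu R) = - (2 * pi * x.2).
  rewrite /alphaL /omega /inter.
  have -> : (mu R).1 = 1 by [].
  have -> : (mu R).2 = 0 by [].
  by field.
have -> : alphaL x ((complex.Im tau)^-1 *: (lam R - complex.Re tau *: mu R)) =
    (complex.Im tau)^-1 * (2 * pi * (x.1 + complex.Re tau * x.2)).
  rewrite /alphaL /omega /inter.
  have -> : ((complex.Im tau)^-1 *: (lam R - complex.Re tau *: mu R)).1 =
     (complex.Im tau)^-1 * (0 - complex.Re tau * 1) by [].
  have -> : ((complex.Im tau)^-1 *: (lam R - complex.Re tau *: mu R)).2 =
     (complex.Im tau)^-1 * (1 - complex.Re tau * 0) by [].
  by field; rewrite gt_eqF.
move=> E; rewrite [in LHS](complexE tau) [in RHS](complexE tau).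
apply: (cauchy_riemann_algebra iiN1 bC); rewrite -[RHS]E.
move: (pi : R) => p.
by rewrite !(rmorph_nat (real_complex R), rmorphN (real_complex R),
  rmorphM (real_complex R), rmorphD (real_complex R), fmorphV (real_complex R)).
Qed.

End FlatSection.

(** * The flat section near its line *)

Section FlatSectionExpansion.
Context {R : realType}.
Variable j : {linear (R * R)%type -> (R * R)%type}.
Hypothesis hj : compatible_structure j.
Variable tau : R[i].
Hypothesis htau : lam R = complex.Re tau *: mu R + complex.Im tau *: j (mu R).
Variable t : R * R -> R[i].
Hypothesis holo_t : holo_on j 1 setT t.
Hypothesis t_lam1 : forall q : R, t (q *: lam R) = 1.

Definition twopii : R[i] := 'i * (2 * pi%:C).
Local Notation A := twopii.

(** The coefficient of the Gaussian decay transversally to the line. *)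
Definition decay : R[i] := A / tau.

Lemma Re_twopii : complex.Re A = 0.
Proof. by rewrite /twopii ReM Re_i Im_i mul0r ImM Re_nat Im_nat Re_real Im_real mulr0 mul0r addr0 mulr0 subr0. Qed.

Lemma Im_twopii : complex.Im A = 2 * pi.
Proof. by rewrite /twopii ImM Re_i Im_i mul0r add0r mul1r ReM Re_nat Im_nat Re_real Im_real mulr0 subr0. Qed.

Lemma Re_decay_gt0 : 0 < complex.Re decay.
Proof.
have pi0 := pi_gt0 R.
have b0 := Im_tau_gt0 hj htau.
have t0 := tau_neq0 hj htau.
have n0 : 0 < cmod tau ^+ 2 by rewrite exprn_gt0// cmod_gt0.
have -> : decay = A * conjc tau * (cmod tau ^+ 2)^-1%:C.
  have cc : (cmod tau ^+ 2)%:C = tau * conjc tau.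
    by rewrite rmorphXn /= -normE sqr_normc.
  rewrite fmorphV /= cc /decay -mulrA; congr (_ * _).
  by rewrite invfM mulrCA mulfV ?mulr1// conjc_eq0.
rewrite Re_mulr ReM Re_twopii Im_twopii mul0r sub0r Im_conj mulrN opprK.
by rewrite !mulr_gt0// invr_gt0.
Qed.

(** The holomorphic section equal to 1 on the line, in closed form. Contact to
    finite order with it suffices, which avoids analytic continuation. *)
Definition flat_model (s q : R) : R[i] :=
  cexp (- (A * s%:C * q%:C) - decay * s%:C ^+ 2).

Let T m : R * R -> R[i] := iter_cderive (nseq m (lam R)) t.
Let E m (s q : R) : R[i] := (- A * s%:C) ^+ m * flat_model s q.

Let smooth_T m : smooth_on setT (T m).
Proof. by apply: smooth_iter; case: holo_t. Qed.

(** The Cauchy-Riemann equation is differentiated m times along the line; this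
    uses the symmetry of second derivatives. *)
Lemma T_rec m s q : tau * cderive (mu R) (T m) (s, q) =
  T m.+1 (s, q) - A * (s%:C + tau * q%:C) * T m (s, q) -
  A * tau * m%:R * T m.-1 (s, q).
Proof.
elim: m q => [|m IH] q.
  have := holo_pde hj htau holo_t (x := (s, q)) Logic.I.
  rewrite mul1r /= mulr0 mul0r subr0 => h.
  rewrite -[A * _ * _]h; rewrite /T /=; ring.
have dl : cder (fun q => tau * cderive (mu R) (T m) (s, q)) q
    (tau * cderive (lam R) (cderive (mu R) (T m)) (s, q)).
  by apply: cderZ; apply: (smooth_cder2 (U := setT)) => //; exact: smooth_cderive.
have dT n : cder (fun q => T n (s, q)) q (T n.+1 (s, q)).
  exact: (smooth_cder2 (U := setT)).
have dlin : cder (fun q => A * (s%:C + tau * q%:C)) q (A * tau).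
  apply: (cder_ext (cderZ A (cderD (cder_cst q s%:C) (cderZ tau (cder_id q))))) => //.
  by rewrite mulr1 add0r.
have dr := cderB (cderB (dT m.+1) (cderM dlin (dT m)))
  (cderZ (A * tau * m%:R) (dT m.-1)).
have {}dr := cder_ext dr (fun q => esym (IH q)) erefl.
rewrite -(smooth_mixed _ (smooth_T m)) (cder_unique dl dr).
have -> : A * tau * m%:R * T m.-1.+1 (s, q) = A * tau * m%:R * T m (s, q).
  by case: (m) => [|n] //; rewrite mulr0 !mul0r.
by rewrite -[m.+1%:R]natr1 /=; ring.
Qed.

Lemma T_line m q : T m (0, q) = (m == 0%N)%:R.
Proof.
elim: m q => [|m IH] q.
  have e : q *: lam R = (q * 0, q * 1) by [].
  by have := t_lam1 q; rewrite e mulr0 mulr1.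
have d1 : cder (fun q => T m (0, q)) q (T m.+1 (0, q)).
  exact: (smooth_cder2 (U := setT)).
have d2 := cder_ext (cder_cst q (m == 0%N)%:R) (fun q => esym (IH q)) erefl.
by rewrite (cder_unique d1 d2).
Qed.

(** The model satisfies the same recursion as the flat section, with its
    derivatives along the line replaced by multiplication by - 2 pi i s. *)
Lemma cder_E m s q : cder (fun s => E m s q) s (tau^-1 *
  (E m.+1 s q - A * (s%:C + tau * q%:C) * E m s q - A * tau * m%:R * E m.-1 s q)).
Proof.
have t0 := tau_neq0 hj htau.
have d1 : cder (fun s => - A * s%:C) s (- A).
  by apply: (cder_ext (cderZ (- A) (cder_id s))) => //; rewrite mulr1.
have d2 : cder (fun s => - (A * s%:C * q%:C) - decay * s%:C ^+ 2) s
    (- (A * q%:C) - decay * (2 * s%:C)).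
  apply: (cder_ext (cderB (cderN (cderM (cderZ A (cder_id s)) (cder_cst s q%:C)))
    (cderZ decay (cder_pow s 2)))) => //.
  by rewrite expr1; ring.
apply: (cder_ext (cderM (cderX m d1) (cder_cexp d2))) => //.
rewrite /E -/(flat_model s q) /decay.
case: m => [|m] /=; first by rewrite !expr0 expr1; field.
by rewrite !exprS; field.
Qed.

Let w m s q := T m (s, q) - E m s q.

Lemma cder_w m s q : cder (fun s => w m s q) s (tau^-1 *
  (w m.+1 s q - A * (s%:C + tau * q%:C) * w m s q - A * tau * m%:R * w m.-1 s q)).
Proof.
have t0 := tau_neq0 hj htau.
have dT : cder (fun s => T m (s, q)) s (cderive (mu R) (T m) (s, q)).
  exact: (smooth_cder1 (U := setT)).
apply: (cder_ext (cderB dT (cder_E m s q))) => //.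
rewrite -[cderive _ _ _](mulKf t0) T_rec /w; ring.
Qed.

Lemma w_line m q : w m 0 q = 0.
Proof.
rewrite /w T_line /E /flat_model !mulr0 mul0r !expr0n /= mulr0 subr0 oppr0 cexp0.
by rewrite mulr1 subrr.
Qed.

Lemma cmod_flat_model s q :
  cmod (flat_model s q) = expR (- (complex.Re decay * s ^+ 2)).
Proof.
rewrite /flat_model cmod_cexp; congr expR.
rewrite ReD ReN (ReN (decay * _)) -(rmorphXn (real_complex R)).
by rewrite !Re_mulr Re_twopii !mul0r oppr0 add0r.
Qed.

Variable Q : R.
Hypothesis Q0 : 0 <= Q.

Lemma w_bounded m : exists2 C : R, 0 <= C & forall s q, `|s| <= 1 -> `|q| <= Q ->
  cmod (w m s q) <= C.
Proof.
have cB : compact (`[-1, 1]%classic `*` `[-Q, Q]%classic : set (R * R)).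
  by apply: compact_setX; exact: segment_compact.
have [C HC] := smooth_bounded (smooth_T m) cB (@subsetT _ _).
exists (`|C| + cmod A ^+ m); first by rewrite addr_ge0// exprn_ge0// cmod_ge0.
move=> s q s1 q1; apply: (le_trans (cmodB _ _)); apply: lerD.
  apply: (le_trans (HC (s, q) _)); last exact: ler_norm.
  by split => /=; rewrite in_itv /= -ler_norml.
rewrite /E cmodM cmodX cmodM cmodN cmodR cmod_flat_model.
rewrite -[leRHS]mulr1 ler_pM ?expR_ge0 ?exprn_ge0 ?mulr_ge0 ?cmod_ge0//.
  by rewrite lerXn2r ?nnegrE ?mulr_ge0 ?cmod_ge0// ler_piMr// cmod_ge0.
by apply: expN_le1; rewrite mulr_ge0 ?sqr_ge0// ltW// Re_decay_gt0.
Qed.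

(** The recursion expresses the transverse derivative of each difference by
    differences, which vanish on the line; integrating gains one order at each
    step, at the price of using more derivatives along the line. *)
Lemma w_vanish n m : exists2 C : R, 0 <= C & forall s q, `|s| <= 1 -> `|q| <= Q ->
  cmod (w m s q) <= C * `|s| ^+ n.
Proof.
elim: n m => [|n IH] m.
  have [C C0 HC] := w_bounded m; exists C => // s q s1 q1.
  by rewrite expr0 mulr1; exact: HC.
have [C1 C10 H1] := IH m.+1; have [C2 C20 H2] := IH m; have [C3 C30 H3] := IH m.-1.
pose K := cmod tau^-1 * (C1 + cmod A * (1 + cmod tau * Q) * C2 +
  cmod A * cmod tau * m%:R * C3).
have K0 : 0 <= K.
  have h1 : 0 <= cmod A * (1 + cmod tau * Q) * C2.
    by rewrite mulr_ge0// mulr_ge0 ?cmod_ge0// addr_ge0// mulr_ge0// cmod_ge0.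
  have h2 : 0 <= cmod A * cmod tau * m%:R * C3.
    by rewrite mulr_ge0// mulr_ge0// mulr_ge0// cmod_ge0.
  by rewrite mulr_ge0 ?cmod_ge0// !addr_ge0.
exists (2 * K); first by rewrite mulr_ge0.
move=> s q s1 q1.
apply: (cder_vanish (f := fun s => w m s q) (del := 1) K0 (fun r _ => cder_w m r q)
  (w_line m q)) => // r r1.
rewrite cmodM /K -[leRHS]mulrA; apply: ler_wpM2l; first exact: cmod_ge0.
rewrite [leRHS]mulrDl [X in _ <= X + _]mulrDl; apply: (le_trans (cmodB _ _)); apply: lerD.
  apply: (le_trans (cmodB _ _)); apply: lerD; first exact: H1.
  rewrite cmodM (cmodM A) -[leRHS]mulrA.
  apply: ler_pM; [by rewrite -cmodM cmod_ge0|exact: cmod_ge0| |exact: H2].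
  apply: ler_wpM2l; first exact: cmod_ge0.
  apply: (le_trans (cmodD _ _)).
  by rewrite cmodM !cmodR; apply: lerD => //; rewrite ler_wpM2l ?cmod_ge0.
rewrite cmodM (cmodM (A * tau)) (cmodM A) cmod_nat -[leRHS]mulrA.
apply: ler_wpM2l; last exact: H3.
by rewrite -cmodM mulr_ge0// cmod_ge0.
Qed.

Lemma flat_section_expansion n : exists2 C : R, 0 <= C &
  forall s q, `|s| <= 1 -> `|q| <= Q ->
  cmod (t (s, q) - flat_model s q) <= C * `|s| ^+ n.
Proof.
have [C C0 HC] := w_vanish n 0; exists C => // s q s1 q1.
by have := HC s q s1 q1; rewrite /w /E expr0 mul1r.
Qed.

Lemma cmod_pow_sub (x y : R[i]) (M : R) k : cmod x <= M -> cmod y <= M ->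
  cmod (x ^+ k - y ^+ k) <= k%:R * M ^+ k.-1 * cmod (x - y).
Proof.
move=> xM yM; have M0 : 0 <= M := le_trans (cmod_ge0 _) xM.
elim: k => [|k IH]; first by rewrite !expr0 subrr cmod0 !mul0r.
have -> : x ^+ k.+1 - y ^+ k.+1 = x * (x ^+ k - y ^+ k) + (x - y) * y ^+ k.
  by rewrite !exprS; ring.
apply: (le_trans (cmodD _ _)); rewrite !cmodM cmodX /=.
have h1 : cmod x * cmod (x ^+ k - y ^+ k) <= k%:R * M ^+ k * cmod (x - y).
  apply: (le_trans (ler_pM (cmod_ge0 _) (cmod_ge0 _) xM IH)).
  case: (k) => [|n]; first by rewrite !mul0r mulr0.
  by rewrite [M ^+ n.+1]exprS /= le_eqVlt; apply/orP; left; apply/eqP; ring.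
have h2 : cmod (x - y) * cmod y ^+ k <= cmod (x - y) * M ^+ k.
  by rewrite ler_wpM2l ?cmod_ge0// lerXn2r ?nnegrE ?cmod_ge0.
apply: (le_trans (lerD h1 h2)).
by rewrite -[k.+1%:R]natr1 le_eqVlt; apply/orP; left; apply/eqP; ring.
Qed.

(** The fourth-order contact makes the error of the k-th power O(1/k),
    uniformly against a Gaussian of width k^(-1/2). *)
Lemma flat_section_power : exists del D : R, [/\ 0 < del, del <= 2^-1, 0 <= D &
  forall (k : nat) s q, (0 < k)%N -> `|s| <= del -> `|q| <= Q ->
  cmod (t (s, q) ^+ k - flat_model s q ^+ k) <=
    D / k%:R * expR (- (complex.Re decay / 4 * k%:R * s ^+ 2)) /\
  cmod (t (s, q) ^+ k) <= expR (- (complex.Re decay / 2 * k%:R * s ^+ 2))].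
Proof.
have [C C0 HC] := flat_section_expansion 4.
have r0 := Re_decay_gt0; set r := complex.Re decay in r0 *.
pose C' := C * expR r + 1.
have C'0 : 0 < C' by rewrite ltr_wpDl// mulr_ge0// expR_ge0.
pose del := Num.min 2^-1 (Num.min (r / (2 * C')) 1).
have rC0 : 0 < r / (2 * C') by rewrite divr_gt0// mulr_gt0.
have del0 : 0 < del by rewrite !lt_min rC0 ltr01 invr_gt0 ltr0n.
exists del, (C * expR (r / 2) * (64 / r ^+ 2)); split => //.
- by rewrite ge_min lexx.
- apply: mulr_ge0; first by rewrite mulr_ge0// expR_ge0.
  by rewrite divr_ge0// sqr_ge0.
move=> k s q k0 sd qQ.
have s2 : `|s| <= 2^-1 by apply: (le_trans sd); rewrite ge_min lexx.
have s1 : `|s| <= 1 by lra.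
have sC : `|s| <= r / (2 * C').
  by apply: (le_trans sd); rewrite ge_min ge_min lexx orbT.
have n0 := normr_ge0 s.
have ss : s ^+ 2 = `|s| ^+ 2 by rewrite real_normK ?num_real.
have h := HC s q s1 qQ.
have em : cmod (flat_model s q) = expR (- (r * s ^+ 2)) by exact: cmod_flat_model.
have x1 : `|s| ^+ 2 <= 1 by rewrite expr_le1.
have tb : cmod (t (s, q)) <= expR (- (r / 2 * s ^+ 2)).
  have h1 : cmod (t (s, q)) <= expR (- (r * s ^+ 2)) + C * `|s| ^+ 4.
    rewrite -[t (s, q)](subrK (flat_model s q)) addrC.
    by apply: (le_trans (cmodD _ _)); rewrite em; apply: lerD.
  have h2 : C * `|s| ^+ 4 <= expR (- (r * s ^+ 2)) * (C' * `|s| ^+ 4).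
    rewrite mulrA ler_wpM2r ?exprn_ge0//.
    have e1 : expR (- r) <= expR (- (r * s ^+ 2)).
      by rewrite ler_expR lerN2 ss -[leRHS]mulr1 ler_pM2l.
    have e2 : expR (- r) * expR r = 1 by rewrite -expRD addNr expR0.
    have e3 := expR_gt0 (- r).
    apply: (@le_trans _ _ (expR (- r) * C')); last by rewrite ler_wpM2r// ltW.
    by rewrite /C' mulrDr mulr1 mulrCA e2 mulr1 lerDl ltW.
  have h3 : 1 + C' * `|s| ^+ 4 <= expR (r / 2 * s ^+ 2).
    apply: le_trans (expR_ge1Dx _); rewrite lerD2l ss.
    have e1 : C' * `|s| <= r / 2.
      have -> : r / 2 = C' * (r / (2 * C')) by field; rewrite gt_eqF.
      by rewrite ler_pM2l.
    have -> : C' * `|s| ^+ 4 = (C' * `|s|) * `|s| * `|s| ^+ 2 by ring.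
    rewrite ler_wpM2r ?sqr_ge0//; apply: le_trans e1.
    by rewrite ler_piMr// mulr_ge0// ltW.
  apply: (le_trans h1); apply: (le_trans (lerD (lexx _) h2)).
  rewrite -[X in X + _]mulr1 -mulrDr.
  have -> : expR (- (r / 2 * s ^+ 2)) =
      expR (- (r * s ^+ 2)) * expR (r / 2 * s ^+ 2).
    by rewrite -expRD; congr expR; field.
  by rewrite ler_pM2l ?expR_gt0.
have eb : cmod (flat_model s q) <= expR (- (r / 2 * s ^+ 2)).
  by rewrite em ler_expR lerN2 ler_wpM2r ?sqr_ge0//; lra.
split; last first.
  rewrite cmodX; apply: (@le_trans _ _ (expR (- (r / 2 * s ^+ 2)) ^+ k)).
    by rewrite lerXn2r ?nnegrE ?cmod_ge0 ?expR_ge0.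
  by rewrite -expRM_natl le_eqVlt; apply/orP; left; apply/eqP; congr expR; ring.
have kR0 : 0 < k%:R :> R by rewrite ltr0n.
apply: (le_trans (cmod_pow_sub k tb eb)).
apply: (le_trans (ler_wpM2l _ h)).
  by rewrite mulr_ge0// exprn_ge0// expR_ge0.
have pw : expR (- (r / 2 * s ^+ 2)) ^+ k.-1 <=
    expR (r / 2) * expR (- (r / 2 * k%:R * s ^+ 2)).
  have kE : k%:R = k.-1%:R + 1 :> R by rewrite natr1 prednK.
  rewrite -expRM_natl -expRD ler_expR kE.
  have : r / 2 * s ^+ 2 <= r / 2 by rewrite ss ler_piMr// divr_ge0// ltW.
  lra.
have y0 : 0 <= r / 2 * k%:R * s ^+ 2.
  by rewrite mulr_ge0 ?sqr_ge0// mulr_ge0 ?(ltW kR0)// divr_ge0// ltW.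
have := y2_exp_le y0; set y := r / 2 * k%:R * s ^+ 2 in pw y0 *.
have -> : y / 2 = r / 4 * k%:R * s ^+ 2 by rewrite /y; field.
set g := expR (- (r / 4 * _ * _)) => yg.
have gg : expR (- y) = g * g.
  by rewrite /g -expRD; congr expR; rewrite /y; field.
have g0 : 0 < g := expR_gt0 _.
have s4 : `|s| ^+ 4 = s ^+ 4.
  by rewrite (exprM `|s| 2 2) real_normK ?num_real// -exprM.
rewrite s4.
apply: (@le_trans _ _ (k%:R * (expR (r / 2) * (g * g)) * (C * s ^+ 4))).
  apply: ler_wpM2r; first by rewrite mulr_ge0// exprn_even_ge0.
  by apply: ler_wpM2l; [exact: ltW|rewrite -gg].
have -> : k%:R * (expR (r / 2) * (g * g)) * (C * s ^+ 4) =
    C * expR (r / 2) * (4 / (r ^+ 2 * k%:R)) * g * (y ^+ 2 * g).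
  by rewrite /y; field; rewrite !gt_eqF.
have -> : C * expR (r / 2) * (64 / r ^+ 2) / k%:R * g =
    C * expR (r / 2) * (4 / (r ^+ 2 * k%:R)) * g * 16.
  by field; rewrite !gt_eqF.
have c0 : 0 <= C * expR (r / 2) * (4 / (r ^+ 2 * k%:R)).
  apply: mulr_ge0; first by rewrite mulr_ge0// expR_ge0.
  by apply: divr_ge0 => //; apply: mulr_ge0; [exact: sqr_ge0|exact: ltW].
by apply: ler_wpM2l => //; apply: mulr_ge0 => //; exact: ltW.
Qed.

End FlatSectionExpansion.

(** * Integration over the fundamental domain *)

Section PlaneIntegral.
Context {R : realType}.

(** The sigma-algebra of the plane is the product one, hence the need for a
    countable union of rational boxes. *)
Lemma open_measurable_plane (U : set (R * R)) : open U ->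
  measurable (U : set (measurableTypeR R * measurableTypeR R)).
Proof.
move=> oU.
pose box (p : rat * rat * (rat * rat)) : set (R * R) :=
  `]ratr p.1.1, ratr p.1.2[%classic `*` `]ratr p.2.1, ratr p.2.2[%classic.
pose F p := if `[< box p `<=` U >] then box p else set0.
have -> : U = \bigcup_p F p.
  apply/seteqP; split => [x Ux|x [p _]]; last first.
    by rewrite /F; case: asboolP => // bU; exact: bU.
  have : nbhs x U by exact: open_nbhs_nbhs.
  move=> /nbhs_ballP[d /= d0 dU].
  have lt1 (y : R) : y - d < y by rewrite ltrBlDr ltrDl.
  have lt2 (y : R) : y < y + d by rewrite ltrDl.
  have [a1] := rat_in_itvoo (lt1 x.1); have [b1] := rat_in_itvoo (lt2 x.1).
  have [a2] := rat_in_itvoo (lt1 x.2); have [b2] := rat_in_itvoo (lt2 x.2).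
  rewrite !in_itv /= => /andP[b21 b22] /andP[a21 a22] /andP[b11 b12] /andP[a11 a12].
  exists (a1, b1, (a2, b2)) => //.
  have bU : box (a1, b1, (a2, b2)) `<=` U.
    move=> y [/= y1 y2]; apply: dU; split; rewrite /ball /= ltr_norml;
      move: y1 y2; rewrite !in_itv /= => /andP[? ?] /andP[? ?]; lra.
  rewrite /F; case: asboolP => // _; split => /=; rewrite in_itv /=; lra.
apply: (@countable_bigcupT_measurable _ (measurableTypeR R * measurableTypeR R)%type).
  exact: countableP.
move=> p; rewrite /F; case: asboolP => // _.
by apply: measurableX; exact: measurable_itv.
Qed.

Lemma continuous_measurable_plane (f : R * R -> R) : continuous f ->
  measurable_fun (setT : set (measurableTypeR R * measurableTypeR R)) f.
Proof.
move=> /continuousP cf; apply: (measurability _ (RGenOpens.measurableE R)).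
move=> _ [_ [a [b ->] <-]]; rewrite setTI; apply: open_measurable_plane.
exact/cf/interval_open.
Qed.

Lemma measurable_unit_square :
  measurable (@unit_square R : set (measurableTypeR R * measurableTypeR R)).
Proof. by apply: measurableX; exact: measurable_itv. Qed.

Lemma continuous_integrable_plane (f : R * R -> R) : continuous f ->
  (@plane_measure R).-integrable (@unit_square R) (EFin \o f).
Proof.
move=> cf; apply: measurable_bounded_integrable.
- exact: measurable_unit_square.
- have mI : measurable (`[0, 1[%classic : set (measurableTypeR R)).
    exact: measurable_itv.
  rewrite [X in (X < _)%E](product_measure1E (@lebesgue_measure R)
    (@lebesgue_measure R) mI mI).
  have L1 : (@lebesgue_measure R) `[0, 1[%classic = 1%E.
    by rewrite lebesgue_measure_itv /= lte_fin ltr01 oppr0 adde0.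
  by rewrite [X in (X * _ < _)%E]L1 mul1e [X in (X < _)%E]L1 ltry.
- apply: measurable_funS (continuous_measurable_plane cf) => //.
have cB : compact (`[0, 1]%classic `*` `[0, 1]%classic : set (R * R)).
  by apply: compact_setX; exact: segment_compact.
have [C HC] : exists C : R, forall x, (`[0, 1]%classic `*` `[0, 1]%classic) x ->
    `|f x| <= C.
  apply: (compact_uniform (P := fun x C => `|f x| <= C)) => // x _.
  exists (`|f x| + 1).
  have /cvgrPdist_le /(_ _ ltr01) := cf x; apply: filterS => y h C hC.
  apply: le_trans hC; rewrite addrC -lerBlDr; apply: le_trans h.
  by rewrite distrC lerBlDr -[X in `|X| <= _](subrK (f x)) ler_normD.
exists C; split; first exact: num_real.
move=> M CM x [/= x1 x2]; apply: (le_trans (HC x _)); last exact: ltW.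
by split => /=; [move: x1|move: x2]; rewrite !in_itv /= => /andP[-> /ltW->].
Qed.

Definition square_integral (f : R * R -> R[i]) : R[i] :=
  Rintegral (@plane_measure R) (@unit_square R) (fun x => complex.Re (f x)) +i*
  Rintegral (@plane_measure R) (@unit_square R) (fun x => complex.Im (f x)).

Definition ccontinuous (f : R * R -> R[i]) :=
  continuous (fun x => complex.Re (f x)) /\ continuous (fun x => complex.Im (f x)).

Lemma ccontinuousM f g : ccontinuous f -> ccontinuous g ->
  ccontinuous (fun x => f x * g x).
Proof.
move=> [fr fi] [gr gi]; split.
  rewrite (_ : (fun x => _) = (fun x => complex.Re (f x) * complex.Re (g x) -
      complex.Im (f x) * complex.Im (g x))); last first.
    by apply/funext => x; rewrite ReM.
  by move=> x; apply: cvgB; apply: cvgM; [exact: fr|exact: gr|exact: fi|exact: gi].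
rewrite (_ : (fun x => _) = (fun x => complex.Re (f x) * complex.Im (g x) +
    complex.Im (f x) * complex.Re (g x))); last first.
  by apply/funext => x; rewrite ImM.
by move=> x; apply: cvgD; apply: cvgM; [exact: fr|exact: gi|exact: fi|exact: gr].
Qed.

Lemma ccontinuousD f g : ccontinuous f -> ccontinuous g ->
  ccontinuous (fun x => f x + g x).
Proof.
move=> [fr fi] [gr gi]; split.
  rewrite (_ : (fun x => _) = (fun x => complex.Re (f x) + complex.Re (g x))).
    by move=> x; apply: cvgD; [exact: fr|exact: gr].
  by apply/funext => x; rewrite ReD.
rewrite (_ : (fun x => _) = (fun x => complex.Im (f x) + complex.Im (g x))).
  by move=> x; apply: cvgD; [exact: fi|exact: gi].
by apply/funext => x; rewrite ImD.
Qed.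

Lemma ccontinuous_cst (c : R[i]) : ccontinuous (fun=> c).
Proof. by split => x; exact: cvg_cst. Qed.

Lemma ccontinuous_conj f : ccontinuous f -> ccontinuous (fun x => conjc (f x)).
Proof.
move=> [fr fi]; split.
  rewrite (_ : (fun x => _) = (fun x => complex.Re (f x))) //.
  by apply/funext => x; rewrite Re_conj.
rewrite (_ : (fun x => _) = (fun x => - complex.Im (f x))).
  by move=> x; apply: cvgN; exact: fi.
by apply/funext => x; rewrite Im_conj.
Qed.

Lemma ccontinuous_sum (I : Type) (r : seq I) (f : I -> R * R -> R[i]) :
  (forall i, ccontinuous (f i)) -> ccontinuous (fun x => \sum_(i <- r) f i x).
Proof.
move=> cf; elim: r => [|i r IH].
  rewrite (_ : (fun _ => _) = (fun=> 0)); first exact: ccontinuous_cst.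
  by apply/funext => x; rewrite big_nil.
rewrite (_ : (fun _ => _) = (fun x => f i x + \sum_(i <- r) f i x)).
  exact: ccontinuousD.
by apply/funext => x; rewrite big_cons.
Qed.

Lemma square_integralD f g : ccontinuous f -> ccontinuous g ->
  square_integral (fun x => f x + g x) = square_integral f + square_integral g.
Proof.
move=> [fr fi] [gr gi]; rewrite /square_integral.
under eq_Rintegral do rewrite ReD.
under [X in _ +i* X]eq_Rintegral do rewrite ImD.
by rewrite !RintegralD//; do ?[exact: measurable_unit_square|
  exact: continuous_integrable_plane].
Qed.

Lemma square_integralZ (c : R[i]) f : ccontinuous f ->
  square_integral (fun x => c * f x) = c * square_integral f.
Proof.
move=> [fr fi]; rewrite /square_integral.
have Zr (a : R) (h : R * R -> R) : continuous h -> continuous (fun x => a * h x).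
  by move=> ch x; apply: cvgM; [exact: cvg_cst|exact: ch].
under eq_Rintegral do rewrite ReM.
under [X in _ +i* X]eq_Rintegral do rewrite ImM.
rewrite RintegralB ?RintegralD ?RintegralZl//;
  do ?[exact: measurable_unit_square|exact: continuous_integrable_plane|
       exact/continuous_integrable_plane/Zr].
by apply: eqCP; rewrite ?ReM ?ImM.
Qed.

Lemma square_integral0 : square_integral (fun=> 0) = 0.
Proof.
rewrite -[RHS](mul0r (square_integral (fun=> 0))) -square_integralZ.
  by congr square_integral; apply/funext => x; rewrite mul0r.
exact: ccontinuous_cst.
Qed.

Lemma square_integral_sum (I : Type) (r : seq I) (f : I -> R * R -> R[i]) :
  (forall i, ccontinuous (f i)) ->
  square_integral (fun x => \sum_(i <- r) f i x) =
  \sum_(i <- r) square_integral (f i).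
Proof.
move=> cf; elim: r => [|i r IH].
  rewrite big_nil -[RHS]square_integral0; congr square_integral.
  by apply/funext => x; rewrite big_nil.
rewrite big_cons -IH -square_integralD//; last exact: ccontinuous_sum.
by congr square_integral; apply/funext => x; rewrite big_cons.
Qed.

End PlaneIntegral.

(** * Half-forms and translations *)

Section HalfForms.
Context {R : realType}.
Variable j : {linear (R * R)%type -> (R * R)%type}.
Hypothesis hj : compatible_structure j.
Variable delta : lmodType R[i].
Variable h : half_form j delta.
Variable tau : R[i].
Hypothesis htau : lam R = complex.Re tau *: mu R + complex.Im tau *: j (mu R).
Variables Om Ol : delta.
Hypothesis hOm : phi h Om Om (mu R) = 1.
Hypothesis hOl : phi h Ol Ol (lam R) = 1.

Lemma phi0l w x : phi h 0 w x = 0.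
Proof.
have := phi_linl h 1 0 0 w x; rewrite scaler0 addr0 mul1r => /eqP.
by rewrite eq_sym -subr_eq0 addrK => /eqP.
Qed.

Lemma phi0r w x : phi h w 0 x = 0.
Proof.
have := phi_linr h 1 0 0 w x; rewrite scaler0 addr0 mul1r => /eqP.
by rewrite eq_sym -subr_eq0 addrK => /eqP.
Qed.

Lemma phiZZ a u x : phi h (a *: u) (a *: u) x = a ^+ 2 * phi h u u x.
Proof.
have e v : a *: v = a *: v + 0 :> delta by rewrite addr0.
by rewrite {1}e phi_linl phi0l addr0 e phi_linr phi0r addr0 mulrA expr2.
Qed.

Lemma Om_neq0 : Om != 0.
Proof.
apply/eqP => O0; have := hOm; rewrite O0 phi0l => /eqP.
by rewrite eq_sym oner_eq0.
Qed.

Lemma Om_span v : exists a, v = a *: Om.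
Proof.
have [u u0 H] := delta_line h; have [a Ea] := H Om; have [b ->] := H v.
have a0 : a != 0.
  by apply: contra Om_neq0 => /eqP a0; rewrite Ea a0 scale0r.
by exists (b / a); rewrite Ea scalerA divfK.
Qed.

(** The sections become scalar functions in the basis [Om] of the half-form
    line. *)
Definition coord (v : delta) : R[i] := sval (cid (Om_span v)).

Lemma coordE v : v = coord v *: Om.
Proof. by rewrite /coord; case: cid. Qed.

Lemma coord_unique v a : v = a *: Om -> coord v = a.
Proof.
move=> va; apply/eqP; rewrite -subr_eq0.
have /eqP : (coord v - a) *: Om = 0 by rewrite scalerBl -coordE -va subrr.
by rewrite scaler_eq0 (negbTE Om_neq0) orbF.
Qed.

Lemma coordZ a v : coord (a *: v) = a * coord v.
Proof. by apply: coord_unique; rewrite -scalerA -coordE. Qed.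

Lemma coordD u v : coord (u + v) = coord u + coord v.
Proof. by apply: coord_unique; rewrite scalerDl -!coordE. Qed.

Lemma coord0 : coord 0 = 0.
Proof. by apply: coord_unique; rewrite scale0r. Qed.

Lemma coord_sum (I : Type) (r : seq I) (F : I -> delta) :
  coord (\sum_(i <- r) F i) = \sum_(i <- r) coord (F i).
Proof. by elim/big_rec2: _ => [|i x y _ <-]; rewrite ?coord0 ?coordD. Qed.

(** An element of K_j is complex linear, and lambda is tau times mu for the
    complex structure j. *)
Lemma Kj_lam (a : R * R -> R[i]) : is_Kj j a -> a (lam R) = tau * a (mu R).
Proof.
move=> [alin aj].
have a0 : a 0 = 0.
  have := alin 1 0 0; rewrite scaler0 addr0 mul1r => /eqP.
  by rewrite eq_sym -subr_eq0 addrK => /eqP.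
rewrite htau alin -[complex.Im tau *: _]addr0 alin a0 addr0 aj [in RHS](complexE tau).
by rewrite mulrDl [(complex.Im tau)%:C * _]mulrCA mulrA.
Qed.

Lemma phi_Om_lam : phi h Om Om (lam R) = tau.
Proof. by rewrite (Kj_lam (phi_Kj h Om Om)) hOm mulr1. Qed.

Lemma coord_Ol : coord Ol ^+ 2 * tau = 1.
Proof. by rewrite -phi_Om_lam -phiZZ -coordE. Qed.

Lemma herm_linr a u v w : herm h w (a *: u + v) = conjc a * herm h w u + herm h w v.
Proof.
rewrite herm_sym herm_lin rmorphD rmorphM /=.
by rewrite -(herm_sym h u w) -(herm_sym h v w).
Qed.

Lemma herm0l w : herm h 0 w = 0.
Proof.
have := herm_lin h 1 0 0 w; rewrite scaler0 addr0 mul1r => /eqP.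
by rewrite eq_sym -subr_eq0 addrK => /eqP.
Qed.

Lemma herm0r w : herm h w 0 = 0.
Proof. by rewrite herm_sym herm0l conjc0. Qed.

Lemma herm_coord u v : herm h u v = coord u * conjc (coord v) * herm h Om Om.
Proof.
rewrite {1}(coordE u) {1}(coordE v) -[coord u *: _]addr0 herm_lin herm0l addr0.
by rewrite -[coord v *: _]addr0 herm_linr herm0r addr0 mulrA.
Qed.

(** If the square norm of [Om] vanished, so would that of its square in K_j,
    which is a positive multiple of Im tau. *)
Lemma herm_Om_gt0 : 0 < complex.Re (herm h Om Om).
Proof.
have g0 := herm_ge0 h Om.
have : herm h Om Om != 0.
  apply/negP => /eqP h0; have := phi_isometry h Om Om.
  rewrite h0 mul0r /Kj_normsq hOm phi_Om_lam conjc1 mul1r mulr1.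
  have b0 := Im_tau_gt0 hj htau; have pi0 := pi_gt0 R.
  move/eqP; rewrite mulf_eq0 mulf_eq0 (negbTE i_neq0) /= invr_eq0.
  rewrite -!cmod_eq0 cmodR normr_eq0 => /orP[|].
    rewrite cmod_eq0 subr_eq0 => /eqP /(congr1 (@complex.Im R)).
    rewrite Im_conj => e; clear g0 h0.
    have e0 : complex.Im tau = 0 by lra.
    by rewrite e0 ltxx in b0.
  rewrite /omega /inter /= mulr1 mulr0 subr0 mulr1 mulf_eq0 gt_eqF//.
  by rewrite gt_eqF.
move: g0; case: (herm h Om Om) => x y; rewrite lecE /= => /andP[/eqP -> x0] n0.
rewrite lt_neqAle x0 andbT eq_sym; apply: contra n0 => /eqP ->.
by rewrite -cmod_eq0 cmodE /= expr0n /= addr0 sqrtr0.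
Qed.

Lemma hnorm_coord v : hnorm h v = cmod (coord v) * hnorm h Om.
Proof.
rewrite /hnorm herm_coord.
have -> : coord v * conjc (coord v) = (cmod (coord v) ^+ 2)%:C.
  by rewrite rmorphXn /= -normE sqr_normc.
rewrite mulrC Re_mulr mulrC sqrtrM ?sqr_ge0// sqrtr_sqr ger0_norm//.
exact: cmod_ge0.
Qed.

Lemma hnorm_Om_gt0 : 0 < hnorm h Om.
Proof. by rewrite /hnorm sqrtr_gt0 herm_Om_gt0. Qed.

End HalfForms.

Section Translations.
Context {R : realType} (delta : lmodType R[i]).
Implicit Types (Psi : R * R -> delta) (x y : R * R).

(** Translations commute up to a phase given by the symplectic form, which is
    trivial in the colinear case. *)
Lemma translate_comp k x y Psi : inter y x = 0 ->
  translate k x (translate k y Psi) = translate k (x + y) Psi.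
Proof.
move=> yx; apply/funext => z; rewrite /translate scalerA -cexpD.
rewrite addrA [y + x]addrC; congr (cexp _ *: _).
have -> : omega y (x + z) = omega y z.
  rewrite /omega /inter.
  have -> : y.1 * (x + z).2 - y.2 * (x + z).1 = inter y x + (y.1 * z.2 - y.2 * z.1).
    by rewrite /inter /=; ring.
  by rewrite yx add0r.
have -> : omega (x + y) z = omega x z + omega y z.
  by rewrite /omega /inter /=; ring.
by rewrite rmorphD mulrDr.
Qed.

Lemma translate0 k Psi : translate k 0 Psi = Psi.
Proof.
apply/funext => z; rewrite /translate add0r.
have -> : omega 0 z = 0 by rewrite /omega /inter /=; ring.
by rewrite mulr0 cexp0 scale1r.
Qed.

Lemma translateZ k x a Psi :
  translate k x (fun z => a *: Psi z) = (fun z => a *: translate k x Psi z).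
Proof. by apply/funext => z; rewrite /translate !scalerA mulrC. Qed.

Lemma inter_colinear (a b : R) (v : R * R) : inter (a *: v) (b *: v) = 0.
Proof. by rewrite /inter /=; rewrite /GRing.scale /=; ring. Qed.

Lemma translate_eigen k (v : R * R) (r : R[i]) Psi : r != 0 ->
  translate k v Psi = (fun z => r *: Psi z) ->
  forall a : int, translate k (a%:~R *: v) Psi = (fun z => r ^ a *: Psi z).
Proof.
move=> r0 E.
have pos (n : nat) : translate k (n%:R *: v) Psi = (fun z => r ^+ n *: Psi z).
  elim: n => [|n IH].
    rewrite scale0r translate0; apply/funext => z.
    by rewrite expr0 scale1r.
  rewrite -natr1 scalerDl scale1r -translate_comp; last first.
    by rewrite -[v in inter v _]scale1r inter_colinear.
  rewrite E translateZ IH; apply/funext => z.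
  by rewrite scalerA exprS.
case=> n; first by rewrite -pmulrn pos.
rewrite NegzE; set m := n.+1.
have h : translate k (- (m%:R : R) *: v) (translate k (m%:R *: v) Psi) = Psi.
  rewrite translate_comp ?inter_colinear// -scalerDl addNr scale0r.
  exact: translate0.
rewrite pos translateZ in h.
rewrite mulrNz -pmulrn; apply/funext => z.
rewrite -[in RHS]h scalerA -exprnN mulVf ?scale1r//.
by rewrite expf_neq0.
Qed.

End Translations.

(** * Sums over symmetric ranges and roots of unity *)

Section SymmetricSums.

Lemma symmetric_sum (V : zmodType) (f : int -> V) N :
  \sum_(i < N.*2.+1) f (i%:Z - N%:Z) =
  f 0 + \sum_(1 <= n < N.+1) (f n%:Z + f (- n%:Z)).
Proof.
elim: N => [|N IH]; first by rewrite big_ord1 big_geq// !addr0.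
rewrite doubleS big_ord_recl big_ord_recr /= big_nat_recr//= [RHS]addrA -IH.
rewrite (_ : \sum_(i < N.*2.+1) _ = \sum_(i < N.*2.+1) f (i%:Z - N%:Z)); last first.
  apply: eq_bigr => i _; congr f; rewrite /= /bump /=; lia.
rewrite [LHS]addrC -[LHS]addrA; congr (_ + (f _ + f _)); rewrite /= /bump /=; lia.
Qed.

(** A range of even length centred at 0 has one unpaired end, - k. *)
Lemma symmetric_sum_even (V : zmodType) (f : int -> V) k : (0 < k)%N ->
  \sum_(b < 2 * k) f (b%:Z - k%:Z) =
  f (- k%:Z) + f 0 + \sum_(1 <= n < k) (f n%:Z + f (- n%:Z)).
Proof.
case: k => // N _.
rewrite -addrA -symmetric_sum (_ : (2 * N.+1)%N = N.*2.+2); last by lia.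
rewrite big_ord_recl; congr (f _ + _); first by rewrite sub0r.
by apply: eq_bigr => i _; congr f; rewrite /= /bump /=; lia.
Qed.

End SymmetricSums.

Section RootsOfUnity.
Context {R : realType}.
Variable k : nat.
Hypothesis k0 : (0 < k)%N.

Lemma circD (x y : R) : circ (x + y) = circ x * circ y.
Proof. by rewrite /circ [(x + y)%:C]rmorphD mulrDr cexpD. Qed.

Lemma circ_nat (n : nat) : circ (n%:R : R) = 1.
Proof.
rewrite /circ (rmorph_nat (real_complex R)) mulrC.
by rewrite (_ : _ * _ = (n%:Z)%:~R * (2 * pi%:C * 'i)) ?cexp_2piz// pmulrn.
Qed.

Lemma circXz (x : R) (a : int) : circ x ^ a = circ (a%:~R * x).
Proof.
by rewrite /circ -cexpMz; congr cexp; rewrite rmorphM /= rmorph_int; ring.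
Qed.

Definition root2k (x : R) : R[i] := circ (x / (2 * k%:R)).

Let kR0 : (k%:R : R) != 0. Proof. by rewrite pnatr_eq0 -lt0n. Qed.

Lemma Z2kE : (Zp_trunc (2 * k)).+2 = (2 * k)%N.
Proof. by apply: Zp_cast; lia. Qed.

Lemma root2k_plus (x y : R) : root2k (x + y) = root2k x * root2k y.
Proof. by rewrite /root2k (mulrDl x y) circD. Qed.

Lemma root2k_period (n : nat) (x : R) : root2k ((n * (2 * k))%:R + x) = root2k x.
Proof.
rewrite /root2k mulrDl circD natrM [(2 * k)%:R]natrM mulfK ?circ_nat ?mul1r//.
by rewrite mulf_neq0// pnatr_eq0.
Qed.

Lemma root2kD (m n : 'Z_(2 * k)) :
  root2k (m + n)%R%:R = root2k m%:R * root2k n%:R.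
Proof.
have -> : ((m + n)%R : nat) = ((m + n) %% (2 * k))%N.
  transitivity ((m + n) %% (Zp_trunc (2 * k)).+2)%N => //.
  by congr (_ %% _)%N; exact: Z2kE.
rewrite -(root2k_period ((m + n) %/ (2 * k))%N) -natrD -divn_eq natrD.
exact: root2k_plus.
Qed.

Lemma root2k_int (l : int) : root2k ((l%:~R : 'Z_(2 * k)) : nat)%:R = root2k l%:~R.
Proof.
have pos (n : nat) : root2k ((n%:R : 'Z_(2 * k)) : nat)%:R = root2k n%:R.
  elim: n => [|n IH] //.
  rewrite -[n.+1%:R in LHS]natr1 root2kD IH -[n.+1%:R in RHS]natr1.
  by rewrite root2k_plus.
case: l => n; first by rewrite -!pmulrn pos.
rewrite NegzE !mulrNz -!pmulrn.
have n0 : root2k n.+1%:R != 0 by exact: circ_neq0.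
apply: (mulfI n0); rewrite -[RHS]root2k_plus subrr -(pos n.+1) -root2kD subrr.
by [].
Qed.

Lemma root2k_inj (m n : 'Z_(2 * k)) : root2k m%:R = root2k n%:R -> m = n.
Proof.
move=> e.
have : circ ((m%:R - n%:R) / (2 * k%:R) : R) = 1.
  have n0 : root2k n%:R != 0 by exact: circ_neq0.
  by rewrite mulrBl circD circN [circ _]e mulfV.
move=> /circ_eq1[z]; move=> /(congr1 ( *%R^~ (2 * k%:R))).
rewrite divfK; last by rewrite mulf_neq0// pnatr_eq0.
have -> : z%:~R * (2 * k%:R) = (z * (2 * k)%:Z)%:~R :> R.
  by rewrite intrM -pmulrn natrM.
have -> : m%:R - n%:R = (m%:Z - n%:Z)%:~R :> R by rewrite intrB -!pmulrn.
move=> /intr_inj H.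
have hm : (m < 2 * k)%N by have := ltn_ord m; rewrite [X in (_ < X)%N]Z2kE.
have hn : (n < 2 * k)%N by have := ltn_ord n; rewrite [X in (_ < X)%N]Z2kE.
apply: val_inj => /=; move: (nat_of_ord m) (nat_of_ord n) hm hn H => x y hx hy H.
have [z1|z1] := leP 1%Z z; first by nia.
have [z2|z2] := leP z (-1)%Z; first by nia.
have z0 : z = 0 by lia.
by rewrite z0 mul0r in H; lia.
Qed.

Lemma root2k_orthogonal (m n : 'Z_(2 * k)) :
  \sum_(b < 2 * k) root2k n%:R ^ (- (b%:Z - k%:Z)) * root2k m%:R ^ (b%:Z - k%:Z) =
  (2 * k)%:R * (m == n)%:R.
Proof.
have [->|mn] := eqVneq m n.
  rewrite (eq_bigr (fun=> 1)); last first.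
    by move=> b _; rewrite -expfzDr ?addNr ?expr0z// circ_neq0.
  by rewrite sumr_const card_ord mulr1.
pose q := root2k m%:R / root2k n%:R.
have n0 : root2k n%:R != 0 by exact: circ_neq0.
have q0 : q != 0 by rewrite mulf_neq0 ?invr_eq0// circ_neq0.
have q1 : q != 1.
  apply: contra mn => /eqP e; apply/eqP/root2k_inj.
  by rewrite -[LHS](divfK n0) -/q e mul1r.
have qE : q = circ ((m%:R - n%:R) / (2 * k%:R)).
  by rewrite mulrBl circD circN.
have q2k : q ^+ (2 * k) = 1.
  rewrite -[LHS]/(q ^ (2 * k)%:Z) qE circXz mulrC -pmulrn natrM divfK; last first.
    by rewrite mulf_neq0// pnatr_eq0.
  by rewrite circD circN !circ_nat invr1 mulr1.
have pw (x y : R[i]) (a : int) : x ^ (- a) * y ^ a = (y / x) ^ a.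
  by rewrite expfzMl mulrC exprz_inv.
have term (b : nat) : q ^ (b%:Z - k%:Z) = q ^ (- k%:Z) * q ^+ b.
  by rewrite addrC expfzDr.
under eq_bigr => b _ do rewrite pw term.
rewrite mulr0.
rewrite -mulr_sumr.
have := subrX1 q (2 * k); rewrite q2k subrr => /esym/eqP.
rewrite mulf_eq0 subr_eq0 (negbTE q1) /= => /eqP ->.
by rewrite mulr0.
Qed.

End RootsOfUnity.

(** * The theta sum at the origin *)

Section ThetaSum.
Context {R : realType}.

(** The terms with n <> 0 are dominated by a geometric progression of ratio
    exp(- 2 pi k Im tau); the rate 1/k is a crude bound for its sum. *)
Lemma theta_sum_near_one (b : R) : 0 < b -> exists C : R,
  forall (k : nat) (tau : R[i]), (0 < k)%N -> complex.Im tau = b ->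
  cmod (sumZ (fun n => cexp (2 * 'i * pi%:C * k%:R * n%:~R ^+ 2 * tau)) - 1) <=
  C / k%:R.
Proof.
move=> b0; have pi0 := pi_gt0 R.
exists (4 / (2 * pi * b)) => k tau k0 tb.
have kR0 : 0 < k%:R :> R by rewrite ltr0n.
set u := fun n : int => _.
pose y := 2 * pi * b * k%:R.
have y0 : 0 < y by rewrite /y !mulr_gt0.
pose x := expR (- y).
have x0 : 0 < x := expR_gt0 _.
have x1 : x < 1 by rewrite -expR0 ltr_expR oppr_lt0.
have umod (n : nat) : cmod (u n%:Z) <= x ^+ n.
  rewrite /u cmod_cexp -expRM_natl ler_expR.
  have -> : complex.Re (2 * 'i * pi%:C * k%:R * n%:Z%:~R ^+ 2 * tau) =
      - (2 * pi * b * k%:R * n%:R ^+ 2).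
    have -> : 2 * 'i * pi%:C * k%:R * n%:Z%:~R ^+ 2 * tau =
        'i * tau * (2 * pi * k%:R * n%:R ^+ 2)%:C.
      rewrite -pmulrn; move: (pi : R) => p.
      rewrite !(rmorphXn (real_complex R), rmorph_nat (real_complex R), rmorphM (real_complex R)) /=.
      by ring.
    by rewrite Re_mulr ReM Re_i Im_i tb; ring.
  rewrite -/y; have : n%:R <= n%:R ^+ 2 :> R.
    by rewrite -natrX ler_nat; case: (n) => [|m] //; rewrite -mulnn leq_pmulr.
  by move=> h; rewrite -/y mulrN lerN2 mulrC ler_pM2l.
have uN (n : nat) : u (- n%:Z) = u n%:Z by rewrite /u mulrNz sqrrN.
have u0 : u 0 = 1 by rewrite /u mulr0z expr0n /= mulr0 mul0r cexp0.
pose S (N : nat) := \sum_(i < N.*2.+1) u (i%:Z - N%:Z).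
have SE N : S N = 1 + 2 * \sum_(1 <= n < N.+1) u n%:Z.
  rewrite /S symmetric_sum u0; congr (_ + _).
  rewrite mulr_sumr; apply: eq_bigr => n _.
  by rewrite uN mulr_natl mulr2n.
have geo N : \sum_(1 <= n < N.+1) x ^+ n <= y^-1.
  have ey : y <= expR y - 1 by have := expR_ge1Dx y; lra.
  have xe : x * expR y = 1 by rewrite /x -expRD addNr expR0.
  have h : (1 - x) * \sum_(1 <= n < N.+1) x ^+ n <= x.
    suff -> : (1 - x) * \sum_(1 <= n < N.+1) x ^+ n = x - x ^+ N.+1.
      by rewrite lerBlDr lerDl exprn_ge0// ltW.
    elim: N => [|N IH]; first by rewrite big_geq// mulr0 expr1 subrr.
    by rewrite big_nat_recr//= mulrDr IH [x ^+ N.+2]exprS; ring.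
  have S0 : 0 <= \sum_(1 <= n < N.+1) x ^+ n.
    by apply: sumr_ge0 => n _; rewrite exprn_ge0// ltW.
  rewrite -[leRHS]mul1r ler_pdivlMr// -(ler_pM2l x0).
  set T := \sum_(_ <= _ < _) _ in h S0 *.
  have : y * x <= 1 - x by nra.
  nra.
have part (p : R[i] -> R) : (forall z w, p (z + w) = p z + p w) ->
    (forall z, `|p z| <= cmod z) -> (p 1 = 1 \/ p 1 = 0) ->
    `|limn (fun N => p (S N)) - p 1| <= 2 / y.
  move=> pD ple p1.
  have p0 : p 0 = 0 by apply: (addrI (p 0)); rewrite -pD !addr0.
  have pS N : p (S N) = p 1 + 2 * \sum_(1 <= n < N.+1) p (u n%:Z).
    rewrite SE pD; congr (_ + _).
    rewrite mulr_natl mulr2n pD mulr_natl mulr2n.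
    have -> // : p (\sum_(1 <= n < N.+1) u n%:Z) = \sum_(1 <= n < N.+1) p (u n%:Z).
    by elim/big_rec2: _ => // n a c _ <-.
  have bd N : `|p (S N) - p 1| <= 2 / y.
    rewrite pS addrAC subrr add0r normrM ger0_norm// ler_wpM2l//.
    apply: le_trans (geo N); apply: le_trans (ler_norm_sum _ _ _) _.
    by apply: ler_sum => n _; apply: le_trans (ple _) (umod _).
  have cS : cvgn (fun N => p (S N)).
    have cser : cvgn [series p (u n.+1%:Z)]_n.
      apply: normed_cvg; apply: (series_le_cvg (v_ := fun n => x ^+ n)).
      - by move=> n; exact: normr_ge0.
      - by move=> n; exact: exprn_ge0 (ltW x0).
      - move=> n; apply: le_trans (ple _) _; apply: le_trans (umod _) _.
        by rewrite exprS ler_piMl ?exprn_ge0 ?ltW.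
      - have -> : (fun n => x ^+ n) = geometric 1 x.
          by apply/funext => n; rewrite /geometric /= mul1r.
        by apply: is_cvg_geometric_series; rewrite ger0_norm// ltW.
    have : (fun N => p 1 + 2 * [series p (u n.+1%:Z)]_n N) =
        (fun N => p (S N)).
      apply/funext => N; rewrite pS; congr (_ + _ * _).
      by rewrite big_add1 /=.
    move=> <-; apply: is_cvgD; first exact: is_cvg_cst.
    by apply: is_cvgM => //; exact: is_cvg_cst.
  have cn : `|p (S N) - p 1| @[N --> \oo] --> `|limn (fun N => p (S N)) - p 1|.
    by apply: cvg_norm; apply: cvgB => //; exact: cvg_cst.
  apply: (cvgr_to_le cn); near=> N; exact: bd.
rewrite /sumZ -/S.
apply: (le_trans (cmod_le_ReIm _)); rewrite ReD ImD ReN ImN Re_cplx Im_cplx.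
have -> : 4 / (2 * pi * b) / k%:R = 2 / y + 2 / y.
  rewrite /y; have pn : pi != 0 :> R by rewrite gt_eqF.
  by move: (pi : R) pn => p pn; field; rewrite pn !gt_eqF.
apply: lerD; apply: part.
- exact: ReD.
- exact: Re_le_cmod.
- by left.
- exact: ImD.
- exact: Im_le_cmod.
- by right.
Unshelve. all: by end_near. Qed.

End ThetaSum.

(** * Extracting a coefficient *)

Section ThetaBasis.
Context {R : realType}.
Variable j : {linear (R * R)%type -> (R * R)%type}.
Hypothesis hj : compatible_structure j.
Variable delta : lmodType R[i].
Variable h : half_form j delta.
Variable tau : R[i].
Hypothesis htau : lam R = complex.Re tau *: mu R + complex.Im tau *: j (mu R).
Variable Om : delta.
Hypothesis hOm : phi h Om Om (mu R) = 1.
Variable k : nat.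
Hypothesis k0 : (0 < k)%N.
Variable Psi : 'Z_(2 * k) -> R * R -> delta.
Hypothesis hPsi : theta_basis h tau Om Psi.
Variable c : 'Z_(2 * k) -> R[i].

Local Notation co := (coord hOm).

Let Z : R * R -> delta := fun x => \sum_m c m *: Psi m x.

Let kR0 : (k%:R : R) != 0. Proof. by rewrite pnatr_eq0 -lt0n. Qed.

Lemma scale_lam (x : R) : x *: lam R = (0, x).
Proof. by rewrite -[in RHS](mulr1 x) -[X in (X, _)](mulr0 x). Qed.

Lemma scale_mu (x : R) : x *: mu R = (x, 0).
Proof. by rewrite -[in RHS](mulr1 x) -[X in (_, X)](mulr0 x). Qed.

Lemma Psi_ccontinuous m : ccontinuous (fun x => co (Psi m x)).
Proof.
have [/(_ m)[[u [g [[sg _] E]] _] _ _ _ _]] := hPsi.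
have -> : (fun x => co (Psi m x)) = (fun x => g x * co u).
  by apply/funext => x; rewrite E coordZ.
apply: ccontinuousM; last exact: ccontinuous_cst.
by split=> x; have [dr di] := smooth_diff (x := x) sg Logic.I;
  exact: differentiable_continuous.
Qed.

(** Continuity makes every product integrable over the square, so that the
    integral of the combination can be split. *)
Lemma scalar_product_coefficient l : scalar_product h Z (Psi l) = c l.
Proof.
have [_ orth _ _ _] := hPsi.
have cont m : ccontinuous (fun x => herm h (Psi m x) (Psi l x)).
  have -> : (fun x => herm h (Psi m x) (Psi l x)) =
      (fun x => co (Psi m x) * conjc (co (Psi l x)) * herm h Om Om).
    by apply/funext => x; exact: herm_coord.
  apply: ccontinuousM; last exact: ccontinuous_cst.
  apply: ccontinuousM; first exact: Psi_ccontinuous.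
  by apply: ccontinuous_conj; exact: Psi_ccontinuous.
have E : (fun x => herm h (Z x) (Psi l x)) =
    (fun x => \sum_m c m * herm h (Psi m x) (Psi l x)).
  apply/funext => x; rewrite /Z; elim/big_rec2: _ => [|m a v _ <-].
    exact: herm0l.
  exact: herm_lin.
have spE (P1 P2 : R * R -> delta) : scalar_product h P1 P2 =
    `|omega (mu R) (lam R)|%:C * square_integral (fun x => herm h (P1 x) (P2 x)).
  by [].
rewrite spE E square_integral_sum; last first.
  by move=> m; apply: ccontinuousM; [exact: ccontinuous_cst|exact: cont].
rewrite mulr_sumr.
rewrite (eq_bigr (fun m => c m * scalar_product h (Psi m) (Psi l))); last first.
  move=> m _; rewrite spE (square_integralZ _ (cont m)).
  exact: mulrCA.
rewrite (bigD1 l)//= orth eqxx mulr1 big1 ?addr0// => m ml.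
by rewrite orth (negbTE ml) mulr0.
Qed.

Lemma Psi_eigen m (a : int) :
  translate k (a%:~R *: ((2 * k%:R)^-1 *: mu R)) (Psi m) =
  (fun x => root2k k m%:R ^ a *: Psi m x).
Proof.
apply: translate_eigen; first exact: circ_neq0.
have [_ _ _ [/(_ m) -> _] _] := hPsi.
apply/funext => x; congr (cexp _ *: _).
rewrite rmorphM fmorphV rmorphM /= !(rmorph_nat (real_complex R)).
have kC : (k%:R : R[i]) != 0 by rewrite pnatr_eq0 -lt0n.
by move: (pi : R) => p; field.
Qed.

Lemma Psi_shift (l : int) :
  translate k (l%:~R *: ((2 * k%:R)^-1 *: lam R)) (Psi 0) = Psi l%:~R.
Proof.
have [_ _ _ [_ sh] _] := hPsi; set v := _ *: lam R in sh *.
have pos (n : nat) m : translate k (n%:R *: v) (Psi m) = Psi (m + n%:R).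
  elim: n m => [|n IH] m; first by rewrite scale0r translate0 addr0.
  rewrite -natr1 scalerDl scale1r -translate_comp; last first.
    by rewrite -[v in inter v _]scale1r inter_colinear.
  by rewrite sh IH -addrA [1 + _]addrC natr1.
case: l => n; first by rewrite -!pmulrn pos add0r.
rewrite NegzE !mulrNz -!pmulrn.
rewrite -[0](addNr (n.+1%:R)) -pos translate_comp ?inter_colinear//.
by rewrite -scalerDl addNr scale0r translate0.
Qed.

(** The translation by l lambda / 2k, which carries Psi_0 to Psi_l, has a
    trivial phase on the line of lambda. *)
Lemma Psi_line (l : int) : Psi l%:~R (0, - l%:~R / (2 * k%:R)) = Psi 0 0.
Proof.
rewrite -Psi_shift /translate.
have -> : l%:~R *: ((2 * k%:R)^-1 *: lam R) = (0, l%:~R / (2 * k%:R)) :> R * R.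
  by rewrite scalerA scale_lam.
have -> : omega ((0, l%:~R / (2 * k%:R)) : R * R) (0, - l%:~R / (2 * k%:R)) = 0.
  by rewrite /omega /inter /= mul0r mulr0 subr0 mulr0.
rewrite mulr0 cexp0 scale1r; congr Psi.
have -> : ((0, l%:~R / (2 * k%:R)) + (0, - l%:~R / (2 * k%:R)) : R * R) =
   (0 + 0, l%:~R / (2 * k%:R) + - l%:~R / (2 * k%:R)) by [].
by rewrite addr0 mulNr subrr.
Qed.

(** Averaging the translates along mu against a character isolates one
    coefficient; it only involves values on a horizontal segment. *)
Lemma extraction (l : int) (q := - l%:~R / (2 * k%:R) : R) :
  \sum_(b < 2 * k)
    (fun a : int => cexp (twopii * (a%:~R / 2)%:C * q%:C) *
       co (Z (a%:~R / (2 * k%:R), q))) (b%:Z - k%:Z) =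
  (2 * k)%:R * (c l%:~R * co (Psi 0 0)).
Proof.
have term (a : int) : cexp (twopii * (a%:~R / 2)%:C * q%:C) *
       co (Z (a%:~R / (2 * k%:R), q)) =
    \sum_(m : 'Z_(2 * k)) root2k k (l%:~R : 'Z_(2 * k))%:R ^ (- a) * root2k k m%:R ^ a *
      (c m * co (Psi m (0, q))).
  have T (m : 'Z_(2 * k)) : cexp (- (twopii * (a%:~R / 2)%:C * q%:C)) *
      co (Psi m (a%:~R / (2 * k%:R), q)) = root2k k m%:R ^ a * co (Psi m (0, q)).
    rewrite -coordZ -(coordZ hOm (_ ^ _)); congr (co _).
    have := congr1 (fun f => f (0, q)) (Psi_eigen m a); rewrite /translate => <-.
    have -> : a%:~R *: ((2 * k%:R)^-1 *: mu R) = (a%:~R / (2 * k%:R), 0) :> R * R.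
      by rewrite scalerA scale_mu.
    have -> : ((a%:~R / (2 * k%:R), 0) + (0, q) : R * R) =
       (a%:~R / (2 * k%:R) + 0, 0 + q) by [].
    rewrite addr0 add0r; congr (cexp _ *: _).
    have -> : omega ((a%:~R / (2 * k%:R), 0) : R * R) (0, q) =
       (2 * pi * (a%:~R / 2) * q) / (k%:R / 2).
      rewrite /omega /inter /= mul0r subr0.
      by move: (pi : R) => p; field.
    have kC : (k%:R : R[i]) != 0 by rewrite pnatr_eq0 -lt0n.
    have eX (X : R) : (X / (k%:R / 2))%:C = X%:C / (k%:R / 2) :> R[i].
      by rewrite !(rmorphM (real_complex R), fmorphV (real_complex R),
        rmorph_nat (real_complex R)).
    have eY (Y : R[i]) : - 'i * (k%:R / 2) * (Y / (k%:R / 2)) = - ('i * Y).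
      by field.
    rewrite eX eY.
    congr (- _); rewrite /twopii.
    by rewrite !(rmorphM (real_complex R)) /= (rmorph_nat (real_complex R)); ring.
  rewrite /Z coord_sum mulr_sumr; apply: eq_bigr => m _.
  rewrite coordZ mulrCA [RHS]mulrCA; congr (_ * _).
  have -> : cexp (twopii * (a%:~R / 2)%:C * q%:C) =
      cexp (2 * (twopii * (a%:~R / 2)%:C * q%:C)) *
      cexp (- (twopii * (a%:~R / 2)%:C * q%:C)).
    by rewrite -cexpD; congr cexp; ring.
  rewrite -[LHS]mulrA T [LHS]mulrA; congr (_ * _); congr (_ * _).
  rewrite root2k_int// /root2k circXz /circ; congr cexp.
  rewrite /twopii /q.
  rewrite !(rmorph_int, rmorph_nat (real_complex R), rmorphN, rmorphM (real_complex R), fmorphV (real_complex R)) /=.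
  have kC : (k%:R : R[i]) != 0 by rewrite pnatr_eq0 -lt0n.
  by move: pi%:C => p; field.
rewrite (eq_bigr (fun b : 'I__ => \sum_(m : 'Z_(2 * k))
  root2k k (l%:~R : 'Z_(2 * k))%:R ^ (- (b%:Z - k%:Z)) * root2k k m%:R ^ (b%:Z - k%:Z) *
  (c m * co (Psi m (0, q))))); last by move=> b _; exact: term.
rewrite exchange_big /=.
under eq_bigr => m _ do rewrite -mulr_suml root2k_orthogonal//.
rewrite (bigD1 (l%:~R))//= eqxx mulr1 big1 ?addr0; last first.
  by move=> m /negbTE ml; rewrite ml mulr0 mul0r.
by rewrite Psi_line.
Qed.

End ThetaBasis.

(** * Summation along a transverse segment *)

Section SegmentSum.
Context {R : realType}.

(** The terms of index a and -a are added before they are estimated, which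
    cancels the first-order variation of the amplitude [f]. *)
Lemma segment_sum (dc : R[i]) (del K : R) :
  0 < complex.Re dc -> 0 < del -> del < 2^-1 -> 0 <= K -> exists C : R,
  forall (k : nat) (N : R) (F : int -> R[i]) (w : R[i]) (f : R -> R[i]),
  (0 < k)%N -> 0 <= N -> cmod w <= K * N ->
  (forall a : int, `|a%:~R / (2 * k%:R) : R| <= del ->
     cmod (F a - w * gE (dc / (4 * k%:R)) a%:~R * f (a%:~R / (2 * k%:R))) <=
     N * (K / k%:R) * expR (- (complex.Re dc / (16 * k%:R) * (a%:~R : R) ^+ 2)) +
     N * (K / k%:R ^+ 2)) ->
  (forall a : int, del < `|a%:~R / (2 * k%:R) : R| <= 2^-1 ->
     cmod (F a) <= N * (K / k%:R ^+ 2)) ->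
  (forall s, `|s| <= del -> cmod (f s + f (- s) - 2 * f 0) <= K * s ^+ 2) ->
  cmod (f 0) <= K ->
  cmod (\sum_(b < 2 * k) F (b%:Z - k%:Z) -
        w * f 0 * gauss_sum k (dc / (4 * k%:R))) <= N * (C / Num.sqrt k%:R).
Proof.
set r := complex.Re dc => r0 d0 d2 K0.
pose C1 := 2 * K + 2 * K ^+ 2 / r.
pose C2 := 2 * K + 8 * K ^+ 2 / (r * del ^+ 2) ^+ 2.
have C10 : 0 <= C1.
  apply: addr_ge0; first exact: mulr_ge0.
  by apply: divr_ge0; [rewrite mulr_ge0 ?sqr_ge0|exact: ltW].
have rd0 : 0 < (r * del ^+ 2) ^+ 2 by rewrite exprn_gt0// mulr_gt0// exprn_gt0.
have C20 : 0 <= C2.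
  apply: addr_ge0; first exact: mulr_ge0.
  by apply: divr_ge0; [rewrite mulr_ge0 ?sqr_ge0|exact: ltW].
exists (3 * K + C1 * (2 * expR 1 / Num.sqrt r) + C2).
move=> k N F w f k0 N0 wK H1 H2 H3 H4.
have kR0 : 0 < k%:R :> R by rewrite ltr0n.
have kR1 : 1 <= k%:R :> R by rewrite ler1n.
have kn0 : k%:R != 0 :> R by rewrite gt_eqF.
have sk0 : 0 < Num.sqrt k%:R :> R by rewrite sqrtr_gt0.
have sk1 : 1 <= Num.sqrt k%:R :> R by rewrite -[leLHS]sqrtr1 ler_sqrt.
have skk : Num.sqrt k%:R ^+ 2 = k%:R :> R by rewrite sqr_sqrtr// ltW.
set e := dc / (4 * k%:R) in H1 *.
have Re_e : complex.Re e = r / (4 * k%:R).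
  rewrite /e (_ : (4 * k%:R)^-1 = (4 * k%:R)^-1%:C) ?Re_mulr//.
  by rewrite fmorphV rmorphM /= !(rmorph_nat (real_complex R)).
have gEN x : gE e (- x) = gE e x by rewrite /gE rmorphN sqrrN.
pose g (a : nat) := expR (- (r / (16 * k%:R) * a%:R ^+ 2)).
have term (a : nat) : (1 <= a < k)%N ->
    cmod (F a%:Z + F (- a%:Z) - 2 * w * f 0 * gE e a%:R) <=
    N * (C1 / k%:R) * g a + N * (C2 / k%:R ^+ 2).
  move=> /andP[a1 ak].
  have aR0 : 0 < a%:R :> R by rewrite ltr0n.
  pose s : R := a%:R / (2 * k%:R).
  have s0 : 0 < s by rewrite divr_gt0// mulr_gt0.
  have s2 : s <= 2^-1.
    by rewrite ler_pdivrMr ?mulr_gt0// mulrA mulVf// mul1r ler_nat ltnW.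
  have aE : (a%:Z)%:~R / (2 * k%:R) = s :> R by rewrite -pmulrn.
  have aNE : (- a%:Z)%:~R / (2 * k%:R) = - s :> R by rewrite mulrNz -pmulrn mulNr.
  have gEm : cmod (gE e a%:R) = expR (- (r / (4 * k%:R) * a%:R ^+ 2)).
    by rewrite cmod_gE Re_e.
  have wg : 0 <= cmod w by exact: cmod_ge0.
  have [near|far] := leP s del.
    have h1 := H1 a%:Z; have h2 := H1 (- a%:Z).
    rewrite aE (ger0_norm (ltW s0)) -pmulrn in h1.
    rewrite aNE normrN (ger0_norm (ltW s0)) mulrNz -pmulrn gEN sqrrN in h2.
    have {}h1 := h1 near; have {}h2 := h2 near.
    have h3 := H3 s; rewrite (ger0_norm (ltW s0)) in h3; have {}h3 := h3 near.
    have -> : F a%:Z + F (- a%:Z) - 2 * w * f 0 * gE e a%:R =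
      (F a%:Z - w * gE e a%:R * f s) + (F (- a%:Z) - w * gE e a%:R * f (- s)) +
      w * gE e a%:R * (f s + f (- s) - 2 * f 0) by ring.
    apply: (le_trans (cmodD _ _)); apply: (le_trans (lerD (cmodD _ _) (lexx _))).
    rewrite -/(g a) in h1 h2.
    have h4 : cmod (w * gE e a%:R * (f s + f (- s) - 2 * f 0)) <=
        N * (2 * K ^+ 2 / r / k%:R) * g a.
      rewrite (cmodM (w * _)) (cmodM w) gEm.
      pose y := r / (4 * k%:R) * a%:R ^+ 2.
      have y0 : 0 <= y by rewrite mulr_ge0 ?sqr_ge0// ltW// divr_gt0// mulr_gt0.
      have yy := y_exp_le y0.
      have ey : expR (- y) = expR (- (y / 2)) * expR (- (y / 2)).
        by rewrite -expRD; congr expR; field.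
      have s2E : s ^+ 2 = y / (r * k%:R).
        by rewrite /s /y; field; rewrite kn0 gt_eqF.
      have gy : expR (- (y / 2)) <= g a.
        rewrite /g ler_expR lerN2.
        have -> : r / (16 * k%:R) * a%:R ^+ 2 = y / 4 by rewrite /y; field.
        lra.
      apply: (@le_trans _ _ (K * N * expR (- y) * (K * s ^+ 2))).
        apply: ler_pM; rewrite ?mulr_ge0 ?cmod_ge0 ?expR_ge0//.
        by rewrite ler_wpM2r ?expR_ge0.
      have -> : K * N * expR (- y) * (K * s ^+ 2) =
          N * (K ^+ 2 / r / k%:R) * (y * expR (- (y / 2))) * expR (- (y / 2)).
        by rewrite ey s2E; field; rewrite kn0 gt_eqF.
      have -> : N * (2 * K ^+ 2 / r / k%:R) * g a =
          N * (K ^+ 2 / r / k%:R) * 2 * g a by ring.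
      have c0 : 0 <= N * (K ^+ 2 / r / k%:R).
        by rewrite mulr_ge0// !mulr_ge0 ?sqr_ge0// invr_ge0 ltW.
      apply: ler_pM; rewrite ?expR_ge0//.
        by rewrite mulr_ge0// mulr_ge0 ?expR_ge0.
      by rewrite ler_wpM2l.
    have -> : N * (C1 / k%:R) * g a = 2 * (N * (K / k%:R) * g a) +
        N * (2 * K ^+ 2 / r / k%:R) * g a by rewrite /C1; ring.
    have : N * (2 * K / k%:R ^+ 2) <= N * (C2 / k%:R ^+ 2).
      rewrite ler_wpM2l// ler_wpM2r ?invr_ge0 ?sqr_ge0// lerDl.
      by rewrite mulr_ge0 ?invr_ge0 ?(ltW rd0)// mulr_ge0// sqr_ge0.
    by lra.
  have h1 := H2 a%:Z; have h2 := H2 (- a%:Z).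
  rewrite aE (ger0_norm (ltW s0)) far s2 in h1.
  rewrite aNE normrN (ger0_norm (ltW s0)) far s2 in h2.
  have {}h1 := h1 isT; have {}h2 := h2 isT.
  have gsm : cmod (gE e a%:R) <= 4 / (r * del ^+ 2) ^+ 2 / k%:R ^+ 2.
    rewrite gEm.
    have z0 : 0 < r * del ^+ 2 * k%:R by rewrite mulr_gt0// mulr_gt0// exprn_gt0.
    have := expN_le_V2 z0.
    have -> : 4 / (r * del ^+ 2 * k%:R) ^+ 2 = 4 / (r * del ^+ 2) ^+ 2 / k%:R ^+ 2.
      by field; rewrite kn0 !gt_eqF.
    apply: le_trans; rewrite ler_expR lerN2.
    have -> : r / (4 * k%:R) * a%:R ^+ 2 = r * s ^+ 2 * k%:R.
      by rewrite /s; field.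
    rewrite ler_wpM2r ?(ltW kR0)// ler_wpM2l ?(ltW r0)//.
    by apply: lerXn2r; rewrite ?nnegrE; exact: ltW.
  apply: (le_trans (cmodB _ _)); apply: (le_trans (lerD (cmodD _ _) (lexx _))).
  have -> : 2 * w * f 0 * gE e a%:R = 2%:R * (w * (f 0 * gE e a%:R)) by ring.
  rewrite cmod_nat_mul (cmodM w) (cmodM (f 0)).
  have h3 : cmod w * (cmod (f 0) * cmod (gE e a%:R)) <=
      K * N * (K * (4 / (r * del ^+ 2) ^+ 2 / k%:R ^+ 2)).
    apply: ler_pM; rewrite ?mulr_ge0 ?cmod_ge0//.
    by apply: ler_pM; rewrite ?cmod_ge0.
  have : 0 <= N * (C1 / k%:R) * g a.
    by apply: mulr_ge0; [apply: mulr_ge0; [|apply: divr_ge0 => //; exact: ltW]|exact: expR_ge0].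
  have -> : N * (C2 / k%:R ^+ 2) = 2 * (N * (K / k%:R ^+ 2)) +
      2 * (K * N * (K * (4 / (r * del ^+ 2) ^+ 2 / k%:R ^+ 2))).
    by rewrite /C2; ring.
  by lra.
rewrite (symmetric_sum_even _ k0) /gauss_sum.
have -> : F (- k%:Z) + F 0 + \sum_(1 <= n < k) (F n%:Z + F (- n%:Z)) -
    w * f 0 * (1 + 2 * \sum_(1 <= a < k) gE e a%:R) =
  F (- k%:Z) + (F 0 - w * f 0) +
  \sum_(1 <= a < k) (F a%:Z + F (- a%:Z) - 2 * w * f 0 * gE e a%:R).
  by rewrite sumrB -mulr_sumr; ring.
have b1 : cmod (F (- k%:Z)) <= N * (K / k%:R ^+ 2).
  have kE : (- k%:Z)%:~R / (2 * k%:R) = - 2^-1 :> R.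
    by rewrite mulrNz -pmulrn; field.
  apply: H2; rewrite kE normrN ger0_norm ?invr_ge0//.
  by rewrite d2 lexx.
have b0 : cmod (F 0 - w * f 0) <= N * (K / k%:R) + N * (K / k%:R ^+ 2).
  have := H1 0; rewrite mul0r normr0 gE_0 mulr1 expr0n /= mulr0 oppr0 expR0 mulr1.
  by apply; exact: ltW.
have bs : cmod (\sum_(1 <= a < k) (F a%:Z + F (- a%:Z) - 2 * w * f 0 * gE e a%:R))
    <= N * (C1 * (2 * expR 1 / Num.sqrt r) / Num.sqrt k%:R) + N * (C2 / k%:R).
  apply: (le_trans (cmod_sum _ _ _)).
  apply: (@le_trans _ _ (\sum_(1 <= a < k) (N * (C1 / k%:R) * g a +
      N * (C2 / k%:R ^+ 2)))).
    rewrite big_nat_cond [leRHS]big_nat_cond; apply: ler_sum => a.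
    by rewrite andbT => /term.
  rewrite big_split /= -mulr_sumr; apply: lerD.
    have sr0 : 0 < Num.sqrt r by rewrite sqrtr_gt0.
    have st0 : 0 < Num.sqrt r / (4 * Num.sqrt k%:R) by rewrite divr_gt0// mulr_gt0.
    have := sum_gauss_le k st0.
    have e16 : 4 ^+ 2 = 16 :> R by rewrite -natrX.
    rewrite (eq_bigr (fun a => g a)); last first.
      move=> a _; rewrite /g exprMn expr_div_n exprMn skk sqr_sqrtr ?(ltW r0)//.
      by rewrite e16.
    move=> h; have c0 : 0 <= N * (C1 / k%:R).
      by apply: mulr_ge0 => //; apply: divr_ge0 => //; exact: ltW.
    apply: (le_trans (ler_wpM2l c0 h)).
    move: skk sk0; move: (Num.sqrt k%:R : R) => t <- t0.
    rewrite le_eqVlt; apply/orP; left; apply/eqP; field.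
    by rewrite !gt_eqF.
  rewrite sumr_const_nat -[leLHS]mulr_natl.
  apply: (@le_trans _ _ (k%:R * (N * (C2 / k%:R ^+ 2)))).
    rewrite ler_wpM2r ?ler_nat ?leq_subr//.
    by apply: mulr_ge0 => //; apply: divr_ge0 => //; exact: sqr_ge0.
  by rewrite le_eqVlt; apply/orP; left; apply/eqP; field.
apply: (le_trans (cmodD _ _)); apply: (le_trans (lerD (cmodD _ _) (lexx _))).
have i1 (x : R) : 0 <= x -> N * (x / k%:R) <= N * (x / Num.sqrt k%:R).
  move=> x0; rewrite ler_wpM2l// ler_wpM2l// lef_pV2 ?posrE//.
  by rewrite -[leRHS]skk expr2 ler_peMl// ltW.
have i2 : N * (K / k%:R ^+ 2) <= N * (K / k%:R).
  rewrite ler_wpM2l// ler_wpM2l// lef_pV2 ?posrE ?exprn_gt0//.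
  by rewrite expr2 ler_peMl// ltW.
have := i1 K K0; have := i1 C2 C20.
have -> : N * ((3 * K + C1 * (2 * expR 1 / Num.sqrt r) + C2) / Num.sqrt k%:R) =
   3 * (N * (K / Num.sqrt k%:R)) +
   N * (C1 * (2 * expR 1 / Num.sqrt r) / Num.sqrt k%:R) +
   N * (C2 / Num.sqrt k%:R) by ring.
by lra.
Qed.

End SegmentSum.

(** * The coefficients near a regular point *)

Section CoefficientFromSum.
Context {R : realType}.

(** The factor [th] is only known to be close to 1, so the size of the
    coefficient has to be bounded before [th] can be removed. *)
Lemma coefficient_from_sum (C V : R) : 0 <= C -> 0 <= V -> exists C' : R,
  forall (k : nat) (c th g v w : R[i]), (0 < k)%N -> 2 * C <= k%:R ->
  cmod v <= V -> cmod w <= C -> cmod (th - 1) <= C / k%:R ->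
  cmod (g - v * (Num.sqrt k%:R)%:C) <= C / Num.sqrt k%:R ->
  cmod ((2 * k)%:R * c * th - w * g) <= C / Num.sqrt k%:R ->
  cmod (c - w * v / (2 * (Num.sqrt k%:R)%:C)) <= C' / (k%:R * Num.sqrt k%:R).
Proof.
move=> C0 V0; pose E := C + C ^+ 2; exists ((E + 2 * C * (C * V + E)) / 2).
move=> k c th g v w k0 kC vV wC thC gC H.
have E0 : 0 <= E by rewrite addr_ge0// sqr_ge0.
have kR0 : 0 < k%:R :> R by rewrite ltr0n.
have kR1 : 1 <= k%:R :> R by rewrite ler1n.
have sk0 : 0 < Num.sqrt k%:R :> R by rewrite sqrtr_gt0.
have skk : k%:R = Num.sqrt k%:R ^+ 2 :> R by rewrite sqr_sqrtr// ltW.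
have sk1 : 1 <= Num.sqrt k%:R :> R by rewrite -(@expr_ge1 _ 2) ?(ltW sk0)// -skk.
have skC : (k%:R : R[i]) = (Num.sqrt k%:R)%:C ^+ 2.
  by rewrite -rmorphXn /= -skk (rmorph_nat (real_complex R)).
set s : R := Num.sqrt k%:R in skC sk0 skk sk1 gC H *.
have sC0 : s%:C != 0 :> R[i] by rewrite -cmod_eq0 cmodR normr_eq0 gt_eqF.
set a := (2 * k)%:R * c in H *.
have h1 : cmod (a * th - w * v * s%:C) <= E / s.
  have -> : a * th - w * v * s%:C = (a * th - w * g) + w * (g - v * s%:C) by ring.
  apply: (le_trans (cmodD _ _)); rewrite (cmodM w).
  have : cmod w * cmod (g - v * s%:C) <= C * (C / s).
    by apply: ler_pM; rewrite ?cmod_ge0.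
  have -> : E / s = C / s + C * (C / s) by rewrite /E; ring.
  by move=> h; apply: lerD.
have h2 : cmod (a * th) <= (C * V + E) * s.
  have -> : a * th = (a * th - w * v * s%:C) + w * v * s%:C by ring.
  apply: (le_trans (cmodD _ _)); rewrite (cmodM (w * v)) (cmodM w) cmodR.
  rewrite (ger0_norm (ltW sk0)).
  have h3 : cmod w * cmod v * s <= C * V * s.
    by rewrite ler_wpM2r ?(ltW sk0)//; apply: ler_pM; rewrite ?cmod_ge0.
  have h4 : E / s <= E * s.
    rewrite ler_wpM2l//; apply: (@le_trans _ _ 1) => //.
    by rewrite invf_le1.
  by move: (lerD (le_trans h1 h4) h3); rewrite addrC -mulrDl [E + _]addrC.
have h3 : cmod a <= 2 * cmod (a * th).
  have : cmod (a * (th - 1)) <= cmod a / 2.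
    rewrite (cmodM a) ler_wpM2l ?cmod_ge0//.
    apply: (le_trans thC); rewrite ler_pdivrMr//; clear -kC; lra.
  have : cmod a <= cmod (a * th) + cmod (a * (th - 1)).
    have {1}-> : a = a * th - a * (th - 1) by ring.
    exact: cmodB.
  clear; lra.
have h4 : cmod (a - w * v * s%:C) <= (E + 2 * C * (C * V + E)) / s.
  have -> : a - w * v * s%:C = (a * th - w * v * s%:C) - a * (th - 1) by ring.
  apply: (le_trans (cmodB _ _)); rewrite mulrDl; apply: lerD => //.
  rewrite (cmodM a).
  have : cmod a * cmod (th - 1) <= 2 * ((C * V + E) * s) * (C / k%:R).
    apply: ler_pM; rewrite ?cmod_ge0//; apply: (le_trans h3).
    by rewrite ler_wpM2l.
  move/le_trans; apply; rewrite skk.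
  by rewrite le_eqVlt; apply/orP; left; apply/eqP; field; rewrite gt_eqF.
have -> : c - w * v / (2 * s%:C) = (a - w * v * s%:C) / (2 * k%:R).
  by rewrite /a natrM skC; field.
rewrite (cmodM (a - w * v * s%:C)) cmodV -natrM cmod_nat ler_pdivrMr ?ltr0n ?muln_gt0//.
apply: (le_trans h4); rewrite natrM.
by rewrite le_eqVlt; apply/orP; left; apply/eqP; field; rewrite !gt_eqF.
Qed.

End CoefficientFromSum.

Section LocalBox.
Context {R : realType}.

(** The linear terms of the Taylor expansion cancel. *)
Lemma symmetric_difference (F F' F'' : R -> R[i]) (del K : R) : 0 <= K ->
  (forall t, `|t| <= del -> cder F t (F' t)) ->
  (forall t, `|t| <= del -> cder F' t (F'' t)) ->
  (forall t, `|t| <= del -> cmod (F'' t) <= K) ->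
  forall t, `|t| <= del -> cmod (F t + F (- t) - 2 * F 0) <= 8 * K * t ^+ 2.
Proof.
move=> K0 d1 d2 b.
have opp (G G' : R -> R[i]) : (forall t, `|t| <= del -> cder G t (G' t)) ->
    forall t, `|t| <= del -> cder (fun t => G (- t)) t (- G' (- t)).
  move=> dG t td.
  have du : is_derive t 1 (fun t : R => - t) (-1).
    by apply: is_derive_ext (is_deriveN (is_derive_id t 1)) _ _.
  have dGt : cder G (- t) (G' (- t)) by apply: dG; rewrite normrN.
  by apply: (cder_ext (cder_comp du dGt)) => //; rewrite rmorphN rmorph1 mulN1r.
have h1 t : `|t| <= del -> cmod (F' t - F' (- t)) <= 2 * (2 * K) * `|t| ^+ 1.
  apply: (@cder_vanish R (fun t => F' t - F' (- t)) (fun t => F'' t + F'' (- t)) (2 * K) del 0).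
  - by rewrite mulr_ge0.
  - move=> u ud; apply: (cder_ext (cderB (d2 _ ud) (opp _ _ d2 _ ud))) => //.
    by rewrite opprK.
  - by rewrite oppr0 subrr.
  - move=> u ud; rewrite expr0 mulr1; apply: (le_trans (cmodD _ _)).
    have := b _ ud; have := b (- u); rewrite normrN => /(_ ud); clear; lra.
move=> t td.
have -> : 8 * K * t ^+ 2 = 2 * (2 * (2 * K)) * `|t| ^+ 2 by rewrite real_normK ?num_real//; ring.
apply: (@cder_vanish R (fun t => F t + F (- t) - 2 * F 0)
  (fun t => F' t - F' (- t)) (2 * (2 * K)) del 1) => //.
- by rewrite !mulr_ge0.
- move=> u ud; apply: (cder_ext (cderB (cderD (d1 _ ud) (opp _ _ d1 _ ud)) (cder_cst u (2 * F 0)))) => //.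
  by rewrite subr0.
- by rewrite oppr0; ring.
Qed.

Lemma compact_box (d q0 : R) :
  compact (`[- d, d]%classic `*` `[q0 - d, q0 + d]%classic : set (R * R)).
Proof. by apply: compact_setX; exact: segment_compact. Qed.

Lemma in_box (d q0 s q : R) : `|s| <= d -> `|q - q0| <= d ->
  (`[- d, d]%classic `*` `[q0 - d, q0 + d]%classic) (s, q).
Proof.
move=> sd qd; split=> /=; rewrite in_itv /=.
  by rewrite -ler_norml.
by move: qd; rewrite ler_norml lerBlDr lerBrDr => /andP[h1 h2]; rewrite lerBlDr [_ + d]addrC; apply/andP; split; clear -h1 h2; lra.
Qed.

End LocalBox.

Section LocalEstimates.
Context {R : realType}.
Variable j : {linear (R * R)%type -> (R * R)%type}.
Hypothesis hj : compatible_structure j.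
Variable delta : lmodType R[i].
Variable h : half_form j delta.
Variable tau : R[i].
Hypothesis htau : lam R = complex.Re tau *: mu R + complex.Im tau *: j (mu R).
Variables Om Ol : delta.
Hypothesis hOm : phi h Om Om (mu R) = 1.
Local Notation co := (coord hOm).

Definition level_scale (k : nat) : R := (k%:R / (2 * pi)) `^ 4^-1.

Lemma level_scale_gt0 k : (0 < k)%N -> 0 < level_scale k.
Proof.
move=> k0; apply: powR_gt0.
by rewrite divr_gt0 ?ltr0n// mulr_gt0// pi_gt0.
Qed.

Lemma level_scale_ge1 k : (0 < k)%N -> level_scale 1 <= level_scale k.
Proof.
move=> k0; have p0 := pi_gt0 R.
rewrite /level_scale ge0_ler_powR ?nnegrE ?invr_ge0//.
- by rewrite divr_ge0// mulr_ge0// ltW.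
- by rewrite divr_ge0// mulr_ge0// ltW.
- by rewrite ler_wpM2r ?ler1n// invr_ge0 mulr_ge0// ltW.
Qed.

(** The microsupport is an intersection of closed sets with rapid decay
    outside, so a point off it is off one of them. *)
Lemma off_microsupport (Z : nat -> R * R -> delta) x : ~ microsupport h Z x ->
  exists U (C : nat -> R), [/\ nbhs x U, forall M, 0 < C M &
    forall (k M : nat) y, (0 < k)%N -> U y -> hnorm h (Z k y) <= C M * k%:R ^- M].
Proof.
move=> nx; have [F [[cF rF] _] nF] : exists2 F,
    (closed F /\ rapidly_small h Z (~` F)) /\ set0 `<=` F & ~ F x.
  apply: contrapT => H; apply: nx => F FH; apply: contrapT => nF.
  by apply: H; exists F.
exact: rF.
Qed.

(** Off the microsupport the decay is locally uniform, and the points at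
    distance between [del] and 1/2 from the line form a compact set. *)
Lemma far_small (Z : nat -> R * R -> delta) (del q0 r : R) : 0 < del ->
  (forall s q, del <= `|s| <= 2^-1 -> `|q - q0| <= r -> ~ microsupport h Z (s, q)) ->
  exists C : R, forall s q, del <= `|s| <= 2^-1 -> `|q - q0| <= r ->
    forall k, (0 < k)%N -> cmod (co (Z k (s, q))) <= C / k%:R ^+ 2.
Proof.
move=> d0 off.
pose B : set (R * R) := (`[- 2^-1, - del]%classic `|` `[del, 2^-1]%classic) `*`
  `[q0 - r, q0 + r]%classic.
have cB : compact B.
  by apply: compact_setX; [apply: compactU|]; exact: segment_compact.
have BP s q : del <= `|s| <= 2^-1 -> `|q - q0| <= r -> B (s, q).
  move=> /andP[s1 s2] qr; split=> /=; last first.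
    move: qr; rewrite in_itv /= ler_norml => /andP[h1 h2].
    by apply/andP; split; lra.
  have [s0|s0] := leP 0 s.
    by right; rewrite /= in_itv /=; rewrite ger0_norm// in s1 s2; rewrite s1.
  left; rewrite /= in_itv /=; rewrite ltr0_norm// in s1 s2.
  by apply/andP; split; lra.
have offB x : B x -> del <= `|x.1| -> ~ microsupport h Z x.
  case: x => s q [/= sB qB] ds; apply: off.
    rewrite ds /=; move: sB; rewrite ler_norml !in_itv /= => sB.
    have [s0|s0] := leP 0 s.
      rewrite ger0_norm// in ds.
      case: sB => /andP[h1 h2]; apply/andP; split; lra.
    rewrite ltr0_norm// in ds.
    case: sB => /andP[h1 h2]; apply/andP; split; lra.
  move: qB; rewrite in_itv /= ler_norml => /andP[h1 h2].
  by apply/andP; split; lra.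
have hO := hnorm_Om_gt0 hj htau hOm.
have [|C HC] := @compact_uniform R _ B
  (fun x C => del <= `|x.1| -> forall k, (0 < k)%N ->
     cmod (co (Z k x)) <= C / k%:R ^+ 2) cB; last first.
  by exists C => s q sd qr k k0; case/andP: (sd) => s1 _; exact: (HC _ (BP _ _ sd qr) s1 k k0).
move=> x Bx; have [dx|dx] := leP del `|x.1|; last first.
  exists 0; near=> y => C' _ dy.
  suff : `|y.1| < del by rewrite ltNge dy.
  near: y; apply: (@cvgr_norm_lt _ _ _ _ _ fst x.1) => //; exact: cvg_fst.
have [U [C [nU C0 HU]]] := off_microsupport (offB _ Bx dx).
exists (C 2 / hnorm h Om); apply: filterS nU => y Uy C' CC' _ k k0.
have := HU k 2 y k0 Uy; rewrite (hnorm_coord hOm).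
rewrite -ler_pdivlMr// => /le_trans; apply.
by rewrite mulrAC ler_wpM2r// invr_ge0 sqr_ge0.
Unshelve. all: by end_near.
Qed.

(** The local description is made quantitative on one square around the point,
    where all the bounds needed for summation hold at once; two orders of the
    rapid decay are enough. *)
Lemma local_box (Z : nat -> R * R -> delta) (V : set (R * R)) (om : R[i])
    (t : R * R -> R[i]) (f fcoef : nat -> R * R -> R[i]) (q0 : R) :
  open V -> V (0, q0) -> smooth_on V (fcoef 0%N) -> smooth_expansion V f fcoef ->
  rapidly_small h (fun k x => Z k x -
    (om * (level_scale k)%:C * t x ^+ k * f k x) *: Ol) V ->
  exists r C : R, [/\ 0 < r, 0 <= C & forall s q, `|s| <= r -> `|q - q0| <= r ->
    [/\ V (s, q), cmod (fcoef 0%N (s, q)) <= C,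
      cmod (fcoef 0%N (s, q) + fcoef 0%N (- s, q) - 2 * fcoef 0%N (0, q)) <= C * s ^+ 2 &
      forall k, (0 < k)%N ->
        cmod (co (Z k (s, q)) -
          om * (level_scale k)%:C * t (s, q) ^+ k * f k (s, q) * co Ol) <= C / k%:R ^+ 2 /\
        cmod (f k (s, q) - fcoef 0%N (s, q)) <= C / k%:R]].
Proof.
move=> oV Vq sf sexp rs.
have hO := hnorm_Om_gt0 hj htau hOm.
have [U [C0 [nU C00 HU]]] := rs _ Vq.
have nV : nbhs ((0, q0) : R * R) V by apply: open_nbhs_nbhs; split.
have [r r0 Hr] := near_box (filterI nU nV).
have Hr' s q : `|s| <= r -> `|q - q0| <= r -> (U `&` V) (s, q).
  by move=> sr qr; apply: Hr => //=; rewrite subr0.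
pose B : set (R * R) := `[- r, r]%classic `*` `[q0 - r, q0 + r]%classic.
have cB : compact B by exact: compact_box.
have BV : B `<=` V.
  case=> s q [/= sB qB]; apply: (proj2 (Hr' s q _ _)).
    by move: sB; rewrite in_itv /= ler_norml.
  move: qB; rewrite in_itv /= ler_norml => /andP[h1 h2].
  by apply/andP; split; lra.
have [C1 H1] := smooth_bounded sf cB BV.
have sf1 := smooth_cderive (mu R) sf; have sf2 := smooth_cderive (mu R) sf1.
have [C2 H2] := smooth_bounded sf2 cB BV.
have [C3 H3] := sexp 1%N [::] B cB BV.
have C20 : 0 <= C2.
  by apply: le_trans (cmod_ge0 _) (H2 (0, q0) _); apply: in_box; rewrite ?normr0 ?subrr ?normr0 ltW.
have C10 : 0 <= C1.
  by apply: le_trans (cmod_ge0 _) (H1 (0, q0) _); apply: in_box; rewrite ?normr0 ?subrr ?normr0 ltW.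
pose D := C1 + 8 * C2 + `|C3| + C0 2%N / hnorm h Om.
have D0 : 0 <= C0 2%N / hnorm h Om by rewrite divr_ge0// ltW.
have n3 := normr_ge0 C3.
exists r, D; split=> // [|s q sr qr]; first by rewrite /D; lra.
have [Us Vs] := Hr' s q sr qr; have Bs : B (s, q) := in_box sr qr.
split=> //.
- by apply: le_trans (H1 _ Bs) _; rewrite /D; lra.
- have sd := @symmetric_difference R (fun s => fcoef 0%N (s, q))
    (fun s => cderive (mu R) (fcoef 0%N) (s, q))
    (fun s => cderive (mu R) (cderive (mu R) (fcoef 0%N)) (s, q)) r C2 C20 _ _ _ s sr.
  apply: le_trans (sd _ _ _) _.
  + by move=> u ur; apply: smooth_cder1 sf _; apply: (proj2 (Hr' u q ur qr)).
  + by move=> u ur; apply: smooth_cder1 sf1 _; apply: (proj2 (Hr' u q ur qr)).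
  + by move=> u ur; apply: H2; exact: in_box.
  + by rewrite ler_wpM2r ?sqr_ge0// /D; lra.
- move=> k k0; have kR0 : 0 < k%:R :> R by rewrite ltr0n.
  split.
    have := HU k 2 (s, q) k0 Us; rewrite (hnorm_coord hOm).
    rewrite -scaleNr coordD coordZ mulNr -ler_pdivlMr// => /le_trans; apply.
    by rewrite mulrAC ler_wpM2r ?invr_ge0 ?sqr_ge0// /D; lra.
  have := H3 k (s, q) k0 Bs; rewrite /= big_ord_recl big_ord0 addr0 /= expr0 invr1 mul1r expr1.
  rewrite normE lecR => /le_trans; apply.
  rewrite ler_wpM2r ?invr_ge0 ?(ltW kR0)//.
  by apply: (le_trans (ler_norm _)); rewrite /D; lra.
Qed.

End LocalEstimates.

Section SummandBounds.
Context {R : realType}.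
Implicit Types x y z u v : R.

Lemma summand_le3 x y z : 0 <= x -> 0 <= y -> 0 <= z ->
  [/\ x <= x + y + z, y <= x + y + z & z <= x + y + z].
Proof. by move=> *; split; lra. Qed.

Lemma summand_le4 x y z u : 0 <= x -> 0 <= y -> 0 <= z -> 0 <= u ->
  [/\ x <= x + y + z + u, y <= x + y + z + u, z <= x + y + z + u &
     u <= x + y + z + u].
Proof. by move=> *; split; lra. Qed.

Lemma summand_le5 x y z u v : 0 <= x -> 0 <= y -> 0 <= z -> 0 <= u -> 0 <= v ->
  [/\ x <= x + y + z + u + v, y <= x + y + z + u + v, z <= x + y + z + u + v,
     u <= x + y + z + u + v & v <= x + y + z + u + v].
Proof. by move=> *; split; lra. Qed.

End SummandBounds.

Section LocalCoefficient.
Context {R : realType}.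
Variable j : {linear (R * R)%type -> (R * R)%type}.
Hypothesis hj : compatible_structure j.
Variable delta : lmodType R[i].
Variable h : half_form j delta.
Variable tau : R[i].
Hypothesis htau : lam R = complex.Re tau *: mu R + complex.Im tau *: j (mu R).
Variables Om Ol : delta.
Hypothesis hOm : phi h Om Om (mu R) = 1.
Variable t : R * R -> R[i].
Hypothesis holo_t : holo_on j 1 setT t.
Hypothesis t_lam1 : forall q : R, t (q *: lam R) = 1.
Variable Psi : forall k : nat, 'Z_(2 * k) -> R * R -> delta.
Hypothesis hPsi : forall k : nat, (0 < k)%N -> theta_basis h tau Om (@Psi k).
Variable c : forall k : nat, 'Z_(2 * k) -> R[i].
Variable Z : nat -> R * R -> delta.
Hypothesis hZ : forall k : nat, (0 < k)%N -> Z k = fun x => \sum_m @c k m *: @Psi k m x.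
Local Notation co := (coord hOm).
Local Notation ka := (co Ol).

Lemma cmod_phase (x y : R) : cmod (cexp (twopii * x%:C * y%:C)) = 1.
Proof. by rewrite cmod_cexp !Re_mulr Re_twopii !mul0r expR0. Qed.

(** On the segment used by the extraction, the character cancels the
    oscillation of the flat model and leaves a pure Gaussian. *)
Lemma phase_flat_model k (a q : R) : (0 < k)%N ->
  cexp (twopii * (a / 2)%:C * q%:C) * flat_model tau (a / (2 * k%:R)) q ^+ k =
  gE (decay tau / (4 * k%:R)) a.
Proof.
move=> k0; rewrite /flat_model -cexpMn -cexpD /gE; congr cexp.
have kC : k%:R != 0 :> R[i] by rewrite pnatr_eq0 -lt0n.
rewrite !(rmorphM (real_complex R)) !fmorphV !(rmorphM (real_complex R)).
rewrite !(rmorph_nat (real_complex R)).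
move: twopii (decay tau) => A D.
by field.
Qed.

(** The segment at height q = - l / 2k carries the l-th coefficient. Near the
    line the state is a slowly varying amplitude times a Gaussian of width
    k^(-1/2); away from it the state is negligible. The sum is thus the
    amplitude on the line times a Gaussian sum. *)
Lemma local_coefficient (V : set (R * R)) (om : R[i])
    (f fcoef : nat -> R * R -> R[i]) (q0 r1 : R) (F : R -> R[i]) (nu : R[i]) (Cg : R) :
  cmod om = 1 -> open V -> V (0, q0) -> smooth_on V (fcoef 0%N) ->
  smooth_expansion V f fcoef ->
  rapidly_small h (fun k x => Z k x -
    (om * (level_scale k)%:C * t x ^+ k * f k x) *: Ol) V ->
  (forall q, V (0, q) -> fcoef 0%N (0, q) = F q) -> 0 < r1 ->
  (forall s q, 0 < `|s| <= 2^-1 -> `|q - q0| <= r1 -> ~ microsupport h Z (s, q)) ->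
  (forall k : nat, (0 < k)%N -> cmod (decay tau) <= 4 * k%:R ->
    cmod (gauss_sum k (decay tau / (4 * k%:R)) - nu * (Num.sqrt k%:R)%:C) <=
    Cg / Num.sqrt k%:R) ->
  exists r C : R, 0 < r /\ forall (k : nat) (l : int), (0 < k)%N -> C <= k%:R ->
    `|- l%:~R / (2 * k%:R) - q0| <= r ->
    cmod (@c k l%:~R - om * ka * F (- l%:~R / (2 * k%:R)) * nu /
      (2 * (Num.sqrt k%:R)%:C)) <= C / (k%:R * Num.sqrt k%:R).
Proof.
move=> om1 oV Vq sf sexp rs hF r10 off hg.
have [r2 [C2 [r20 C20 HB]]] := local_box hj htau hOm oV Vq sf sexp rs.
have Q0 : 0 <= `|q0| + 1 by rewrite addr_ge0.
have [del1 [D [del10 _ D0 HT]]] := flat_section_power hj htau holo_t t_lam1 Q0.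
pose del := Num.min del1 (Num.min r2 4^-1).
have del0 : 0 < del by rewrite !lt_min del10 r20 invr_gt0 ltr0n.
have del_1 : del <= del1 by rewrite ge_min lexx.
have del_2 : del <= r2 by rewrite !ge_min lexx orbT.
have del_3 : del < 2^-1.
  apply: (@le_lt_trans _ _ 4^-1); first by rewrite !ge_min lexx !orbT.
  by rewrite ltf_pV2 ?posrE// ltr_nat.
pose r := Num.min r1 (Num.min r2 1).
have rr0 : 0 < r by rewrite !lt_min r10 r20 ltr01.
have r_1 : r <= r1 by rewrite ge_min lexx.
have r_2 : r <= r2 by rewrite !ge_min lexx orbT.
have r_3 : r <= 1 by rewrite !ge_min lexx !orbT.
have [|C3 H3] := @far_small R j hj delta h tau htau Om hOm Z del q0 r del0.
  move=> s q /andP[s1 s2] qr; apply: off; last exact: le_trans qr r_1.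
  by rewrite s2 (lt_le_trans del0).
have n10 := level_scale_gt0 (R := R) (ltn0Sn 0); set n1 := level_scale 1 in n10.
have ka0 := cmod_ge0 ka.
pose K := C2 / n1 + cmod ka * (C2 + C2 * D) + `|C3| / n1 + C2 + cmod ka.
have K1 : 0 <= C2 / n1 by rewrite divr_ge0// ltW.
have K2 : 0 <= cmod ka * (C2 + C2 * D) by rewrite mulr_ge0// addr_ge0// mulr_ge0.
have K3 : 0 <= `|C3| / n1 by rewrite divr_ge0// ltW.
have K0 : 0 <= K by rewrite /K !addr_ge0.
have [Kb1 Kb2 Kb3 Kb4 Kb5] := summand_le5 K1 K2 K3 C20 ka0.
rewrite -/K in Kb1 Kb2 Kb3 Kb4 Kb5.
have r0 := Re_decay_gt0 hj htau.
have [C4 H4] := segment_sum r0 del0 del_3 K0.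
have [C5 H5] := theta_sum_near_one (Im_tau_gt0 hj htau).
pose CC := `|C4| + `|C5| + `|Cg| + cmod ka * C2.
have CC0 : 0 <= CC by rewrite /CC !addr_ge0// mulr_ge0.
have pk : 0 <= cmod ka * C2 by rewrite mulr_ge0.
have [CC1 CC2 CC3 CC4] :=
  summand_le4 (normr_ge0 C4) (normr_ge0 C5) (normr_ge0 Cg) pk.
rewrite -/CC in CC1 CC2 CC3 CC4.
have [C6 H6] := coefficient_from_sum CC0 (cmod_ge0 nu).
pose CF := `|C6| + 2 * CC + cmod (decay tau).
have CC20 : 0 <= 2 * CC by rewrite mulr_ge0.
have [/(le_trans (ler_norm _)) C6le CFle CFd] :=
  summand_le3 (normr_ge0 C6) CC20 (cmod_ge0 (decay tau)).
rewrite -/CF in C6le CFle CFd.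
exists r, CF; split=> // k l k0 kC ql.
have kR0 : 0 < k%:R :> R by rewrite ltr0n.
have kn0 : k%:R != 0 :> R by rewrite gt_eqF.
have sk0 : 0 < Num.sqrt k%:R :> R by rewrite sqrtr_gt0.
have kCC : 2 * CC <= k%:R := le_trans CFle kC.
have kd : cmod (decay tau) <= 4 * k%:R.
  by apply: (le_trans CFd); apply: (le_trans kC); rewrite ler_peMl ?ler1n// ltW.
have {}hg := hg k k0 kd.
have [_ _ _ _ Psi00] := hPsi k0.
set q := - l%:~R / (2 * k%:R) in ql *.
pose G (a : int) := cexp (twopii * (a%:~R / 2)%:C * q%:C) * co (Z k (a%:~R / (2 * k%:R), q)).
have ext : \sum_(b < 2 * k) G (b%:Z - k%:Z) =
    (2 * k)%:R * (@c k l%:~R * co (@Psi k 0 0)).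
  by rewrite /G (hZ k0); exact: (extraction hOm k0 (hPsi k0)).
rewrite Psi00 coordZ (coord_unique hOm (esym (scale1r Om))) mulr1 in ext.
rewrite -/(level_scale k) in ext.
have := H5 k tau k0 erefl; move: ext; move: (sumZ _) => th ext hth.
have N0 := level_scale_gt0 (R := R) k0; have Nn := level_scale_ge1 (R := R) k0.
set N := level_scale k in ext N0 Nn; rewrite -/n1 in Nn.
have qQ : `|q| <= `|q0| + 1.
  by rewrite -[q](subrK q0) (le_trans (ler_normD _ _))// addrC lerD2l (le_trans ql).
have q_2 : `|q - q0| <= r2 := le_trans ql r_2.
pose w := om * N%:C * ka.
have wE : cmod w = N * cmod ka.
  by rewrite /w (cmodM (om * N%:C)) (cmodM om) om1 mul1r cmodR ger0_norm// ltW.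
have [V0 b0 _ _] := HB 0 q (eq_ind_r (fun x => x <= r2) (ltW r20) (normr0 _)) q_2.
have kN (x : R) : 0 <= x -> x / k%:R ^+ 2 <= N * (x / n1 / k%:R ^+ 2).
  move=> x0; have -> : N * (x / n1 / k%:R ^+ 2) = (N / n1) * (x / k%:R ^+ 2) by ring.
  rewrite -[leLHS]mul1r ler_wpM2r// ?divr_ge0 ?sqr_ge0//.
  by rewrite ler_pdivlMr// mul1r.
have NK (x : R) : x <= K -> N * (x / k%:R ^+ 2) <= N * (K / k%:R ^+ 2).
  by move=> xK; rewrite ler_wpM2l ?(ltW N0)// ler_wpM2r ?invr_ge0 ?sqr_ge0.
have main := H4 k N G w (fun s => fcoef 0%N (s, q)) k0 (ltW N0) _ _ _ _ _.
have {}main : cmod (\sum_(b < 2 * k) G (b%:Z - k%:Z) -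
    w * fcoef 0%N (0, q) * gauss_sum k (decay tau / (4 * k%:R))) <=
    N * (C4 / Num.sqrt k%:R).
  apply: main.
  - by rewrite wE mulrC ler_wpM2r ?(ltW N0).
  - move=> a; set s := a%:~R / (2 * k%:R) => sd.
    have [Vs fb _ /(_ k k0) [zb fk]] := HB s q (le_trans sd del_2) q_2.
    have [tf tb] := HT k s q k0 (le_trans sd del_1) qQ.
    have ph1 := cmod_phase (a%:~R / 2) q.
    have pf := phase_flat_model a%:~R q k0; rewrite -/s in pf.
    rewrite /G -/s -pf; set ph := cexp _ in ph1 pf *.
    set T := t (s, q) ^+ k in zb tf tb *; set FM := flat_model tau s q ^+ k in tf *.
    set f0 := fcoef 0%N (s, q) in fb fk *.
    have -> : ph * co (Z k (s, q)) - w * (ph * FM) * f0 =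
       ph * (co (Z k (s, q)) - om * N%:C * T * f k (s, q) * ka) +
       (w * (ph * T * (f k (s, q) - f0)) + w * (f0 * (ph * (T - FM)))).
      by rewrite /w; ring.
    have e4 : complex.Re (decay tau) / (16 * k%:R) * a%:~R ^+ 2 =
        complex.Re (decay tau) / 4 * k%:R * s ^+ 2 by rewrite /s; field.
    rewrite e4; set E := expR _ in tf *.
    have E0 : 0 <= E := expR_ge0 _.
    have tE : cmod T <= E.
      apply: (le_trans tb); rewrite ler_expR lerN2 -!mulrA.
      apply: ler_wpM2l; first exact: ltW.
      rewrite ler_wpM2r ?lef_pV2 ?posrE ?ler_nat//.
      by rewrite mulr_ge0 ?sqr_ge0// ltW.
    apply: (le_trans (cmodD _ _)); rewrite addrC; apply: lerD; last first.
      rewrite (cmodM ph) ph1 mul1r; apply: (le_trans zb).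
      by apply: (le_trans (kN _ C20)); exact: NK.
    apply: (le_trans (cmodD _ _)); rewrite (cmodM w) (cmodM w) wE -mulrDr.
    rewrite (cmodM (ph * T)) (cmodM ph) (cmodM f0) (cmodM ph) ph1 !mul1r.
    have b1 : cmod T * cmod (f k (s, q) - f0) <= E * (C2 / k%:R).
      by apply: ler_pM; rewrite ?cmod_ge0.
    have b2 : cmod f0 * cmod (T - FM) <= C2 * (D / k%:R * E).
      by apply: ler_pM; rewrite ?cmod_ge0.
    apply: (@le_trans _ _ (N * cmod ka * (E * (C2 / k%:R) + C2 * (D / k%:R * E)))).
      by rewrite ler_wpM2l ?mulr_ge0 ?(ltW N0)//; exact: lerD.
    have -> : N * cmod ka * (E * (C2 / k%:R) + C2 * (D / k%:R * E)) =
      N * (cmod ka * (C2 + C2 * D) / k%:R) * E by ring.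
    by rewrite ler_wpM2r// ler_wpM2l ?(ltW N0)// ler_wpM2r ?invr_ge0 ?(ltW kR0).
  - move=> a /andP[s1 s2]; rewrite /G (cmodM (cexp _)) cmod_phase mul1r.
    apply: (@le_trans _ _ (`|C3| / k%:R ^+ 2)).
      have s12 : del <= `|a%:~R / (2 * k%:R) : R| <= 2^-1 by rewrite (ltW s1).
      apply: (le_trans (H3 _ _ s12 ql k k0)).
      by rewrite ler_wpM2r ?invr_ge0 ?sqr_ge0// ler_norm.
    by apply: (le_trans (kN _ (normr_ge0 _))); exact: NK.
  - move=> s sd; have [_ _ sym _] := HB s q (le_trans sd del_2) q_2.
    by apply: (le_trans sym); rewrite ler_wpM2r ?sqr_ge0.
  - exact: le_trans b0 Kb4.
have div (x : R) (n : R) : 0 <= n -> `|x| <= CC -> x / n <= CC / n.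
  by move=> n0 xC; rewrite ler_wpM2r ?invr_ge0// (le_trans (ler_norm _)).
have res := H6 k (@c k l%:~R) th (gauss_sum k (decay tau / (4 * k%:R))) nu
  (om * ka * fcoef 0%N (0, q)) k0 kCC (lexx _) _ _ _ _.
rewrite -hF//; apply: (le_trans (res _ _ _ _)).
- rewrite (cmodM (om * ka)) (cmodM om) om1 mul1r.
  by apply: le_trans CC4; rewrite ler_wpM2l.
- by apply: (le_trans hth); apply: div => //; exact: ltW.
- by apply: (le_trans hg); apply: div => //; exact: ltW.
- rewrite -(ler_pM2l N0).
  have -> : N * cmod ((2 * k)%:R * @c k l%:~R * th - om * ka * fcoef 0%N (0, q) *
      gauss_sum k (decay tau / (4 * k%:R))) =
    cmod (\sum_(b < 2 * k) G (b%:Z - k%:Z) -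
      w * fcoef 0%N (0, q) * gauss_sum k (decay tau / (4 * k%:R))).
    rewrite -{1}(ger0_norm (ltW N0)) -cmodR -(cmodM N%:C) ext /w.
    by congr cmod; ring.
  apply: (le_trans main); rewrite ler_wpM2l ?(ltW N0)//.
  by apply: div => //; exact: ltW.
- apply: ler_wpM2r; first by rewrite invr_ge0; apply: mulr_ge0; exact: ltW.
  exact: C6le.
Qed.

End LocalCoefficient.

(** * The phase does not depend on the point *)

Section LocallyConstant.
Context {R : realType}.

Lemma locally_constant (T : Type) (g : R -> T) (a b : R) :
  (forall x, a < x < b -> exists2 r : R, 0 < r &
     forall y, a < y < b -> `|y - x| <= r -> g y = g x) ->
  forall x y, a < x < b -> a < y < b -> g x = g y.
Proof.
move=> H x y xab yab.
pose A : set R := [set` `]a, b[%R].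
have inA z : A z = (a < z < b) :> Prop by rewrite /A /= in_itv.
have lc (Q : T -> Prop) : open [set z | A z /\ Q (g z)].
  rewrite openE => z [Az Qz]; have zab : a < z < b by rewrite -inA.
  have [r r0 Hr] := H z zab.
  have : nbhs z A by apply: open_nbhs_nbhs; split => //; exact: interval_open.
  have nr : nbhs z (ball z r) by exact: nbhsx_ballx.
  move=> nA; apply: filterS2 nr nA => w wr Aw; split=> //.
  by rewrite Hr -?inA// distrC ltW.
have cA : connected A by apply/connected_intervalP; exact: interval_is_interval.
have Ay : A y by rewrite inA.
have -> // : g x = g y.
suff E : [set z | A z /\ g z = g y] = A.
  have : A x by rewrite inA.
  by rewrite -E => -[].
apply: cA.
- by exists y; split.
- exists [set z | A z /\ g z = g y]; first exact: (lc (fun u => u = g y)).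
  by apply/seteqP; split => z /=; [move=> [? ?]|move=> [? []]].
- exists (~` [set z | A z /\ g z <> g y]).
    by rewrite closedC; exact: (lc (fun u => u <> g y)).
  apply/seteqP; split => z /=; first by move=> [Az gz]; split => // -[].
  by move=> [Az nz]; split=> //; apply: contrapT => gz; apply: nz.
Qed.

End LocallyConstant.

Section ConstantPhase.
Context {R : realType}.
Variables (z : nat -> R -> R[i]) (F : R -> R[i]) (ka : R[i]) (a b : R).

(** The error is measured relatively to the growth k^(1/4) of the leading
    term, so that the phase can be read off where [F] does not vanish. *)
Definition has_phase (q : R) (om : R[i]) : Prop :=
  exists C : R, forall k, (0 < k)%N ->
    cmod (z k q - om * (level_scale k)%:C * ka * F q) <= C * (level_scale k / k%:R).

Lemma has_phase_unique q om1 om2 : ka != 0 -> F q != 0 ->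
  has_phase q om1 -> has_phase q om2 -> om1 = om2.
Proof.
move=> ka0 Fq [C1 H1] [C2 H2].
have bound k : (0 < k)%N -> cmod (om1 - om2) * cmod (ka * F q) * k%:R <= C1 + C2.
  move=> k0; have N0 := level_scale_gt0 (R := R) k0.
  have kR0 : 0 < k%:R :> R by rewrite ltr0n.
  rewrite -(ler_pM2r (divr_gt0 N0 kR0)).
  have -> : cmod (om1 - om2) * cmod (ka * F q) * k%:R * (level_scale k / k%:R) =
      level_scale k * (cmod (om1 - om2) * cmod (ka * F q)).
    by field; rewrite gt_eqF.
  rewrite -{1}(ger0_norm (ltW N0)) -cmodR -!cmodM.
  have -> : (level_scale k)%:C * ((om1 - om2) * (ka * F q)) =
    (z k q - om2 * (level_scale k)%:C * ka * F q) -
    (z k q - om1 * (level_scale k)%:C * ka * F q) by ring.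
  apply: (le_trans (cmodB _ _)); rewrite mulrDl addrC.
  by apply: lerD; [exact: H1|exact: H2].
apply/eqP; rewrite -subr_eq0 -cmod_eq0; apply: contraT => d0.
have D0 : 0 < cmod (om1 - om2) * cmod (ka * F q).
  by apply: mulr_gt0; rewrite cmod_gt0; [rewrite -cmod_eq0|exact: mulf_neq0].
have := bound (Num.trunc (`|C1 + C2| / (cmod (om1 - om2) * cmod (ka * F q)))).+1 isT.
rewrite leNgt => /negP []; rewrite mulrC -ltr_pdivrMr//.
apply: le_lt_trans (truncnS_gt _).
by rewrite ler_wpM2r ?invr_ge0 ?(ltW D0)// ler_norm.
Qed.

(** Two overlapping local descriptions have the same phase, since the
    amplitude vanishes at half-integers only and these are isolated. *)
Lemma constant_phase (om : R -> R[i]) : ka != 0 ->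
  (forall q, a < q < b -> (forall n : int, 2 * q != n%:~R) -> F q != 0) ->
  (forall q, a < q < b -> exists2 r : R, 0 < r &
     forall q', `|q' - q| <= r -> has_phase q' (om q)) ->
  forall x y, a < x < b -> a < y < b -> om x = om y.
Proof.
move=> ka0 F0 H; apply: locally_constant => x xab.
have [r r0 Hr] := H x xab; exists (r / 2); first by rewrite divr_gt0.
move=> y yab yx; have [r' r'0 Hr'] := H y yab.
have [ya yb] := andP yab.
(* So small that y + e is not a half-integer when y is one. *)
pose e := Num.min (Num.min r' (r / 2)) (Num.min ((b - y) / 2) 4^-1).
have e0 : 0 < e.
  by rewrite !lt_min r'0 !divr_gt0// ?subr_gt0// invr_gt0 ltr0n.
have e1 : e <= r' by rewrite !ge_min lexx.
have e2 : e <= r / 2 by rewrite !ge_min lexx orbT.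
have e3 : e <= (b - y) / 2 by rewrite !ge_min lexx !orbT.
have e4 : e <= 4^-1 by rewrite !ge_min lexx !orbT.
have conclude w : a < w < b -> (forall n : int, 2 * w != n%:~R) -> `|w - y| <= e ->
    om y = om x.
  move=> wab wn wy; apply: (has_phase_unique ka0 (F0 w wab wn)).
    by apply: Hr'; exact: le_trans e1.
  apply: Hr; rewrite -(subrK y w) -addrA (le_trans (ler_normD _ _))//.
  rewrite [leRHS](splitr r); apply: lerD => //; exact: le_trans wy e2.
have [yn|/existsNP[n /negP]] := pselect (forall n : int, 2 * y != n%:~R).
  by apply: (conclude y) => //; rewrite subrr normr0 ltW.
rewrite negbK => /eqP yn; apply: (conclude (y + e)).
- by apply/andP; split; lra.
- move=> m; apply/eqP => ym.
  have E : 2 * e = (m - n)%:~R by rewrite rmorphB /= -yn -ym; ring.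
  have : (m - n < 1)%R by rewrite -(ltrz1 R) -E; lra.
  have : (0 < m - n)%R by rewrite -(ltr0z R) -E mulr_gt0.
  by rewrite gtz0_ge1 leNgt => /negP.
- by rewrite addrC addKr ger0_norm// ltW.
Qed.

End ConstantPhase.

(** * The constants of the leading term *)

Section LocalPhase.
Context {R : realType}.
Variable j : {linear (R * R)%type -> (R * R)%type}.
Hypothesis hj : compatible_structure j.
Variable delta : lmodType R[i].
Variable h : half_form j delta.
Variable tau : R[i].
Hypothesis htau : lam R = complex.Re tau *: mu R + complex.Im tau *: j (mu R).
Variables Om Ol : delta.
Hypothesis hOm : phi h Om Om (mu R) = 1.
Variable t : R * R -> R[i].
Hypothesis t_lam1 : forall q : R, t (q *: lam R) = 1.
Variable Z : nat -> R * R -> delta.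
Local Notation co := (coord hOm).
Local Notation ka := (co Ol).

Lemma local_phase (V : set (R * R)) (om : R[i])
    (f fcoef : nat -> R * R -> R[i]) (q0 : R) (F : R -> R[i]) :
  cmod om = 1 -> open V -> V (0, q0) -> smooth_on V (fcoef 0%N) ->
  smooth_expansion V f fcoef ->
  rapidly_small h (fun k x => Z k x -
    (om * (level_scale k)%:C * t x ^+ k * f k x) *: Ol) V ->
  (forall q, V (0, q) -> fcoef 0%N (0, q) = F q) ->
  exists2 r : R, 0 < r & forall q, `|q - q0| <= r ->
    has_phase (fun k q => co (Z k (0, q))) F ka q om.
Proof.
move=> om1 oV Vq sf sexp rs hF.
have [r [C [r0 C0 HB]]] := local_box hj htau hOm oV Vq sf sexp rs.
have n10 := level_scale_gt0 (R := R) (ltn0Sn 0); set n1 := level_scale 1 in n10.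
exists r => // q qr; exists (C / n1 + cmod ka * C) => k k0.
have N0 := level_scale_gt0 (R := R) k0; have Nn := level_scale_ge1 (R := R) k0.
rewrite -/n1 in Nn; set N := level_scale k in N0 Nn *.
have kR0 : 0 < k%:R :> R by rewrite ltr0n.
have z_r : `|0 : R| <= r by rewrite normr0 ltW.
have [V0 _ _ /(_ k k0) [zb fk]] := HB 0 q z_r qr.
rewrite -/N -scale_lam t_lam1 expr1n mulr1 scale_lam in zb.
rewrite -hF//; set f0 := fcoef 0%N (0, q) in fk *.
have -> : co (Z k (0, q)) - om * N%:C * ka * f0 =
    (co (Z k (0, q)) - om * N%:C * f k (0, q) * ka) +
    om * (N%:C * (ka * (f k (0, q) - f0))) by ring.
apply: (le_trans (cmodD _ _)); rewrite mulrDl; apply: lerD.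
  apply: (le_trans zb).
  have -> : C / n1 * (N / k%:R) = (N / n1) * (C / k%:R) by ring.
  apply: (@le_trans _ _ (C / k%:R)).
    rewrite ler_wpM2l// lef_pV2 ?posrE ?exprn_gt0//.
    by rewrite expr2 ler_peMl ?ler1n// ltW.
  rewrite ler_peMl ?divr_ge0 ?(ltW kR0)//.
  by rewrite ler_pdivlMr// mul1r.
rewrite (cmodM om) om1 mul1r (cmodM N%:C) cmodR ger0_norm ?(ltW N0)// (cmodM ka).
have -> : cmod ka * C * (N / k%:R) = N * (cmod ka * (C / k%:R)) by ring.
by rewrite ler_wpM2l ?(ltW N0)// ler_wpM2l ?cmod_ge0.
Qed.

End LocalPhase.

Section LeadingTerm.
Context {R : realType}.

Lemma finitely_many_bounded (T : nat -> int -> R) (N L : nat) :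
  (forall k l, 0 <= T k l) ->
  exists C : R, forall k (l : int), (k < N)%N -> (`|l| <= L)%N -> T k l <= C.
Proof.
move=> T0; exists (\sum_(k < N) \sum_(b < (2 * L).+1) T k (b%:Z - L%:Z)).
move=> k l kN lL.
have bL : (`|(l + L%:Z)%R| < (2 * L).+1)%N by lia.
have lE : l = `|(l + L%:Z)%R|%N%:Z - L%:Z by lia.
rewrite (bigD1 (Ordinal kN)) //= (bigD1 (Ordinal bL)) //= -lE -addrA lerDl.
by rewrite addr_ge0// ?sumr_ge0// => i _; rewrite sumr_ge0.
Qed.

(** The symmetry of the Alexander polynomial makes the sign of the point on
    the line irrelevant in its evaluation. *)
Lemma laurent_eval_inv (P : {poly int}) d (z : R[i]) : z != 0 ->
  (size P <= (2 * d).+1)%N ->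
  (forall i : nat, (i <= 2 * d)%N -> P`_i = P`_(2 * d - i)) ->
  laurent_eval P d z^-1 = laurent_eval P d z.
Proof.
move=> z0 sP sym; rewrite /laurent_eval.
have E w : (map_poly intr P).[w] = \sum_(i < (2 * d).+1) (P`_i)%:~R * w ^+ i.
  rewrite (@horner_coef_wide _ (2 * d).+1); last first.
    by rewrite (leq_trans (size_poly _ _)).
  by apply: eq_bigr => i _; rewrite coef_map.
rewrite !E (reindex_inj rev_ord_inj) !mulr_suml; apply: eq_bigr => i _ /=.
have iD : (i <= 2 * d)%N by rewrite -ltnS.
rewrite subSS -sym// -!mulrA; congr (_ * _).
rewrite exprVn exprVn invrK -exprVn.
apply: (mulfI (expf_neq0 (2 * d - i) z0)); rewrite mulrA exprVn mulfV ?expf_neq0//.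
apply: (mulIf (expf_neq0 d z0)); rewrite mul1r -!mulrA mulVf ?expf_neq0// mulr1.
by rewrite -!exprD addnn -mul2n subnK.
Qed.

Lemma eighth_circ (m : int) : cexp ('i * m%:~R * pi%:C / 4) = circ (m%:~R / 8 : R).
Proof.
rewrite /circ; congr cexp.
rewrite (rmorphM (real_complex R)) fmorphV (rmorph_nat (real_complex R)).
rewrite (rmorph_int (real_complex R)).
have H (I p n : R[i]) : I * n * p / 4 = 2 * p * I * (n / 8) by field.
exact: H.
Qed.

(** The two square roots of - i are the eighth roots of unity of index - 1
    and 3. *)
Lemma eighth_root (u : R[i]) : u ^+ 2 = - 'i ->
  exists m : int, u = circ (m%:~R / 8).
Proof.
have c4 : circ (- (4^-1) : R) = - 'i.
  rewrite circE.
  have -> : 2 * pi * - 4^-1 = - (pi / 2) :> R by move: (pi : R) => p; field.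
  by rewrite cosN sinN cos_pihalf sin_pihalf; apply: eqCP; rewrite /= ?oppr0.
have c2 : circ (2^-1 : R) = -1.
  rewrite circE.
  have -> : 2 * pi * 2^-1 = pi :> R by move: (pi : R) => p; field.
  by rewrite cospi sinpi; apply: eqCP; rewrite /= ?oppr0.
have e2 : circ (- 8^-1 : R) ^+ 2 = - 'i.
  by rewrite expr2 -circD -c4; congr circ; field.
rewrite -e2 => /eqP; rewrite eqf_sqr => /orP[] /eqP ->.
  by exists (-1); congr circ; rewrite mulrNz mulr1z mulN1r.
exists 3; rewrite -mulN1r -c2 -circD; congr circ.
by rewrite -pmulrn; field.
Qed.

(** In the square, the change of half-form gives tau^(-1) and the Gaussian sum
    gives tau, so that the constant no longer depends on the complex structure. *)
Lemma amplitude_square (tau ka nu : R[i]) : tau != 0 -> ka ^+ 2 * tau = 1 ->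
  nu ^+ 2 = 4 * pi%:C / decay tau ->
  (- (ka * nu * (Num.sqrt 2)^-1%:C)) ^+ 2 = - 'i.
Proof.
move=> t0 kt n2.
have s2 : (Num.sqrt 2)^-1%:C ^+ 2 = 2^-1 :> R[i].
  by rewrite -rmorphXn /= exprVn sqr_sqrtr// fmorphV (rmorph_nat (real_complex R)).
rewrite sqrrN !exprMn n2 s2 /decay /twopii.
have k2 : ka ^+ 2 = tau^-1 by rewrite -[LHS](mulfK t0) kt mul1r.
have p0 : pi%:C != 0 :> R[i] by rewrite -cmod_eq0 cmodR normr_eq0 gt_eqF// pi_gt0.
have i0 := @i_neq0 R; have i2 := @iiN1 R; rewrite k2.
apply: (mulfI i0); rewrite mulrN i2 opprK.
have H (I p : R[i]) : I != 0 -> p != 0 ->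
    I * (tau^-1 * (4 * p / (I * (2 * p) / tau)) * 2^-1) = 1.
  by move=> I0 p1; field; rewrite I0 p1 t0.
exact: H.
Qed.

Lemma powR_three_half (k : nat) : (0 < k)%N ->
  (k%:R : R) `^ (- (3 / 2)) = (k%:R * Num.sqrt k%:R)^-1.
Proof.
move=> k0; have kR : (k%:R : R) != 0 by rewrite pnatr_eq0 -lt0n.
have -> : (3 / 2 : R) = 1 + 2^-1 by field.
rewrite powRN powRD ?kR ?implybT// powRr1 ?powR12_sqrt//.
Qed.

End LeadingTerm.

(** * Coefficients of the knot state *)

Theorem theorem6p4 (R : realType)
  (K : knot) (ori : bool)
  (Delta : {poly int}) (d : nat) (hDelta : is_alexander K Delta d)
  (j : {linear (R * R)%type -> (R * R)%type}) (hj : compatible_structure j)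
  (delta : lmodType R[i]) (h : half_form j delta)
  (tau : R[i])
  (htau : lam R = complex.Re tau *: mu R + complex.Im tau *: j (mu R))
  (Omega_mu Omega_lam : delta)
  (hOmega_mu : phi h Omega_mu Omega_mu (mu R) = 1)
  (hOmega_lam : phi h Omega_lam Omega_lam (lam R) = 1)
  (t_lam : R * R -> R[i])
  (ht_lam : holo_on j 1 setT t_lam)
  (ht_lam1 : forall q : R, t_lam (q *: lam R) = 1)
  (Psi : forall k : nat, 'Z_(2 * k) -> R * R -> delta)
  (hPsi : forall k : nat, (0 < k)%N -> theta_basis h tau Omega_mu (Psi k))
  (Z : nat -> R * R -> delta)
  (hZ : forall k : nat, (0 < k)%N -> Z k = knot_state K (Psi k))
  (hi : @torus_point R @` microsupport h Z
        `<=` restriction ori @` @knot_moduli R K)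
  (hii : forall q : R, regular_point K ori Delta d q ->
     exists (V : set (R * R)) (m' : int) (f fcoef : nat -> R * R -> R[i]),
       [/\ open V /\ V (q *: lam R),
           forall q' : R, V (q' *: lam R) -> regular_point K ori Delta d q',
           (forall k : nat, (0 < k)%N -> smooth_on V (f k)) /\
           (forall n : nat, holo_on j 0 V (fcoef n)) /\
           smooth_expansion V f fcoef,
           (forall q' : R, V (q' *: lam R) ->
              let sigma := cexp (2 * 'i * pi%:C * q'%:C) in
              fcoef 0%N (q' *: lam R) =
              (Num.sqrt 2)^-1%:C * (sigma - sigma^-1)
                / laurent_eval Delta d (sigma ^+ 2)) &
           rapidly_small h
             (fun k x => Z k x -
                (cexp ('i * m'%:~R * pi%:C / 4)
                 * ((k%:R / (2 * pi)) `^ 4^-1)%:C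
                 * t_lam x ^+ k * f k x) *: Omega_lam) V])
  (eps : R) (heps : 0 < eps)
  (hirr : forall x : R * R, - eps < x.2 < eps ->
     ~ (restriction ori @` @knot_moduli_irr R K) (torus_point x))
  (hroot : forall q : R, - eps < q < eps ->
     laurent_eval Delta d (cexp (2 * 'i * pi%:C * q%:C)) != 0) :
  exists m : int, forall eta : R, 0 < eta < eps ->
    exists C : R, forall (k : nat) (l : int), (0 < k)%N ->
      `|l%:~R| <= k%:R * eta ->
      let sigma := cexp ('i * pi%:C * l%:~R / k%:R) in
      `|scalar_product h (Z k) (Psi k l%:~R)
        - cexp ('i * m%:~R * pi%:C / 4) / (2 * (Num.sqrt k%:R)%:C)
          * ((sigma - sigma^-1) / laurent_eval Delta d (sigma ^+ 2))|
      <= (C * k%:R `^ (- (3 / 2)))%:C.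
Proof.
pose F (q : R) : R[i] := (Num.sqrt 2)^-1%:C * (circ q - (circ q)^-1) /
  laurent_eval Delta d (circ q ^+ 2).
have sigmaE (q : R) : cexp (2 * 'i * pi%:C * q%:C) = circ q.
  by rewrite /circ [2 * 'i * _]mulrAC.
pose c (k : nat) (m : 'Z_(2 * k)) : R[i] := (sin (pi / k%:R) / Num.sqrt k%:R)%:C *
  colored_jones K m (- cexp ('i * pi%:C / (2 * k%:R))).
have hZc (k : nat) : (0 < k)%N -> Z k = fun x => \sum_m c k m *: Psi k m x.
  move=> k0; rewrite hZ//; apply/funext => x; rewrite /knot_state scaler_sumr.
  by apply: eq_bigr => m _; rewrite scalerA.
(* Off the characters of the knot group, hence off the microsupport: the only
   reducible characters of the strip lie over the lattice translates of the
   line. *)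
have off (x : R * R) : - eps < x.2 < eps -> (forall n : int, x.1 != n%:~R) ->
    ~ microsupport h Z x.
  move=> xe xn xM.
  have [H|[n xE]] := @knot_moduli_abelian R K ori x (hi _ (ex_intro2 _ _ x xM erefl)).
    exact: hirr xe H.
  by move: (xn n); rewrite xE eqxx.
have [nu nu2 [Cg hg]] := complex_gauss_sum (Re_decay_gt0 hj htau).
set ka := coord hOmega_mu Omega_lam.
pose om (m : int) : R[i] := cexp ('i * m%:~R * pi%:C / 4).
have omE m : om m = circ (m%:~R / 8) := eighth_circ m.
have om1 m : cmod (om m) = 1.
  by rewrite omE circE cmodE /= cos2Dsin2 sqrtr1.
pose good (q0 : R) (m : int) :=
  (exists r C : R, 0 < r /\ forall (k : nat) (l : int), (0 < k)%N -> C <= k%:R ->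
    `|- l%:~R / (2 * k%:R) - q0| <= r ->
    cmod (c k l%:~R - om m * ka * F (- l%:~R / (2 * k%:R)) * nu /
      (2 * (Num.sqrt k%:R)%:C)) <= C / (k%:R * Num.sqrt k%:R)) /\
  (exists2 r : R, 0 < r & forall q, `|q - q0| <= r ->
    has_phase (fun k q => coord hOmega_mu (Z k (0, q))) F ka q (om m)).
(* Heights within eps / 2 of q0 stay in the strip, which provides the radius
   for the decay away from the line. *)
have loc (q0 : R) : - eps / 2 < q0 < eps / 2 -> exists m, good q0 m.
  move=> qe; have reg := strip_regular hirr hroot qe.
  have [V [m [f [fcoef [[oV Vq] _ [_ [hol sexp]] hF rs]]]]] := hii _ reg.
  have [sf _] := hol 0%N; rewrite scale_lam in Vq.
  have hF' q : V (0, q) -> fcoef 0%N (0, q) = F q.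
    by move=> Vq'; have := hF q; rewrite scale_lam sigmaE; apply.
  exists m; split; last exact: (local_phase hj htau hOmega_mu ht_lam1 (om1 m) oV Vq sf sexp rs hF').
  have e2 : 0 < eps / 2 by rewrite divr_gt0.
  apply: (local_coefficient hj htau hOmega_mu ht_lam ht_lam1 hPsi hZc (om1 m) oV Vq sf
    sexp rs hF' e2 _ hg) => s q /andP[s0 s2] qq.
  apply: off => /= [|n].
    move: qe qq; rewrite ler_norml => /andP[h1 h2] /andP[h3 h4].
    by apply/andP; split; clear -h1 h2 h3 h4; lra.
  apply/eqP => sn; move: s0 s2; rewrite sn -intr_norm => s0.
  have : (1 <= `|n|)%R by rewrite -gtz0_ge1 -(ltr0z R).
  by rewrite -(ler1z R) => h1 h2; clear -h1 h2; lra.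
have [|mm Hm] := @choice R int (fun (q0 : R) m => - eps / 2 < q0 < eps / 2 -> good q0 m).
  move=> q0; have [/loc[m Hm]|n] := pselect (- eps / 2 < q0 < eps / 2); first by exists m.
  by exists 0.
have t0 := tau_neq0 hj htau.
have ka2 : ka ^+ 2 * tau = 1 := coord_Ol htau hOmega_mu hOmega_lam.
have ka0 : ka != 0.
  by apply: contraTneq (oner_neq0 R[i]) => k0; rewrite -ka2 k0 expr0n mul0r eqxx.
have const (q0 : R) : - eps / 2 < q0 < eps / 2 -> om (mm q0) = om (mm 0).
  have z0 : - eps / 2 < 0 < eps / 2 by apply/andP; split; clear -heps; lra.
  move=> q0e; apply: (@constant_phase R (fun k q => coord hOmega_mu (Z k (0, q))) F ka
    (- eps / 2) (eps / 2) (fun q => om (mm q)) ka0 _ _ q0 0 q0e z0).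
    move=> q /andP[q1 q2] qn.
    have c2 : circ q ^+ 2 = circ (2 * q) by rewrite expr2 -circD mulr2n mulrDl mul1r.
    have s2 : (Num.sqrt 2)^-1%:C != 0 :> R[i].
      by rewrite -cmod_eq0 cmodR normr_eq0 invr_eq0 gt_eqF// sqrtr_gt0.
    have qne : - eps < 2 * q < eps.
      by apply/andP; split; clear -q1 q2; lra.
    have := hroot _ qne; rewrite sigmaE -c2 => lau.
    rewrite /F; apply: mulf_neq0; last by rewrite invr_eq0.
    apply: mulf_neq0 => //; apply/eqP => /eqP; rewrite subr_eq0 => /eqP cV.
    have : circ (2 * q) = 1 by rewrite -c2 expr2 {2}cV mulfV// circ_neq0.
    by move=> /circ_eq1[n qE]; move: (qn n); rewrite qE eqxx.
  by move=> q /Hm[].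
have [m1 um1] := eighth_root (amplitude_square t0 ka2 nu2).
have [_ _ sD symD] := hDelta.
have leadE (k : nat) (l : int) (sigma := cexp ('i * pi%:C * l%:~R / k%:R)) :
    (0 < k)%N -> om (mm 0) * ka * F (- l%:~R / (2 * k%:R)) * nu /
      (2 * (Num.sqrt k%:R)%:C) =
    om (mm 0 + m1) / (2 * (Num.sqrt k%:R)%:C) *
      ((sigma - sigma^-1) / laurent_eval Delta d (sigma ^+ 2)).
  move=> k0; have kC : k%:R != 0 :> R[i] by rewrite pnatr_eq0 -lt0n.
  have sE : sigma = circ (l%:~R / (2 * k%:R)).
    rewrite /sigma /circ; congr cexp.
    rewrite (rmorphM (real_complex R)) fmorphV (rmorphM (real_complex R)).
    rewrite !(rmorph_nat (real_complex R)) (rmorph_int (real_complex R)).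
    have H (I p n : R[i]) : I * p * n / k%:R = 2 * p * I * (n / (2 * k%:R)) by field.
    exact: H.
  have s0 : sigma != 0 by rewrite sE circ_neq0.
  have omD : om (mm 0 + m1) = om (mm 0) * - (ka * nu * (Num.sqrt 2)^-1%:C).
    by rewrite um1 !omE -circD rmorphD /= mulrDl.
  (* The segment lies over - l / 2k: sigma is inverted, which changes the sign
     of the numerator and leaves the Alexander polynomial unchanged. *)
  rewrite /F mulNr circN -sE invrK exprVn laurent_eval_inv ?expf_neq0// omD.
  by ring.
exists (mm 0 + m1) => eta /andP[eta0 etae].
(* The local estimates hold from some level on; compactness makes this level
   uniform, and the remaining levels involve finitely many coefficients. *)
have [C0 HC0] : exists C0 : R, forall q : R, - (eta / 2) <= q <= eta / 2 ->
    forall (k : nat) (l : int), (0 < k)%N -> C0 <= k%:R -> - l%:~R / (2 * k%:R) = q ->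
    cmod (c k l%:~R - om (mm 0) * ka * F q * nu / (2 * (Num.sqrt k%:R)%:C)) <=
      C0 / (k%:R * Num.sqrt k%:R).
  have [|C0 H] := @compact_uniform R R _ (fun (q : R) C0 => forall (k : nat) (l : int),
    (0 < k)%N -> C0 <= k%:R -> - l%:~R / (2 * k%:R) = q ->
    cmod (c k l%:~R - om (mm 0) * ka * F q * nu / (2 * (Num.sqrt k%:R)%:C)) <=
      C0 / (k%:R * Num.sqrt k%:R)) (@segment_compact R (- (eta / 2)) (eta / 2)).
    move=> q0 /=; rewrite in_itv /= => /andP[qin1 qin2].
    have qe : - eps / 2 < q0 < eps / 2.
      by apply/andP; split; clear -qin1 qin2 etae; lra.
    have [[r [C [r0 HC]]] _] := Hm q0 qe; exists C.
    have nb : nbhs q0 (ball q0 r) by exact: nbhsx_ballx.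
    apply: filterS nb => q qr C' CC' k l k0 Ck ql.
    rewrite -(const q0 qe) -ql; apply: le_trans (HC k l k0 (le_trans CC' Ck) _) _.
      by rewrite ql distrC; exact: ltW.
    by rewrite ler_wpM2r// invr_ge0 mulr_ge0// sqrtr_ge0.
  by exists C0 => q qin; apply: H; rewrite /= in_itv.
have coefE (k : nat) (l : int) : (0 < k)%N ->
    scalar_product h (Z k) (Psi k l%:~R) = c k l%:~R.
  by move=> k0; rewrite hZc//; exact: (scalar_product_coefficient hOmega_mu (hPsi k k0) (c k)).
pose lead (k : nat) (l : int) : R[i] := let sigma := cexp ('i * pi%:C * l%:~R / k%:R) in
  om (mm 0 + m1) / (2 * (Num.sqrt k%:R)%:C) *
    ((sigma - sigma^-1) / laurent_eval Delta d (sigma ^+ 2)).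
pose T (k : nat) (l : int) : R :=
  cmod (scalar_product h (Z k) (Psi k l%:~R) - lead k l) * (k%:R * Num.sqrt k%:R).
have T0 k l : 0 <= T k l by rewrite !mulr_ge0 ?cmod_ge0 ?sqrtr_ge0.
pose N := (Num.trunc `|C0|).+1.
have [C1 HC1] := finitely_many_bounded N (Num.trunc (N%:R * eta)).+1 T0.
exists (`|C0| + `|C1|) => k l k0 lk; cbv zeta.
rewrite normE lecR powR_three_half//.
have W : 0 < k%:R * Num.sqrt k%:R :> R by rewrite mulr_gt0 ?sqrtr_gt0 ?ltr0n.
rewrite ler_pdivlMr// -/(lead k l) -/(T k l).
have [kN|Nk] := ltnP k N.
  apply: (@le_trans _ _ C1); last first.
    by apply: (le_trans (ler_norm _)); rewrite lerDr.
  apply: HC1 => //; rewrite -(ler_nat R) natr_absz intr_norm.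
  apply: (le_trans lk); apply: ltW; apply: le_lt_trans (truncnS_gt _).
  by rewrite ler_wpM2r ?(ltW eta0)// ler_nat ltnW.
apply: (@le_trans _ _ C0); last first.
  by apply: (le_trans (ler_norm _)); rewrite lerDl.
rewrite /T -ler_pdivlMr// coefE// /lead -leadE//; apply: HC0 => //.
  rewrite -ler_norml normrM normrN normfV [`|2 * _|]ger0_norm ?mulr_ge0//.
  rewrite ler_pdivrMr ?mulr_gt0 ?ltr0n//.
  by have -> : eta / 2 * (2 * k%:R) = k%:R * eta by field.
apply: (le_trans (ler_norm _)); apply: ltW.
by apply: lt_le_trans (truncnS_gt _) _; rewrite ler_nat.
Qed.
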